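(* For $a,b\in X(\mathbb{U})$, one has $\chi(a)=\chi(b)$ if and only if for any choice of a branch of $\pi^{-1}$ there is some $g\in G(\mathbb{C})$ so that $\pi(g\cdot\pi^{-1}(a))=b$. (Here $a$ and $b$ are regarded, after suitable restriction, as analytic maps from a ball $V\subseteq\mathbb{C}^n$ to $X(\mathbb{C})$; $\pi^{-1}(a)$ is an analytic lift $V\to U$ of $a$ through $\pi$; and the equality means that, after possibly shrinking $V$, $g\cdot\pi^{-1}(a)$ takes values in $U$ and its composite with $\pi$ is $b$.)
   Context: Standing data and hypotheses: - $n$ is a fixed natural number; a differential ring or field is one (fields of characteristic zero) with $n$ commuting derivations $\Delta=\{\partial_1,\dots,\partial_n\}$; $M^\Delta$ is its ring of constants. - $\mathbb{R}_{\mathcal{F}}$ is a fixed o-minimal expansion of the ordered field $\mathbb{R}$; ''definable'' means definable (with parameters) in $\mathbb{R}_{\mathcal{F}}$, identifying $\mathbb{C}$ with $\mathbb{R}^2$ and complex points of varieties with definable sets via finite affine charts. - $G$ is an algebraic group over $\mathbb{C}$; $Y$ is a complex algebraic variety; $G\times Y\to Y$ is a regular faithful action. - $U\subseteq Y(\mathbb{C})$ is a complex submanifold. - $\Gamma<G(\mathbb{C})$ is a Zariski dense, discrete subgroup acting, via the restriction of the action on $Y(\mathbb{C})$, as a group of automorphisms of $U$. - $X$ is a complex algebraic variety and $\pi:U\to X(\mathbb{C})$ is a complex analytic covering map expressing $X(\mathbb{C})$ as $\Gamma\backslash U$. - $F\subseteq Y(\mathbb{C})$ is an open definable subset of $Y(\mathbb{C})$,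 contained in $U$, such that $\pi\upharpoonright F:F\to X(\mathbb{C})$ is definable and surjective. - $\mathbb{U}$ is a differentially closed field, realized as a differential subfield of a differential field $M$ of germs of meromorphic functions in $n$ complex variables (derivations $\partial/\partial z_i$, constants $M^\Delta=\mathbb{C}$), over which the algebraic data $X,Y,Z,G,\widetilde\chi,\chi$ are defined. Definitions. For a variety $W$ over $\mathbb{C}$, $\mathcal{A}_mW$ represents $R\mapsto W(R[\epsilon_1,\dots,\epsilon_n]/(\epsilon_1,\dots,\epsilon_n)^{m+1})$, and for a differential ring $A$ whose constants contain the field of definition, $\nabla_m:W(A)\to\mathcal{A}_mW(A)$ is induced by $x\mapsto\sum_{|\alpha|\le m}\frac{1}{\alpha!}\partial^\alpha(x)\epsilon^\alpha$. A constructible function is one that is regular on each piece of a finite partition of the domain into locally closed subvarieties; a differential constructible function $W\to Z$ is one of the form $f_m\circ\nabla_m$ with $f_m:\mathcal{A}_mW\to Z$ constructible. $\widetilde\chi:Y\to Z$ is a differential constructible function to an algebraic variety $Z$ such that for every differential field $M$ with $M^\Delta=\mathbb{C}$ and all $a,b\in Y(M)$: $\widetilde\chi(a)=\widetilde\chi(b)$ if and only if $g\cdot a=b$ for some $g\in G(\mathbb{C})$. The generalized logarithmic derivative associated to $\pi$ is $\chi:=\widetilde\chi\circ\pi^{-1}:X\to Z$ (for any branch of $\pi^{-1}$): it is the well-defined differential constructible function with $\chi(a)=\widetilde\chi(\tilde a)$ whenever $a:V\to X(\mathbb{C})$ is analytic on a small polydisc $V$ and $\tilde a:V\to U$ is an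 analytic lift of $a$ through $\pi$. *)

(* Defs.v *)
From Stdlib Require List.
From HB Require Import structures.
From mathcomp Require Import all_boot all_order all_algebra.
From mathcomp Require Import complex.
(* The notations of mpoly clash with those of the analysis library, so
   multivariate polynomials are written [mpoly n K], multi-indices [multinom n],
   and [bmultinom n m] is the finite type of multi-indices of degree < m. *)
From mathcomp Require Import -(notations) mpoly.
From mathcomp Require Import all_classical all_reals all_analysis.

Set Implicit Arguments.
Unset Strict Implicit.
Unset Printing Implicit Defensive.

Import Order.TTheory GRing.Theory Num.Theory numFieldNormedType.Exports.
Local Open Scope classical_set_scope.
Local Open Scope ring_scope.

(* The alias makes the topology of numClosedFieldType's available on R[i]. *)
Definition Cx (R : realType) : numClosedFieldType := R[i].

Record diffFieldType (n : nat) := DiffField {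
  dsort :> fieldType ;
  deriv : 'I_n -> dsort -> dsort ;
  derivD : forall i x y, deriv i (x + y) = deriv i x + deriv i y ;
  derivM : forall i x y, deriv i (x * y) = deriv i x * y + x * deriv i y ;
  derivCA : forall i j x, deriv i (deriv j x) = deriv j (deriv i x) ;
  diff_char0 : [pchar dsort] =i pred0 }.

Definition derivs n (K : diffFieldType n) (a : multinom n) (x : K) : K :=
  foldr (fun i => iter (a i) (deriv i)) x (enum 'I_n).

Definition diff_hom n (K L : diffFieldType n) (f : K -> L) :=
  forall i x, f (deriv i x) = deriv i (f x).

Definition constants_are n (K : diffFieldType n) (k : Type) (iota : k -> K) :=
  forall x : K, (forall i, deriv i x = 0) <-> exists c, x = iota c.

Definition peval (k A : nzRingType) (iota : k -> A) N (x : 'rV[A]_N)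
    (P : mpoly N k) : A :=
  mmap iota (fun c => x 0 c) P.

(* Number of coordinates (c, a) with c < d and a a multi-index of degree <= m. *)
Notation njet n m d := #|{: 'I_d * bmultinom n m.+1}|.

Definition jet_index n m d (k : 'I_(njet n m d)) : 'I_d * bmultinom n m.+1 :=
  enum_val k.

Definition djet n (K : diffFieldType n) m N (y : 'rV[K]_N) :
    'rV[K]_(njet n m N) :=
  \row_k derivs (jet_index k).2 (y 0 (jet_index k).1).

Definition diff_closed n (K : diffFieldType n) :=
  forall (L : diffFieldType n) (phi : {rmorphism K -> L}), diff_hom phi ->
  forall m N (eqs ineqs : seq (mpoly (njet n m N) K)),
  (exists y : 'rV[L]_N,
     (forall P, P \in eqs -> peval phi (djet m y) P = 0) /\
     (forall P, P \in ineqs -> peval phi (djet m y) P <> 0)) ->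
  exists y : 'rV[K]_N,
     (forall P, P \in eqs -> peval idfun (djet m y) P = 0) /\
     (forall P, P \in ineqs -> peval idfun (djet m y) P <> 0).

Section Truncated.
Variables (n m : nat) (K : fieldType).

(* The ideal (eps_1, ..., eps_n)^(m+1) consists of the polynomials without terms
   of degree <= m. *)
Definition eps_ideal : {pred mpoly n K} :=
  [pred p | [forall a : bmultinom n m.+1, mcoeff a p == 0]].

Lemma eps_idealP p :
  reflect (forall a : multinom n, (mdeg a <= m)%N -> mcoeff a p = 0)
          (p \in eps_ideal).
Proof.
apply: (iffP forallP) => /= [h a am|h a].
  by have /eqP := h (@BMultinom n m.+1 a am).
by apply/eqP/h; case: a.
Qed.

Lemma eps_ideal_closed : idealr_closed eps_ideal.
Proof.
split=> [||p q1 q2 /eps_idealP h1 /eps_idealP h2].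
- by apply/eps_idealP => a _; rewrite mcoeff0.
- apply/negP => /eps_idealP /(_ mnm0); rewrite mdeg0 => /(_ isT).
  by rewrite mcoeff1 eqxx => /eqP; rewrite oner_eq0.
- apply/eps_idealP => a am; rewrite mcoeffD h2 // addr0 mcoeffM big1 //.
  move=> [u v] /= /eqP auv; rewrite [X in _ * X]h1 ?mulr0 //.
  apply: leq_trans am; have := congr1 mdeg auv.
  by rewrite mdegD => adeg; apply: leq_trans (leq_addl _ _) (eq_leq (esym adeg)).
Qed.

HB.instance Definition _ :=
  GRing.isZmodClosed.Build (mpoly n K) eps_ideal
    (idealr_closedB eps_ideal_closed).
HB.instance Definition _ :=
  isProperIdeal.Build (mpoly n K) eps_ideal
    (idealr_closed_nontrivial eps_ideal_closed).

(* K[eps_1, ..., eps_n] / (eps_1, ..., eps_n)^(m+1) *)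
Definition trunc : comNzRingType := {ideal_quot eps_ideal}.

Definition to_trunc : {rmorphism mpoly n K -> trunc} :=
  \pi_({ideal_quot eps_ideal})%qT.

Definition trunc_coef (a : multinom n) (x : trunc) : K :=
  mcoeff a (repr (x : {ideal_quot eps_ideal})).

End Truncated.

Definition trunc_emb n m (K : fieldType) (k : nzRingType)
    (iota : {rmorphism k -> K}) : {rmorphism k -> trunc n m K} :=
  to_trunc n m K \o @mpolyC n K \o iota.

Definition taylor n m (K : diffFieldType n) (x : K) : trunc n m K :=
  to_trunc n m K (\sum_(a : bmultinom n m.+1)
    (derivs a x / (\prod_(i < n) (a i)`!)%:R) *: mpolyX K a).

Definition jet_coord n m (K : fieldType) d (x : 'rV[trunc n m K]_d) :
    'rV[K]_(njet n m d) :=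
  \row_k trunc_coef (jet_index k).2 (x 0 (jet_index k).1).

Section Varieties.
Variable R : realType.
Local Notation C := (Cx R).

(* The rational map x |-> (fnum_c(x) / fden(x))_c. *)
Record frac (N d : nat) := Frac {
  fden : mpoly N C ;
  fnum : 'I_d -> mpoly N C }.

Definition frac_def (A : comNzRingType) (iota : C -> A) N d (f : frac N d)
    (x : 'rV[A]_N) :=
  exists u, peval iota x (fden f) * u = 1.

Definition frac_at (A : comNzRingType) (iota : C -> A) N d (f : frac N d)
    (x : 'rV[A]_N) (y : 'rV[A]_d) :=
  frac_def iota f x /\
  forall c, y 0 c * peval iota x (fden f) = peval iota x (fnum f c).

Definition zeros (A : nzRingType) (iota : C -> A) N (E : seq (mpoly N C))
    (x : 'rV[A]_N) :=
  forall P, P \in E -> peval iota x P = 0.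

(* Gluing data: the i-th chart is the closed subset of affine space cut out by
   [eqs i]; [glue i j] is a list of rational maps presenting the transition map
   from chart i to chart j, whose domain is the open set on which one of them
   is defined. *)
Record atlas := Atlas {
  nch : nat ;
  dim : 'I_nch -> nat ;
  eqs : forall i, seq (mpoly (dim i) C) ;
  glue : forall i j, seq (frac (dim i) (dim j)) }.

(* A-points of the i-th chart as a reduced affine variety: all polynomials
   vanishing at its complex points are imposed. *)
Definition chart_pt (A : comNzRingType) (iota : C -> A) (W : atlas) i
    (x : 'rV[A]_(@dim W i)) :=
  forall P, (forall z : 'rV[C]_(dim i), zeros idfun (eqs i) z ->
               peval idfun z P = 0) ->
            peval iota x P = 0.

Definition glued (A : comNzRingType) (iota : C -> A) (W : atlas) i
    (x : 'rV[A]_(@dim W i)) j (y : 'rV[A]_(@dim W j)) :=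
  [/\ chart_pt iota x, chart_pt iota y &
      exists2 f, List.In f (glue i j) & frac_at iota f x y].

(* The conditions are required of points in all extension fields of the complex
   numbers, that is at all scheme-theoretic points. The last one is
   separatedness. *)
Definition is_variety (W : atlas) :=
  (forall (K : fieldType) (iota : {rmorphism C -> K}),
    [/\ forall i j (x : 'rV[K]_(@dim W i)) (y : 'rV[K]_(@dim W j)) f,
          List.In f (glue i j) -> chart_pt iota x -> frac_at iota f x y ->
          chart_pt iota y,
        forall i (x y : 'rV[K]_(@dim W i)),
          glued iota x y <-> chart_pt iota x /\ x = y,
        forall i j (x : 'rV[K]_(@dim W i)) (y : 'rV[K]_(@dim W j)),
          glued iota x y -> glued iota y x &
        forall i j k (x : 'rV[K]_(@dim W i)) (y : 'rV[K]_(@dim W j))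
          (z : 'rV[K]_(@dim W k)),
          glued iota x y -> glued iota y z -> glued iota x z]) /\
  (forall i j, exists E : seq (mpoly (@dim W i + @dim W j) C),
    forall (K : fieldType) (iota : {rmorphism C -> K}) x y,
      chart_pt iota x -> chart_pt iota y ->
      (glued iota x y <-> zeros iota E (row_mx x y))).

Record variety := Variety { vatlas :> atlas ; _ : is_variety vatlas }.

(* A K-point is a class of glued chart points: [coord p i x] says that p has
   coordinates x in the i-th chart. *)
Record pt (K : fieldType) (iota : {rmorphism C -> K}) (W : variety) := Pt {
  coord : forall i : 'I_(nch W), 'rV[K]_(dim i) -> Prop ;
  _ : exists i (x : 'rV[K]_(dim i)), chart_pt iota x /\
        coord = fun j y => @glued K iota W i x j y }.

Definition Cpt (W : variety) := pt (idfun : {rmorphism C -> C}) W.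

(* The points with coordinates in a subring, e.g. those of W(C) in W(K). *)
Definition rational_pt (k : nzRingType) (K : fieldType) (phi : k -> K)
    (iota : {rmorphism C -> K}) (W : variety) (a : pt iota W) :=
  exists i (x : 'rV[k]_(dim i)), coord a (map_mx phi x).

(* A rational map into some chart of W. *)
Definition local_map N (W : variety) := {j : 'I_(nch W) & frac N (dim j)}.

Definition locally_into (K : fieldType) (iota : {rmorphism C -> K}) N
    (W : variety) (fs : seq (local_map N W)) (x : 'rV[K]_N) :=
  forall j f y, List.In (existT _ j f) fs -> frac_at iota f x y ->
    chart_pt iota y.

Definition local_value (K : fieldType) (iota : {rmorphism C -> K}) N
    (W : variety) (fs : seq (local_map N W)) (x : 'rV[K]_N) (q : pt iota W) :=
  exists j f y, [/\ List.In (existT _ j f) fs, frac_at iota f x y & coord q y].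

Definition rgraph (W1 W2 : variety)
    (F : forall i : 'I_(nch W1), seq (local_map (dim i) W2))
    (K : fieldType) (iota : {rmorphism C -> K}) (p : pt iota W1)
    (q : pt iota W2) :=
  exists i (x : 'rV[K]_(dim i)), coord p x /\ local_value (F i) x q.

Record rmap (W1 W2 : variety) := RMap {
  rdata : forall i : 'I_(nch W1), seq (local_map (dim i) W2) ;
  rinto : forall (K : fieldType) (iota : {rmorphism C -> K}) i
    (x : 'rV[K]_(@dim W1 i)), chart_pt iota x -> locally_into iota (rdata i) x ;
  rfun : forall (K : fieldType) (iota : {rmorphism C -> K}) (p : pt iota W1),
    exists! q, rgraph rdata p q }.

Definition rapp W1 W2 (f : rmap W1 W2) (K : fieldType)
    (iota : {rmorphism C -> K}) (p : pt iota W1) : pt iota W2 :=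
  projT1 (cid (rfun f p)).

Definition rgraph2 (W1 W2 W3 : variety)
    (F : forall (i : 'I_(nch W1)) (j : 'I_(nch W2)),
           seq (local_map (dim i + dim j) W3))
    (K : fieldType) (iota : {rmorphism C -> K}) (p : pt iota W1)
    (p' : pt iota W2) (q : pt iota W3) :=
  exists i j (x : 'rV[K]_(dim i)) (y : 'rV[K]_(dim j)),
    [/\ coord p x, coord p' y & local_value (F i j) (row_mx x y) q].

(* Regular maps W1 x W2 -> W3; the charts of W1 x W2 are the products of a chart
   of W1 and a chart of W2. *)
Record rmap2 (W1 W2 W3 : variety) := RMap2 {
  rdata2 : forall (i : 'I_(nch W1)) (j : 'I_(nch W2)),
    seq (local_map (dim i + dim j) W3) ;
  rinto2 : forall (K : fieldType) (iota : {rmorphism C -> K}) i j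
    (x : 'rV[K]_(@dim W1 i)) (y : 'rV[K]_(@dim W2 j)),
    chart_pt iota x -> chart_pt iota y ->
    locally_into iota (rdata2 i j) (row_mx x y) ;
  rfun2 : forall (K : fieldType) (iota : {rmorphism C -> K})
    (p : pt iota W1) (p' : pt iota W2), exists! q, rgraph2 rdata2 p p' q }.

Definition rapp2 W1 W2 W3 (f : rmap2 W1 W2 W3) (K : fieldType)
    (iota : {rmorphism C -> K}) (p : pt iota W1) (p' : pt iota W2) :
    pt iota W3 :=
  projT1 (cid (rfun2 f p p')).

Record alg_group := AlgGroup {
  gvar :> variety ;
  gone : Cpt gvar ;
  gmul : rmap2 gvar gvar gvar ;
  ginv : rmap gvar gvar ;
  gmulA : forall g h k : Cpt gvar,
    rapp2 gmul g (rapp2 gmul h k) = rapp2 gmul (rapp2 gmul g h) k ;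
  gmul1 : forall g : Cpt gvar, rapp2 gmul gone g = g ;
  gmulV : forall g : Cpt gvar, rapp2 gmul (rapp ginv g) g = gone }.

Definition is_faithful_action (G : alg_group) (Y : variety)
    (act : rmap2 G Y Y) :=
  [/\ forall y : Cpt Y, rapp2 act (gone G) y = y,
      forall (g h : Cpt G) (y : Cpt Y),
        rapp2 act (rapp2 (gmul G) g h) y = rapp2 act g (rapp2 act h y) &
      forall g : Cpt G,
        (forall y : Cpt Y, rapp2 act g y = y) -> g = gone G].

Definition subgroup (G : alg_group) (Gam : set (Cpt G)) :=
  [/\ Gam (gone G),
      forall g h, Gam g -> Gam h -> Gam (rapp2 (gmul G) g h) &
      forall g, Gam g -> Gam (rapp (ginv G) g)].

Definition zariski_closed (W : variety) (S : set (Cpt W)) :=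
  forall i : 'I_(nch W), exists E : seq (mpoly (dim i) C),
    forall (p : Cpt W) (x : 'rV[C]_(dim i)), coord p x ->
      (S p <-> zeros idfun E x).

Definition zariski_dense (W : variety) (S : set (Cpt W)) :=
  forall T : set (Cpt W), zariski_closed T -> S `<=` T -> T = setT.

(* A locally closed subset of affine N-space and a map on it. *)
Record piece (N : nat) (Z : variety) := Piece {
  peqs : seq (mpoly N C) ;
  pineqs : seq (mpoly N C) ;
  pmap : seq (local_map N Z) }.

Definition in_piece (K : fieldType) (iota : {rmorphism C -> K}) N Z
    (s : piece N Z) (x : 'rV[K]_N) :=
  zeros iota (peqs s) x /\ exists2 P, P \in pineqs s & peval iota x P <> 0.

Section Constructible.
Variables (n m : nat) (W Z : variety)
  (F : forall i : 'I_(nch W), seq (piece (njet n m (dim i)) Z)).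

(* [x] is a point of the i-th chart of W in K[eps]/(eps)^(m+1), that is a
   K-point of the i-th chart of A_m W; [F i] is evaluated at its coordinates. *)
Definition cgraph (K : fieldType) (iota : {rmorphism C -> K}) i
    (x : 'rV[trunc n m K]_(@dim W i)) (q : pt iota Z) :=
  exists2 s, List.In s (F i) &
    in_piece iota s (jet_coord x) /\ local_value (pmap s) (jet_coord x) q.

Definition is_constructible :=
  forall (K : fieldType) (iota : {rmorphism C -> K}),
  [/\ forall i (x : 'rV[trunc n m K]_(@dim W i)),
        chart_pt (trunc_emb n m iota) x ->
        exists! k, exists2 s, List.nth_error (F i) k = Some s &
          in_piece iota s (jet_coord x),
      forall i (x : 'rV[trunc n m K]_(@dim W i)) s,
        chart_pt (trunc_emb n m iota) x -> List.In s (F i) ->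
        in_piece iota s (jet_coord x) ->
        locally_into iota (pmap s) (jet_coord x),
      forall i (x : 'rV[trunc n m K]_(@dim W i)),
        chart_pt (trunc_emb n m iota) x ->
        exists q : pt iota Z, cgraph x q &
      forall i j (x : 'rV[trunc n m K]_(@dim W i))
        (y : 'rV[trunc n m K]_(@dim W j)) (q q' : pt iota Z),
        glued (trunc_emb n m iota) x y -> cgraph x q -> cgraph y q' -> q = q'].

End Constructible.

(* [cdata] presents a constructible function A_m W -> Z, with m = [cord]. *)
Record dconstr (n : nat) (W Z : variety) := DConstr {
  cord : nat ;
  cdata : forall i : 'I_(nch W), seq (piece (njet n cord (dim i)) Z) ;
  _ : is_constructible cdata }.

(* [dvalue f p q] says that f_m (nabla_m p) = q. *)
Definition dvalue n W Z (f : dconstr n W Z) (K : diffFieldType n)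
    (iota : {rmorphism C -> K}) (p : pt iota W) (q : pt iota Z) :=
  exists i (x : 'rV[K]_(dim i)),
    coord p x /\ cgraph (cdata f) (map_mx (@taylor n (cord f) K) x) q.

Definition same_dvalue n W1 W2 Z (f : dconstr n W1 Z) (g : dconstr n W2 Z)
    (K : diffFieldType n) (iota : {rmorphism C -> K})
    (p : pt iota W1) (p' : pt iota W2) :=
  exists2 q, dvalue f p q & dvalue g p' q.

Section DefinedOver.
Variable k : set C.

Definition poly_over N (P : mpoly N C) := forall a, k (mcoeff a P).
Definition polys_over N (E : seq (mpoly N C)) := forall P, P \in E -> poly_over P.
Definition frac_over N d (f : frac N d) :=
  poly_over (fden f) /\ forall c, poly_over (fnum f c).
Definition local_maps_over N W (fs : seq (local_map N W)) :=
  forall j f, List.In (existT _ j f) fs -> frac_over f.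
Definition variety_over (W : variety) :=
  (forall i, polys_over (@eqs W i)) /\
  (forall i j f, List.In f (@glue W i j) -> frac_over f).
Definition group_over (G : alg_group) :=
  [/\ variety_over G, forall i j, local_maps_over (rdata2 (gmul G) i j) &
      forall i, local_maps_over (rdata (ginv G) i)].
Definition dconstr_over n W Z (f : dconstr n W Z) :=
  forall i s, List.In s (cdata f i) ->
  [/\ polys_over (peqs s), polys_over (pineqs s) & local_maps_over (pmap s)].

End DefinedOver.

(* f is the sum of a convergent power series around a. *)
Definition analytic_at n (f : 'rV[C]_n -> C) (a : 'rV[C]_n) :=
  exists (c : multinom n -> C) (r B : C),
    [/\ 0 < r, forall u, `|c u| * r ^+ mdeg u <= B &
        forall z, ball a r z ->
          (fun N => \sum_(u : bmultinom n N)
             c u * \prod_(i < n) (z 0 i - a 0 i) ^+ u i) @ \oo --> f z].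

Definition analytic_vect_at n d (f : 'rV[C]_n -> 'rV[C]_d) (a : 'rV[C]_n) :=
  forall k, analytic_at (fun z => f z 0 k) a.

(* Maps from an open subset V of C^n. *)
Definition analytic_map n (W : variety) (V : set 'rV[C]_n)
    (f : 'rV[C]_n -> Cpt W) :=
  forall z, V z -> exists (i : 'I_(nch W)) (F : 'rV[C]_n -> 'rV[C]_(dim i)),
    analytic_vect_at F z /\ \forall w \near z, coord (f w) (F w).

(* Maps on a subset D of W1(C): locally restrictions of analytic maps of the
   ambient affine spaces. *)
Definition analytic_on (W1 W2 : variety) (D : set (Cpt W1))
    (f : Cpt W1 -> Cpt W2) :=
  forall p, D p -> exists (i : 'I_(nch W1)) (x : 'rV[C]_(dim i))
      (j : 'I_(nch W2)) (F : 'rV[C]_(dim i) -> 'rV[C]_(dim j)),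
    [/\ coord p x, analytic_vect_at F x &
        \forall w \near x, forall q, D q -> coord q w -> coord (f q) (F w)].

Definition near_pt (W : variety) (p : Cpt W) (S : set (Cpt W)) :=
  exists (i : 'I_(nch W)) (x : 'rV[C]_(dim i)),
    coord p x /\ \forall w \near x, forall q, coord q w -> S q.

Definition open_pts (W : variety) (S : set (Cpt W)) :=
  forall p, S p -> near_pt p S.

Definition discrete_pts (W : variety) (S : set (Cpt W)) :=
  forall p, S p -> near_pt p [set q | S q -> q = p].

(* Near each of its points, U is carried by a biholomorphism [Phi] between open
   sets of affine space onto the linear subspace of points whose coordinates of
   index >= e vanish. *)
Definition submanifold (W : variety) (U : set (Cpt W)) :=
  forall p, U p -> exists (i : 'I_(nch W)) (x : 'rV[C]_(dim i)) (e : nat)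
      (Phi Psi : 'rV[C]_(dim i) -> 'rV[C]_(dim i)),
    [/\ coord p x,
        analytic_vect_at Phi x /\ (\forall w \near x, Psi (Phi w) = w),
        analytic_vect_at Psi (Phi x) /\
          (\forall v \near Phi x, Phi (Psi v) = v) &
        \forall w \near x, (exists2 q, U q & coord q w) <->
          (forall k : 'I_(dim i), (e <= k)%N -> Phi w 0 k = 0)].

Definition analytic_covering (Y X : variety) (U : set (Cpt Y))
    (pi : Cpt Y -> Cpt X) :=
  [/\ analytic_on U pi, pi @` U = setT &
      forall q, exists O : set (Cpt X), [/\ open_pts O, O q &
        exists sheets : set (set (Cpt Y)),
        [/\ forall s, sheets s -> exists2 O', open_pts O' & s = U `&` O',
            forall s t, sheets s -> sheets t -> s `&` t !=set0 -> s = t,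
            U `&` pi @^-1` O = \bigcup_(s in sheets) s &
            forall s, sheets s -> exists sigma : Cpt X -> Cpt Y,
              [/\ analytic_on O sigma,
                  forall q', O q' -> s (sigma q') /\ pi (sigma q') = q' &
                  forall u, s u -> sigma (pi u) = u]]]].

(* An expansion of the real field is given by its sets definable with
   parameters. *)
Record ominimal_expansion := OMinimal {
  def : forall k, set (set 'rV[R]_k) ;
  def0 : forall k, def (@set0 'rV[R]_k) ;
  defC : forall k (A : set 'rV[R]_k), def A -> def (~` A) ;
  defU : forall k (A B : set 'rV[R]_k), def A -> def B -> def (A `|` B) ;
  def_prodl : forall k (A : set 'rV[R]_k), def A ->
    def [set x : 'rV[R]_(1 + k) | A (rsubmx x)] ;
  def_prodr : forall k (A : set 'rV[R]_k), def A ->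
    def [set x : 'rV[R]_(k + 1) | A (lsubmx x)] ;
  def_diag : forall k, def [set x : 'rV[R]_k.+1 | x 0 ord0 = x 0 ord_max] ;
  def_proj : forall k (A : set 'rV[R]_(k + 1)), def A ->
    def [set lsubmx x | x in A] ;
  def_const : forall r, def [set x : 'rV[R]_1 | x 0 0 = r] ;
  def_lt : def [set x : 'rV[R]_2 | x 0 ord0 < x 0 ord_max] ;
  def_add : def [set x : 'rV[R]_3 | x 0 (inord 0) + x 0 (inord 1) = x 0 (inord 2)] ;
  def_mul : def [set x : 'rV[R]_3 | x 0 (inord 0) * x 0 (inord 1) = x 0 (inord 2)] ;
  def_omin : forall A : set 'rV[R]_1, def A ->
    exists s : seq (interval R), forall x, A x <-> has (fun I => x 0 0 \in I) s }.

Variable O : ominimal_expansion.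

Definition definableC N (A : set 'rV[C]_N) :=
  def O [set row_mx (map_mx (@complex.Re R) z) (map_mx (@complex.Im R) z)
        | z in A].

Definition definable_pts (W : variety) (D : set (Cpt W)) :=
  forall i : 'I_(nch W),
    definableC [set x : 'rV[C]_(dim i) | exists2 p, D p & coord p x].

Definition definable_map (W1 W2 : variety) (D : set (Cpt W1))
    (f : Cpt W1 -> Cpt W2) :=
  forall (i : 'I_(nch W1)) (j : 'I_(nch W2)),
    definableC [set z : 'rV[C]_(dim i + dim j) |
      exists2 p, D p & coord p (lsubmx z) /\ coord (f p) (rsubmx z)].

End Varieties.

Section Germs.
Variable R : realType.
Local Notation C := (Cx R).

(* An embedding of differential fields over C of K in the field of germs at p of
   meromorphic functions: x is sent to the germ of [num x] / [den x]. *)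
Record germ_field n (K : diffFieldType n) (iota : C -> K) (p : 'rV[C]_n) :=
  GermField {
  num : K -> 'rV[C]_n -> C ;
  den : K -> 'rV[C]_n -> C ;
  num_analytic : forall x, analytic_at (num x) p ;
  den_analytic : forall x, analytic_at (den x) p ;
  den_neq0 : forall x, ~ (\forall z \near p, den x z = 0) ;
  germ_const : forall c, \forall z \near p, num (iota c) z = c * den (iota c) z ;
  germ_add : forall x y, \forall z \near p,
    num (x + y) z * (den x z * den y z) =
    den (x + y) z * (num x z * den y z + num y z * den x z) ;
  germ_mul : forall x y, \forall z \near p,
    num (x * y) z * (den x z * den y z) = den (x * y) z * (num x z * num y z) ;
  germ_deriv : forall i x, \forall z \near p,
    num (deriv i x) z * den x z ^+ 2 =
    den (deriv i x) z *
      ('D_(delta_mx 0 i) (num x) z * den x z -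
       num x z * 'D_(delta_mx 0 i) (den x) z) }.

Section Realization.
Variables (n : nat) (K : diffFieldType n) (iota : {rmorphism C -> K})
  (p : 'rV[C]_n) (real : germ_field iota p) (W : variety R).

(* The germ at p of the analytic map f is the K-point a. *)
Definition has_germ (f : 'rV[C]_n -> Cpt W) (a : pt iota W) :=
  exists i (x : 'rV[K]_(dim i)) (w : 'rV[C]_n -> 'rV[C]_(dim i)),
    coord a x /\ \forall z \near p, coord (f z) (w z) /\
      forall c, w z 0 c * den real (x 0 c) z = num real (x 0 c) z.

(* f is the K-point a regarded as an analytic map on V; V need not contain p, as
   the coordinates of a may have poles there. *)
Definition realizes (a : pt iota W) (V : set 'rV[C]_n)
    (f : 'rV[C]_n -> Cpt W) :=
  analytic_map V f /\
  exists i (x : 'rV[K]_(dim i)), coord a x /\ forall z, V z ->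
    (forall c, den real (x 0 c) z <> 0) /\
    coord (f z) (\row_c (num real (x 0 c) z / den real (x 0 c) z)).

End Realization.

Definition is_lift n (Y X : variety R) (U : set (Cpt Y))
    (pi : Cpt Y -> Cpt X) (V : set 'rV[C]_n) (f : 'rV[C]_n -> Cpt X)
    (ft : 'rV[C]_n -> Cpt Y) :=
  analytic_map V ft /\ forall z, V z -> U (ft z) /\ pi (ft z) = f z.

Definition separates_orbits n (G : alg_group R) (Y Z : variety R)
    (act : rmap2 G Y Y) (chit : dconstr n Y Z) :=
  forall (K : diffFieldType n) (iota : {rmorphism C -> K}),
    constants_are iota ->
  forall a b : pt iota Y,
    same_dvalue chit chit a b <->
    exists2 g : pt iota G, rational_pt iota g & rapp2 act g a = b.

(* chi is computed by applying chit to analytic lifts through pi, both being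
   evaluated in differential fields of germs of meromorphic functions. *)
Definition is_log_derivative n (Y X Z : variety R) (U : set (Cpt Y))
    (pi : Cpt Y -> Cpt X) (chit : dconstr n Y Z) (chi : dconstr n X Z) :=
  forall (K : diffFieldType n) (iota : {rmorphism C -> K}) (q : 'rV[C]_n)
    (real : germ_field iota q), constants_are iota ->
  forall (r : C) f ft (a : pt iota X) (at' : pt iota Y), 0 < r ->
    analytic_map (ball q r) f -> is_lift U pi (ball q r) f ft ->
    has_germ real f a -> has_germ real ft at' ->
    same_dvalue chi chit a at'.

End Germs.

(* Main.v *)
(** For a point q, the germs at q of meromorphic functions form a differential
    field with constants C, and an analytic map to a variety near q is a point
    over this field. Over balls, analytic maps lift through the covering pi, by
    continuation along segments. If at, bt are lifts of a, b, the defining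
    property of chi gives chi(a) = chit(at) and chi(b) = chit(bt), and
    chit(at) = chit(bt) means g.at = bt for some g in G(C). As an identity of
    germs this says that g.at = bt on a smaller ball, whence pi(g.at) = b there;
    conversely, if pi(g.at) = b then g.at is itself a lift of b. The equality
    chi(a) = chi(b), stated in the abstract field M, is moved to the germ field
    at a nearby point c through the field of meromorphic functions on a ball
    centred at p: embeddings of differential fields preserve and reflect it,
    because taking Taylor jets commutes with them. *)

Require Import Defs.
From HB Require Import structures.
From mathcomp Require Import all_boot all_order all_algebra.
From mathcomp Require Import complex.
From mathcomp Require Import -(notations) mpoly.
From mathcomp Require Import all_classical all_reals all_analysis.
From mathcomp Require Import ring lra.
Import Defs.

Set Implicit Arguments.
Unset Strict Implicit.
Unset Printing Implicit Defensive.

Import Order.TTheory GRing.Theory Num.Theory numFieldNormedType.Exports.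
Local Open Scope classical_set_scope.
Local Open Scope ring_scope.

(** * Limits and neighbourhoods *)

(** [M] is realized by germs at [p] alone, and its elements may have poles there. So [a] and [b]
    become analytic maps only near other points [c], while no map leads from germs at [p] to germs
    at [c]. Only the finitely many coordinates of [a] and [b] matter: their numerators and
    denominators converge on one ball about [p], and the field of that ball restricts to both germ
    fields. Zeros of a denominator may form a hypersurface through the point considered, so
    identities between germs can be evaluated only off such a set ([generically]); this is where the
    smaller ball [ball c' r'] comes from. Analytic functions are handled by power series alone. A
    weighted [l^1]-norm of the coefficients controls products, inverses and substitution through
    geometric series, differentiation costs a little radius, and the identity theorem follows from
    uniqueness of coefficients and continuation along segments. Hence convex domains: there an
    analytic function with one zero germ has only zero germs, so nonzero quotients are
    invertible. *)

Section ComplexLimits.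
Variable R : realType.
Local Notation C := (Cx R).
Implicit Types (x y : C).

Lemma half_itv x : 0 < x -> 0 < x / 2 < x.
Proof. by move=> x0; rewrite divr_gt0 // ltr_pdivrMr // ltr_pMr // ltr1n. Qed.

(** The order on [R[i]] compares only numbers with equal imaginary parts, so radii and bounds typed
    in [C] are real; estimates are reduced to the reals in this way. *)
Lemma ge0_complexP x : 0 <= x -> exists2 y : R, 0 <= y & x = (y%:C)%C.
Proof.
case: x => a b; rewrite lecE /= => /andP[/eqP b0 a0].
by exists a => //; rewrite b0.
Qed.

Lemma rV_ballP n (a z : 'rV[C]_n) (r : C) :
  ball a r z <-> 0 < r /\ forall i, `|z 0 i - a 0 i| < r.
Proof.
split=> [[r0 h]|[r0 h]]; split=> // i.
  by move: (h 0 i); rewrite /ball /= distrC.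
by move=> k; rewrite ord1 /ball /= distrC.
Qed.

Lemma cvg_norm_le (u : nat -> C) (l b : C) (N0 : nat) :
  (forall N, (N0 <= N)%N -> `|u N| <= b) -> u @ \oo --> l -> `|l| <= b.
Proof.
move=> ub ul.
have b0 : 0 <= b by apply: le_trans (ub _ (leqnn _)).
rewrite real_leNgt ?ger0_real //; apply/negP => bl.
have e0 : 0 < `|l| - b by rewrite subr_gt0.
have /cvgrPdist_lt /(_ _ e0) [N1 _ h] := ul.
have := h (maxn N0 N1) (leq_maxr _ _); apply/negP.
rewrite -real_leNgt ?realB ?ger0_real //.
have := ub _ (leq_maxl N0 N1); set v := u _ => vb.
by rewrite (le_trans _ (lerB_dist _ _)) // lerD2l lerN2.
Qed.

Lemma expr_small (q e B : C) : 0 <= q < 1 -> 0 < e -> 0 <= B ->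
  exists N, forall k, (N <= k)%N -> q ^+ k * B < e.
Proof.
move=> /andP[q0 q1] e0 B0.
have [t t0 qt] := ge0_complexP q0; have [b b0 Bb] := ge0_complexP B0.
have [d d0 ed] := ge0_complexP (ltW e0).
have t1 : t < 1 by move: q1; rewrite qt ltcE /= eqxx.
have {}d0 : 0 < d by move: e0; rewrite ed ltcE /= eqxx.
have : (fun k => t ^+ k * b) @ \oo --> 0 * b.
  by apply: cvgMl; apply: cvg_expr; rewrite ger0_norm.
rewrite mul0r => /cvgrPdist_lt /(_ _ d0) [N _ h]; exists N => k /h.
rewrite sub0r normrN ger0_norm ?mulr_ge0 ?exprn_ge0 // => hk.
rewrite qt Bb ed -rmorphXn -rmorphM ltcE /= eqxx //.
Qed.

(** Completeness of the reals, applied to real and imaginary parts. *)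
Lemma complex_cauchy (u : nat -> C) :
  (forall e : C, 0 < e -> exists N, forall k, (N <= k)%N -> `|u k - u N| < e) ->
  exists l : C, u @ \oo --> l.
Proof.
move=> cu.
have Rle (z : C) (d : R) : `|z| < (d%:C)%C ->
    `|complex.Re z| < d /\ `|complex.Im z| < d.
  rewrite normc_def ltcE /= => /andP[_ h]; split; apply: le_lt_trans h.
    by rewrite -sqrtr_sqr ler_wsqrtr // lerDl sqr_ge0.
  by rewrite -sqrtr_sqr ler_wsqrtr // lerDr sqr_ge0.
have part (p : C -> R) : (forall z w, p (z - w) = p z - p w) ->
   (forall (z : C) (d : R), `|z| < (d%:C)%C -> `|p z| < d) -> cvgn (p \o u).
  move=> pB pd; apply: cauchy_cvg; apply: cauchy_exP => d d0.
  have [N hN] := cu (d%:C)%C ltac:(by rewrite ltcE /= eqxx).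
  exists (p (u N)); exists N => // k /= /hN h.
  by rewrite /ball /= distrC -pB pd.
have /cvgrPdist_lt cr : cvgn (complex.Re (R:=R) \o u).
  by apply: part => [[a b] [a' b']|z d /Rle[]].
have /cvgrPdist_lt ci : cvgn (complex.Im (R:=R) \o u).
  by apply: part => [[a b] [a' b']|z d /Rle[]].
set a := lim _ in cr; set b := lim _ in ci.
exists (Complex a b : C); apply/cvgrPdist_lt => e e0.
have [d d0 ed] := ge0_complexP (ltW e0).
have {}d0 : 0 < d by move: e0; rewrite ed ltcE /= eqxx.
(* Half of [d] suffices for each part, since the two squares then add up to less than [d ^+ 2]. *)
have d20 : 0 < d / 2 by rewrite divr_gt0.
near=> k.
have h1 : `|a - complex.Re (u k)| < d / 2 by near: k; exact: cr.
have h2 : `|b - complex.Im (u k)| < d / 2 by near: k; exact: ci.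
move: h1 h2; case: (u k) => [x y] /= h1 h2.
rewrite normc_def ed ltcE /= eqxx /=.
rewrite -(@ltr_pXn2r _ 2) ?nnegrE ?sqrtr_ge0 ?ltW //.
rewrite sqr_sqrtr ?addr_ge0 ?sqr_ge0 //.
have s1 : (a - x) ^+ 2 < (d / 2) ^+ 2.
  by rewrite -real_normK ?num_real // ltr_pXn2r ?nnegrE ?normr_ge0 ?ltW.
have s2 : (b - y) ^+ 2 < (d / 2) ^+ 2.
  by rewrite -real_normK ?num_real // ltr_pXn2r ?nnegrE ?normr_ge0 ?ltW.
nra.
Unshelve. all: by end_near. Qed.

End ComplexLimits.

Section NearRow.
Variables (R : realType) (n : nat).
Implicit Types (a : 'rV[Cx R]_n) (P Q S : 'rV[Cx R]_n -> Prop).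

Lemma near_rV_ball a P : (\forall z \near a, P z) <->
  exists2 r : Cx R, 0 < r & forall z, ball a r z -> P z.
Proof.
by split=> [/nbhs_ballP[r r0 h]|[r r0 h]]; [exists r|apply/nbhs_ballP; exists r].
Qed.

Lemma near_rV_mono a P Q : (forall z, P z -> Q z) ->
  (\forall z \near a, P z) -> \forall z \near a, Q z.
Proof. by move=> PQ; apply: (@filterS _ _ (nbhs_filter a) P Q PQ). Qed.

Lemma near_rV_mono2 a P Q S : (forall z, P z -> Q z -> S z) ->
  (\forall z \near a, P z) -> (\forall z \near a, Q z) -> \forall z \near a, S z.
Proof. by move=> PQ; apply: (@filterS2 _ _ (nbhs_filter a) P Q S PQ). Qed.

Lemma near_rV_all a P : (forall z, P z) -> \forall z \near a, P z.
Proof. by move=> PT; apply/near_rV_ball; exists 1. Qed.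

Lemma near_rV_self a P : (\forall z \near a, P z) -> P a.
Proof. by move=> /near_rV_ball[r r0]; apply; exact: ballxx. Qed.

Lemma near_rV_near a P : (\forall z \near a, P z) ->
  \forall z \near a, \forall w \near z, P w.
Proof. by move=> h; exact: (nbhs_interior h). Qed.

Lemma near_rV_forall (I : finType) a (P : I -> 'rV[Cx R]_n -> Prop) :
  (forall i, \forall z \near a, P i z) -> \forall z \near a, forall i, P i z.
Proof.
move=> h.
suff H : \forall z \near a, forall i, i \in enum I -> P i z.
  by apply: near_rV_mono H => z Hz i; apply: Hz; rewrite mem_enum.
elim: (enum I) => [|i l IH]; first exact: near_rV_all.
apply: near_rV_mono2 (h i) IH => z hi hl k.
by rewrite inE => /predU1P[->|/hl].
Qed.

End NearRow.

(** * Absolutely convergent power series *)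

Section PowerSeries.
Variable R : realType.
Local Notation C := (Cx R).

Section Monomials.
Variable n : nat.
Implicit Types (u v : multinom n) (w : 'I_n -> C) (c d : multinom n -> C).

Lemma mnm_neq0P u : u != mnm0 -> exists i, u i != 0%N.
Proof.
move=> u0; apply: contrapT => h; move/eqP: u0; apply; apply/mnmP => i.
by rewrite mnm0E; apply/eqP; apply: contrapT => ui; apply: h; exists i; apply/negP.
Qed.

Lemma mnm_sub1K u i : u i != 0%N -> mnm_add (mnm_sub u (mnm1 i)) (mnm1 i) = u.
Proof. by move=> ui; apply: submK; rewrite lep1mP. Qed.

Definition mon w u : C := \prod_(i < n) w i ^+ u i.

Lemma mon_add w u v : mon w (mnm_add u v) = mon w u * mon w v.
Proof.
by rewrite /mon -big_split; apply: eq_bigr => i _; rewrite mnmDE exprD.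
Qed.

Lemma mon_le w t u : (forall i, `|w i| <= t) -> `|mon w u| <= t ^+ mdeg u.
Proof.
move=> wt; rewrite /mon normr_prod mdegE -prodrXr; apply: ler_prod => i _.
by rewrite normr_ge0 normrX lerXn2r ?nnegrE ?(le_trans _ (wt i)).
Qed.

Lemma bmultinom_widen (V : nmodType) N M (F : multinom n -> V) :
  (N <= M)%N ->
  \sum_(u : bmultinom n N) F u = \sum_(u : bmultinom n M | (mdeg u < N)%N) F u.
Proof.
move=> NM; pose h (u : bmultinom n N) := BMultinom (leq_trans (bmdeg u) NM).
rewrite (reindex_omap h (fun v : bmultinom n M => insub (v : multinom n))) /=.
  by apply: eq_bigl => u; rewrite bmdeg valK eqxx.
by move=> v vN; rewrite insubT /=; congr Some; apply: val_inj.
Qed.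

Lemma sum_bmultinom1 (V : nmodType) N u (F : multinom n -> V) :
  (mdeg u < N)%N -> \sum_(v : bmultinom n N | (v : multinom n) == u) F v = F u.
Proof.
move=> uN; rewrite (big_pred1 (BMultinom uN)) //.
Qed.

(** The Cauchy product. Both parts of a decomposition of [u] have degree at most [mdeg u], so
    truncating at [(mdeg u).+1] loses no term. *)
Definition cmul c d u : C :=
  \sum_(v : bmultinom n (mdeg u).+1)
    \sum_(v' : bmultinom n (mdeg u).+1 | mnm_add v v' == u) c v * d v'.

Lemma cmul_widen M c d u : (mdeg u < M)%N -> cmul c d u =
  \sum_(v : bmultinom n M) \sum_(v' : bmultinom n M | mnm_add v v' == u)
    c v * d v'.
Proof.
move=> uM; rewrite /cmul.
under eq_bigr => v _.
  rewrite big_mkcond /=.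
  rewrite (bmultinom_widen (fun v' => if mnm_add v v' == u then c v * d v' else 0) uM).
  over.
rewrite (bmultinom_widen (fun v => \sum_(v' : bmultinom n M | (mdeg v' < (mdeg u).+1)%N)
  if mnm_add v v' == u then c v * d v' else 0) uM) /=.
rewrite big_mkcond /=; apply: eq_bigr => v _.
rewrite -big_mkcondr /=; case: ifP => [_|/negbT vu].
  apply: eq_bigl => v'; rewrite andb_idl // => /eqP <-.
  by rewrite mdegD ltnS leq_addl.
rewrite big_pred0 // => v'; apply/eqP => uE; move: vu.
by rewrite -uE mdegD ltnS leq_addr.
Qed.

Lemma sum_cmul N (G : multinom n -> multinom n -> C) :
  \sum_(u : bmultinom n N) \sum_(v : bmultinom n N)
    \sum_(v' : bmultinom n N | mnm_add v v' == u) G v v' =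
  \sum_(v : bmultinom n N) \sum_(v' : bmultinom n N | (mdeg v + mdeg v' < N)%N)
    G v v'.
Proof.
rewrite exchange_big /=; apply: eq_bigr => v _.
rewrite (exchange_big_dep predT) //= [RHS]big_mkcond /=.
apply: eq_bigr => v' _; case: ifP => vN.
  under eq_bigl => u do rewrite eq_sym.
  by rewrite (@sum_bmultinom1 C N _ (fun=> G v v')) // mdegD.
rewrite big_pred0 // => u; apply/eqP => uE; move: vN.
by rewrite -mdegD uE bmdeg.
Qed.

(** Multi-indices of degree below [N] embed into the cube of exponents below [N], over which the sum
    is the [n]-th power of a geometric sum. *)
Lemma sum_geom_bmultinom N (q : C) : 0 <= q < 1 ->
  \sum_(u : bmultinom n N) q ^+ mdeg u <= ((1 - q)^-1) ^+ n.
Proof.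
move=> /andP[q0 q1].
have ub : forall u : bmultinom n N, forall i, (u i < N)%N.
  by move=> u i; apply: leq_ltn_trans (bmdeg u); rewrite mdegE (bigD1 i) //= leq_addr.
pose h (u : bmultinom n N) : {ffun 'I_n -> 'I_N} := [ffun i => Ordinal (ub u i)].
have hI : injective h.
  move=> u v /ffunP huv; apply/val_inj/mnmP => i.
  by have := congr1 val (huv i); rewrite !ffunE.
have s1 : \sum_(k < N) q ^+ k <= (1 - q)^-1.
  have q0' : 0 < 1 - q by rewrite subr_gt0.
  rewrite -(ler_pM2l q0') mulfV ?gt_eqF //.
  have := subrX1 q N; set s := \sum_(k < N) _ => e.
  have -> : (1 - q) * s = 1 - q ^+ N by rewrite -opprB mulNr -e opprB.
  by rewrite gerBl exprn_ge0.
apply: le_trans (_ : \prod_(i < n) \sum_(k < N) q ^+ k <= _); last first.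
  rewrite prodr_const card_ord lerXn2r ?nnegrE //.
    by apply: sumr_ge0 => k _; rewrite exprn_ge0.
  by rewrite invr_ge0 subr_ge0 ltW.
rewrite bigA_distr_bigA /=.
have -> : \sum_(u : bmultinom n N) q ^+ mdeg u =
    \sum_(f in (h @: predT)%SET) \prod_(i < n) q ^+ f i.
  rewrite big_imset /=; last by move=> u v _ _ /hI.
  apply: eq_bigr => u _; rewrite mdegE -prodrXr.
  by apply: eq_bigr => i _; rewrite ffunE.
rewrite [leRHS](bigID (fun f => f \in (h @: predT)%SET)) /=.
rewrite lerDl sumr_ge0 // => f _; apply: prodr_ge0 => i _.
by rewrite exprn_ge0.
Qed.

End Monomials.

Section Fixed.
Variable n : nat.
Implicit Types (u v : multinom n) (w : 'I_n -> C) (c d : multinom n -> C).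
Implicit Types (a z : 'rV[C]_n) (r s t : C) (f g : 'rV[C]_n -> C).

Definition disp a z : 'I_n -> C := fun i => z 0 i - a 0 i.

Definition psum c w N : C := \sum_(u : bmultinom n N) c u * mon w u.

(** [analytic_at] bounds the terms one by one; bounding the whole weighted sum is the form stable
    under products. [analytic_normP] passes between the two. *)
Definition abs_bound r c s := forall N,
  \sum_(u : bmultinom n N) `|c u| * r ^+ mdeg u <= s.

Definition has_series a r c s f := [/\ 0 < r, abs_bound r c s &
  forall z, ball a r z -> psum c (disp a z) @ \oo --> f z].

(** Grouping by total degree turns a multiple series into a series over [nat], to which the
    geometric estimates apply. *)
Lemma psum_homog c w K : psum c w K =
  \sum_(k < K) \sum_(v : bmultinom n k.+1 | (mdeg v == k)%N) c v * mon w v.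
Proof.
elim: K => [|K IH].
  by rewrite big_ord0 /psum big1 // => u _; have := bmdeg u.
rewrite big_ord_recr /= -IH /psum.
rewrite (bigID (fun u : bmultinom n K.+1 => (mdeg u < K)%N)) /=.
congr (_ + _).
  by rewrite -(bmultinom_widen (fun u => c u * mon w u)).
apply: eq_bigl => u; rewrite -leqNgt eqn_leq andbC.
by have := bmdeg u; rewrite ltnS => ->; rewrite andbT.
Qed.

Lemma psum_cvg_coef0 c w : (forall u, u != mnm0 -> c u * mon w u = 0) ->
  psum c w @ \oo --> c mnm0.
Proof.
move=> h; apply: cvg_near_cst; exists 1%N => // N /= N0.
have dN : (mdeg (@mnm0 n) < N)%N by rewrite mdeg0.
rewrite /psum (bigD1 (BMultinom dN)) //= big1 ?addr0 => [|u].
  by rewrite /mon big1 ?mulr1 // => i _; rewrite mnm0E.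
by rewrite -val_eqE => u0; exact: h.
Qed.

(** Strict inequality in finitely many coordinates leaves a uniform margin. The maximum is built by
    recursion because the order on [C] is partial; it starts from [0]. *)
Lemma ball_margin a r z : ball a r z ->
  exists2 t, 0 <= t < r & forall i, `|disp a z i| <= t.
Proof.
move=> [r0 h].
have {}h i : `|disp a z i| < r by move: (h 0 i); rewrite /ball /= distrC.
suff [t t0 ht] : exists2 t, 0 <= t < r &
    forall i, i \in enum 'I_n -> `|disp a z i| <= t.
  by exists t => // i; apply: ht; rewrite mem_enum.
elim: (enum 'I_n) => [|i l [t /andP[t0 tr] IH]].
  by exists 0 => //; rewrite lexx r0.
have tR : t >=< `|disp a z i| by apply: real_comparable; rewrite ger0_real.
case/comparable_leP: tR => [ti|ti].
  exists `|disp a z i|; first by rewrite normr_ge0 h.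
  by move=> k; rewrite inE => /predU1P[->//|/IH/le_trans->].
exists t; first by rewrite t0.
by move=> k; rewrite inE => /predU1P[->//|/IH//]; exact: ltW.
Qed.

Lemma abs_bound_ge0 r c s : abs_bound r c s -> 0 <= s.
Proof.
move=> /(_ 0); rewrite big1 // => u _.
by have := bmdeg u; rewrite ltn0.
Qed.

Lemma psum_le r c s w N : abs_bound r c s -> (forall i, `|w i| <= r) ->
  `|psum c w N| <= s.
Proof.
move=> cs wr; apply: le_trans (cs N); apply: le_trans (ler_norm_sum _ _ _) _.
by apply: ler_sum => u _; rewrite normrM ler_wpM2l // mon_le.
Qed.

Lemma has_series_le a r c s f z : has_series a r c s f -> ball a r z ->
  `|f z| <= s.
Proof.
move=> [r0 cs h] az; have [t /andP[_ tr] ht] := ball_margin az.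
apply: (@cvg_norm_le _ _ _ _ 0 _ (h z az)) => N _.
by apply: psum_le cs _ => i; apply: le_trans (ht i) (ltW tr).
Qed.

Lemma abs_boundW r c s s' : abs_bound r c s -> s <= s' -> abs_bound r c s'.
Proof. by move=> h ss' N; apply: le_trans ss'. Qed.

Lemma abs_bound_shrink r r' c s : 0 <= r' <= r ->
  abs_bound r c s -> abs_bound r' c s.
Proof.
move=> /andP[r'0 rr'] h N; apply: le_trans (h N); apply: ler_sum => u _.
by rewrite ler_wpM2l // lerXn2r ?nnegrE // (le_trans r'0).
Qed.

Lemma ball_shrink (V : pseudoMetricType C) (a z : V) r r' :
  r' <= r -> ball a r' z -> ball a r z.
Proof. by move=> /le_ball; apply. Qed.

Lemma has_series_shrink a r r' c s f : 0 < r' <= r ->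
  has_series a r c s f -> has_series a r' c s f.
Proof.
move=> /andP[r'0 rr'] [r0 cs h]; split=> [//||].
  by apply: abs_bound_shrink cs; rewrite ltW.
by move=> z /(ball_shrink rr')/h.
Qed.

Lemma has_series_ext a r c s f g : (forall z, ball a r z -> f z = g z) ->
  has_series a r c s f -> has_series a r c s g.
Proof. by move=> fg [r0 cs h]; split=> [//|//|z az]; have <- := fg z az; apply: h. Qed.

Lemma has_seriesW a r c s s' f : has_series a r c s f -> s <= s' ->
  has_series a r c s' f.
Proof. by move=> [? cs ?] ss'; split=> //; apply: abs_boundW cs ss'. Qed.

Lemma has_series_coef0 a r c s f : has_series a r c s f -> c mnm0 = f a.
Proof.
move=> [r0 _ /(_ a (ballxx a r0)) h1].
have h2 : psum c (disp a a) @ \oo --> c mnm0.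
  apply: psum_cvg_coef0 => u /mnm_neq0P[i ui].
  by rewrite /mon (bigD1 i) //= /disp subrr expr0n (negbTE ui) mul0r mulr0.
exact: (cvg_unique _ h2 h1).
Qed.

Lemma has_series_mono a r u x : 0 < r ->
  has_series a r (fun v => if v == u then x else 0) (`|x| * r ^+ mdeg u)
    (fun z => x * mon (disp a z) u).
Proof.
move=> r0; split=> [//|N|z az].
  have [uN|Nu] := ltnP (mdeg u) N.
    rewrite (bigD1 (BMultinom uN)) //= eqxx big1 ?addr0 // => v.
    by rewrite -val_eqE /= => /negbTE ->; rewrite normr0 mul0r.
  rewrite big1 ?mulr_ge0 ?exprn_ge0 ?(ltW r0) // => v _.
  case: eqP => [vu|_]; last by rewrite normr0 mul0r.
  by move: (bmdeg v); rewrite vu ltnNge Nu.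
apply: cvg_near_cst; exists (mdeg u).+1 => // N /= uN.
rewrite /psum (bigD1 (BMultinom uN)) //= eqxx big1 ?addr0 // => v.
by rewrite -val_eqE /= => /negbTE ->; rewrite mul0r.
Qed.

Lemma has_series_add a r c d s t f g :
  has_series a r c s f -> has_series a r d t g ->
  has_series a r (fun u => c u + d u) (s + t) (fun z => f z + g z).
Proof.
move=> [r0 cs hf] [_ ct hg]; split=> [//|N|z az].
  apply: le_trans (lerD (cs N) (ct N)); rewrite -big_split /=.
  apply: ler_sum => u _; rewrite -mulrDl ler_wpM2r ?exprn_ge0 ?(ltW r0) //.
  exact: ler_normD.
rewrite (_ : psum _ _ = psum c (disp a z) \+ psum d (disp a z)).
  by apply: cvgD; [exact: hf|exact: hg].
by apply/funext => N; rewrite /psum /= -big_split; apply: eq_bigr => u _;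
  rewrite mulrDl.
Qed.

(** The truncated Cauchy product and the product of the truncations differ by pairs of total degree
    at least [k]. At displacements bounded by [q < r] each such pair contributes at most
    [(q / r) ^+ k] times its weight at radius [r], and the weights sum to at most [s * t]. *)
Lemma has_series_mul a r c d s t f g :
  has_series a r c s f -> has_series a r d t g ->
  has_series a r (cmul c d) (s * t) (fun z => f z * g z).
Proof.
move=> [r0 cs hf] [_ ct hg].
have s0 := abs_bound_ge0 cs; have t0 := abs_bound_ge0 ct.
have r0' := ltW r0.
pose A v v' := (`|c v| * r ^+ mdeg v) * (`|d v'| * r ^+ mdeg v').
have A0 v v' : 0 <= A v v' by rewrite !mulr_ge0 ?exprn_ge0.
have At N : \sum_(v : bmultinom n N) \sum_(v' : bmultinom n N) A v v' <= s * t.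
  apply: le_trans (ler_pM _ _ (cs N) (ct N)).
  - by rewrite big_distrlr.
  - by apply: sumr_ge0 => u _; rewrite mulr_ge0 ?exprn_ge0.
  - by apply: sumr_ge0 => u _; rewrite mulr_ge0 ?exprn_ge0.
split=> [//|N|z az].
  apply: le_trans (At N).
  apply: le_trans (_ : \sum_(u : bmultinom n N) \sum_(v : bmultinom n N)
    \sum_(v' : bmultinom n N | mnm_add v v' == u) A v v' <= _); last first.
    rewrite (sum_cmul N A); apply: ler_sum => v _.
    by rewrite big_mkcond; apply: ler_sum => v' _; case: ifP.
  apply: ler_sum => u _; rewrite (cmul_widen c d (bmdeg u)).
  apply: le_trans (_ : (\sum_(v : bmultinom n N)
     \sum_(v' : bmultinom n N | mnm_add v v' == u) `|c v * d v'|) *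
     r ^+ mdeg u <= _).
    rewrite ler_wpM2r ?exprn_ge0 //.
    apply: le_trans (ler_norm_sum _ _ _) _.
    by apply: ler_sum => v _; apply: ler_norm_sum.
  rewrite big_distrl /=; apply: ler_sum => v _; rewrite big_distrl /=.
  apply: ler_sum => v' /eqP <-; rewrite /A normrM mdegD exprD.
  by rewrite mulrACA.
have [q /andP[q0 qr] wq] := ball_margin az; set w := disp a z.
have qr1 : 0 <= q / r < 1 by rewrite divr_ge0 // ltr_pdivrMr // mul1r.
apply: cvg_sub0; last by apply: cvgM; [exact: hf|exact: hg].
apply/cvgrPdist_lt => e e0.
have [N hN] := expr_small qr1 e0 (mulr_ge0 s0 t0).
exists N => // k /= /hN; apply: le_lt_trans.
rewrite sub0r normrN.
have -> : (psum (cmul c d) w - (fun N => psum c w N * psum d w N)) k =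
   - \sum_(v : bmultinom n k)
      \sum_(v' : bmultinom n k | ~~ (mdeg v + mdeg v' < k)%N)
        (c v * mon w v) * (d v' * mon w v').
  transitivity (psum (cmul c d) w k - psum c w k * psum d w k); first by [].
  have -> : psum (cmul c d) w k = \sum_(v : bmultinom n k)
      \sum_(v' : bmultinom n k | (mdeg v + mdeg v' < k)%N)
        (c v * mon w v) * (d v' * mon w v').
    rewrite -(sum_cmul k (fun v v' => (c v * mon w v) * (d v' * mon w v'))).
    apply: eq_bigr => u _; rewrite (cmul_widen c d (bmdeg u)) big_distrl /=.
    apply: eq_bigr => v _; rewrite big_distrl /=; apply: eq_bigr => v' /eqP <-.
    by rewrite mon_add mulrACA.
  rewrite /psum big_distrlr /= -sumrB -sumrN; apply: eq_bigr => v _.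
  rewrite [X in _ - X](bigID (fun v' : bmultinom n k => (mdeg v + mdeg v' < k)%N)) /=.
  by rewrite opprD addrA subrr sub0r.
rewrite normrN; apply: le_trans (ler_norm_sum _ _ _) _.
apply: le_trans (_ : (q / r) ^+ k *
  (\sum_(v : bmultinom n k) \sum_(v' : bmultinom n k) A v v') <= _); last first.
  by rewrite ler_wpM2l // exprn_ge0 //; case/andP: qr1.
rewrite mulr_sumr; apply: ler_sum => v _.
apply: le_trans (ler_norm_sum _ _ _) _; rewrite mulr_sumr big_mkcond /=.
apply: ler_sum => v' _; case: ifP => [|_]; last first.
  by rewrite mulr_ge0 // exprn_ge0 //; case/andP: qr1.
rewrite -leqNgt => kv.
rewrite /A !normrM mulrACA [X in _ * X <= _](_ : _ = `|mon w (mnm_add v v')|); last first.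
  by rewrite mon_add normrM.
rewrite [in leRHS]mulrACA [leRHS]mulrCA ler_wpM2l ?mulr_ge0 //.
apply: le_trans (mon_le _ wq) _.
rewrite mdegD -exprD.
have -> : q ^+ (mdeg v + mdeg v') =
   (q / r) ^+ (mdeg v + mdeg v') * r ^+ (mdeg v + mdeg v').
  by rewrite -exprMn divfK // gt_eqF.
rewrite ler_wpM2r ?exprn_ge0 //; case/andP: qr1 => qr0 qr1.
by rewrite ler_wiXn2l // ltW.
Qed.

End Fixed.
End PowerSeries.

(** * Infinite sums of analytic functions in the weighted norm *)

Section Closure.
Variable R : realType.
Local Notation C := (Cx R).

Lemma cvg_bigsum (I : Type) (l : seq I) (F : I -> nat -> C) (x : I -> C) :
  (forall i, F i @ \oo --> x i) ->
  (fun K => \sum_(i <- l) F i K) @ \oo --> \sum_(i <- l) x i.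
Proof.
move=> Fx; elim: l => [|i l IH].
  rewrite big_nil; apply: cvg_near_cst; apply: nearW => K; exact: big_nil.
rewrite big_cons (_ : (fun K => _) = F i \+ (fun K => \sum_(i <- l) F i K)).
  by apply: cvgD; [exact: Fx|exact: IH].
by apply/funext => K; rewrite big_cons.
Qed.

Lemma geom_tail (q B : C) (K m : nat) : 0 <= q < 1 -> 0 <= B ->
  \sum_(K <= k < m) B * q ^+ k <= q ^+ K * (B / (1 - q)).
Proof.
move=> /andP[q0 q1] B0; have q10 : 0 < 1 - q by rewrite subr_gt0.
have [Km|mK] := leqP K m; last first.
  rewrite big_geq; last exact: ltnW.
  by rewrite !mulr_ge0 ?exprn_ge0 ?invr_ge0 ?(ltW q10).
rewrite -mulr_sumr mulrCA ler_wpM2l // ler_pdivlMr // -{1}(add0n K) big_addn.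
under eq_bigr do rewrite exprD.
rewrite -mulr_suml big_mkord mulrAC.
have -> : (\sum_(i < m - K) q ^+ i) * (1 - q) = 1 - q ^+ (m - K).
  by rewrite mulrC -opprB mulNr -subrX1 opprB.
by rewrite mulrBl mul1r gerBl mulr_ge0 ?exprn_ge0.
Qed.

Section Geometric.
Variables (q B : C) (x : nat -> C).
Hypotheses (q01 : 0 <= q < 1) (B0 : 0 <= B)
  (xq : forall k, `|x k| <= B * q ^+ k).

Let tail_sum K m : (K <= m)%N ->
  `|\sum_(k < m) x k - \sum_(k < K) x k| <= q ^+ K * (B / (1 - q)).
Proof.
move=> Km; apply: le_trans (geom_tail K m q01 B0).
have E p : \sum_(k < p) x k = \sum_(0 <= k < p) x k by rewrite big_mkord.
rewrite !E (big_cat_nat (leq0n K) Km) /= addrAC subrr add0r.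
by apply: le_trans (ler_norm_sum _ _ _) _; apply: ler_sum => k _; exact: xq.
Qed.

Let Bq0 : 0 <= B / (1 - q).
Proof. by case/andP: q01 => _ q1; rewrite mulr_ge0 // invr_ge0 subr_ge0 ltW. Qed.

Lemma geom_cvg : exists l : C, (fun K => \sum_(k < K) x k) @ \oo --> l.
Proof.
apply: complex_cauchy => e e0; have [N hN] := expr_small q01 e0 Bq0.
by exists N => k Nk; apply: le_lt_trans (tail_sum Nk) (hN _ _).
Qed.

Lemma geom_lim_tail (l : C) K : (fun K => \sum_(k < K) x k) @ \oo --> l ->
  `|l - \sum_(k < K) x k| <= q ^+ K * (B / (1 - q)).
Proof.
move=> xl; apply: (@cvg_norm_le _
  (fun m => \sum_(k < m) x k - \sum_(k < K) x k) _ _ K).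
  by move=> m; exact: tail_sum.
by apply: cvgB; [exact: xl|exact: cvg_cst].
Qed.

End Geometric.

(* [s] bounds the weighted l^1-norm of the coefficients, which is
   submultiplicative: this makes substitution into a power series converge
   without any rearrangement of multiple series. *)
Definition analytic_norm n (a : 'rV[C]_n) r (f : 'rV[C]_n -> C) s :=
  exists c, has_series a r c s f.

Section Fixed.
Variable n : nat.
Implicit Types (a z : 'rV[C]_n) (r s t : C) (f g : 'rV[C]_n -> C).

Lemma analytic_norm_ext a r f g s : (forall z, ball a r z -> f z = g z) ->
  analytic_norm a r f s -> analytic_norm a r g s.
Proof. by move=> fg [c h]; exists c; apply: has_series_ext fg h. Qed.

Lemma analytic_norm_le a r f s z : analytic_norm a r f s -> ball a r z -> `|f z| <= s.
Proof. by move=> [c h]; apply: has_series_le h. Qed.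

Lemma analytic_norm_gt0 a r f s : analytic_norm a r f s -> 0 < r.
Proof. by case=> c []. Qed.

Lemma analytic_norm_weaken a r f s s' : analytic_norm a r f s -> s <= s' ->
  analytic_norm a r f s'.
Proof. by move=> [c h] ss'; exists c; apply: has_seriesW h ss'. Qed.

Lemma analytic_norm_shrink a r r' f s : 0 < r' <= r -> analytic_norm a r f s ->
  analytic_norm a r' f s.
Proof. by move=> rr' [c h]; exists c; apply: has_series_shrink h. Qed.

Lemma analytic_norm_cst a r x : 0 < r -> analytic_norm a r (fun=> x) `|x|.
Proof.
move=> r0; exists (fun v => if v == mnm0 then x else 0).
have := has_series_mono a mnm0 x r0; rewrite mdeg0 mulr1.
apply: has_series_ext => z _; rewrite /mon big1 ?mulr1 // => i _.
by rewrite mnm0E.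
Qed.

Lemma analytic_norm_disp a r i : 0 < r -> analytic_norm a r (fun z => z 0 i - a 0 i) r.
Proof.
move=> r0; exists (fun v => if v == mnm1 i then 1 else 0).
have := has_series_mono a (mnm1 i) 1 r0.
rewrite mdeg1 expr1 normr1 mul1r; apply: has_series_ext => z _.
rewrite mul1r /mon (bigD1 i) //= mnm1E eqxx expr1 big1 ?mulr1 // => k ki.
by rewrite mnm1E eq_sym (negbTE ki).
Qed.

Lemma analytic_norm_add a r f g s t : analytic_norm a r f s -> analytic_norm a r g t ->
  analytic_norm a r (fun z => f z + g z) (s + t).
Proof. by move=> [c hc] [d hd]; eexists; apply: has_series_add hc hd. Qed.

Lemma analytic_norm_mul a r f g s t : analytic_norm a r f s -> analytic_norm a r g t ->
  analytic_norm a r (fun z => f z * g z) (s * t).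
Proof. by move=> [c hc] [d hd]; eexists; apply: has_series_mul hc hd. Qed.

Lemma analytic_norm_sum (I : Type) (l : seq I) (P : pred I) (f : I -> 'rV[C]_n -> C)
    (s : I -> C) a r :
  0 < r -> (forall i, analytic_norm a r (f i) (s i)) ->
  analytic_norm a r (fun z => \sum_(i <- l | P i) f i z) (\sum_(i <- l | P i) s i).
Proof.
move=> r0 h; elim: l => [|i l IH].
  rewrite big_nil; have := analytic_norm_cst a 0 r0; rewrite normr0.
  by apply: analytic_norm_ext => z _; rewrite big_nil.
rewrite big_cons; case: ifP => Pi; last first.
  by apply: analytic_norm_ext IH => z _; rewrite big_cons Pi.
by apply: analytic_norm_ext (analytic_norm_add (h i) IH) => z _; rewrite big_cons Pi.
Qed.

Lemma analytic_norm_prod (I : Type) (l : seq I) (f : I -> 'rV[C]_n -> C)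
    (s : I -> C) a r :
  0 < r -> (forall i, analytic_norm a r (f i) (s i)) ->
  analytic_norm a r (fun z => \prod_(i <- l) f i z) (\prod_(i <- l) s i).
Proof.
move=> r0 h; elim: l => [|i l IH].
  rewrite big_nil; have := analytic_norm_cst a 1 r0; rewrite normr1.
  by apply: analytic_norm_ext => z _; rewrite big_nil.
by rewrite big_cons; apply: analytic_norm_ext (analytic_norm_mul (h i) IH) => z _; rewrite big_cons.
Qed.

Lemma analytic_norm_exp f s a r k : 0 < r -> analytic_norm a r f s ->
  analytic_norm a r (fun z => f z ^+ k) (s ^+ k).
Proof.
move=> r0 h; have := @analytic_norm_prod _ (index_enum 'I_k) (fun=> f) (fun=> s) a r r0 (fun=> h).
by rewrite prodr_const card_ord; apply: analytic_norm_ext => z _; rewrite prodr_const card_ord.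
Qed.

(** A Weierstrass M-test in the weighted norm. Each coefficient is a geometrically convergent
    series, and the tails after [K] are bounded uniformly in the truncation degree, which permits
    the exchange of the two limits. *)
Lemma analytic_norm_series a r (h : nat -> 'rV[C]_n -> C) f q B :
  0 < r -> 0 <= q < 1 -> 0 <= B ->
  (forall k, analytic_norm a r (h k) (B * q ^+ k)) ->
  (forall z, ball a r z -> (fun K => \sum_(k < K) h k z) @ \oo --> f z) ->
  analytic_norm a r f (B / (1 - q)).
Proof.
move=> r0 q01 B0 hk hf; have [c hc] := choice hk.
have cs k : abs_bound r (c k) (B * q ^+ k) by case: (hc k).
have term k u : `|c k u| <= B / r ^+ mdeg u * q ^+ k.
  rewrite mulrAC ler_pdivlMr ?exprn_gt0 //.
  apply: le_trans (cs k (mdeg u).+1).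
  rewrite (bigD1 (BMultinom (ltnSn (mdeg u)))) //= lerDl sumr_ge0 // => v _.
  by rewrite mulr_ge0 // exprn_ge0 // ltW.
have Br (u : multinom n) : 0 <= B / r ^+ mdeg u by rewrite divr_ge0 // exprn_ge0 // ltW.
have [d hd] := choice (fun u => geom_cvg q01 (Br u) (term ^~ u)).
have Bq0 : 0 <= B / (1 - q).
  by case/andP: q01 => _ q1; rewrite mulr_ge0 // invr_ge0 subr_ge0 ltW.
exists d; split=> [//|N|z az].
  pose S K := \sum_(u : bmultinom n N) `|\sum_(k < K) c k u| * r ^+ mdeg u.
  have SB K : `|S K| <= B / (1 - q).
    rewrite ger0_norm; last first.
      by apply: sumr_ge0 => u _; rewrite mulr_ge0 // exprn_ge0 // ltW.
    apply: le_trans (_ : \sum_(k < K) B * q ^+ k <= _); last first.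
      have := geom_tail 0 K q01 B0; rewrite expr0 mul1r; apply: le_trans.
      by rewrite big_mkord.
    apply: le_trans (_ : \sum_(u : bmultinom n N) \sum_(k < K)
       `|c k u| * r ^+ mdeg u <= _).
      apply: ler_sum => u _; rewrite -mulr_suml ler_wpM2r //.
        by rewrite exprn_ge0 // ltW.
      exact: ler_norm_sum.
    by rewrite exchange_big /=; apply: ler_sum => k _; exact: cs.
  have Sl : S @ \oo --> \sum_(u : bmultinom n N) `|d u| * r ^+ mdeg u.
    apply: cvg_bigsum => u; apply: cvgMr_tmp; apply: cvg_norm; exact: hd.
  have := cvg_norm_le (N0 := 0) (fun N _ => SB N) Sl.
  rewrite ger0_norm //; apply: sumr_ge0 => u _.
  by rewrite mulr_ge0 // exprn_ge0 // ltW.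
have [t /andP[t0 tr] wt] := ball_margin az; set w := disp a z.
have wr i : `|w i| <= r by apply: le_trans (wt i) (ltW tr).
have pk k N : `|psum (c k) w N| <= B * q ^+ k by apply: psum_le (cs k) wr.
have pd N : (fun K => \sum_(k < K) psum (c k) w N) @ \oo --> psum d w N.
  rewrite (_ : (fun K => _) =
    fun K => \sum_(u : bmultinom n N) (\sum_(k < K) c k u) * mon w u).
    by apply: cvg_bigsum => u; apply: cvgMr_tmp; exact: hd.
  apply/funext => K; rewrite /psum exchange_big /=; apply: eq_bigr => u _.
  by rewrite mulr_suml.
have fz k : `|h k z| <= B * q ^+ k by apply: analytic_norm_le (hk k) az.
apply/cvgrPdist_lt => e e0.
have e30 : 0 < e / 3 by rewrite divr_gt0.
(* [K] is fixed before [N]: it makes the tail of [f z] and that of [psum d w N] at most [e / 3] for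
   every [N], leaving a finite sum of convergent sequences. *)
have [K hK] := expr_small q01 e30 Bq0.
have h3 : (fun N => \sum_(k < K) psum (c k) w N) @ \oo --> \sum_(k < K) h k z.
  by apply: cvg_bigsum => k; case: (hc k) => _ _; apply.
near=> N.
have -> : f z - psum d w N = (f z - \sum_(k < K) h k z) +
    (\sum_(k < K) h k z - \sum_(k < K) psum (c k) w N) -
    (psum d w N - \sum_(k < K) psum (c k) w N) by ring.
have -> : e = e / 3 + e / 3 + e / 3 by field.
apply: le_lt_trans (ler_normB _ _) _; apply: ltr_leD; last first.
  by apply: le_trans (geom_lim_tail q01 B0 (pk ^~ N) K (pd N)) (ltW (hK _ _)).
apply: le_lt_trans (ler_normD _ _) _; apply: ler_ltD.
  by apply: le_trans (geom_lim_tail q01 B0 fz K (hf z az)) (ltW (hK _ _)).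
by near: N; move/cvgrPdist_lt: h3; apply.
Unshelve. all: by end_near. Qed.

End Fixed.
End Closure.

(** * Analytic functions *)

Section Analytic.
Variable R : realType.
Local Notation C := (Cx R).

(** Split [F] into homogeneous parts. By submultiplicativity, substitution gives the part of degree
    [k] norm at most [s * (sg / rho) ^+ k], and [analytic_norm_series] sums these. *)
Lemma analytic_norm_subst d n (b : 'rV[C]_d) (a : 'rV[C]_n) (r rho sg s : C)
    (F : 'rV[C]_d -> C) (g : 'I_d -> 'rV[C]_n -> C) :
  0 < r -> 0 <= sg < rho -> analytic_norm b rho F s ->
  (forall k, analytic_norm a r (fun z => g k z - b 0 k) sg) ->
  analytic_norm a r (fun z => F (\row_k g k z)) (s / (1 - sg / rho)).
Proof.
move=> r0 /andP[sg0 sgr] [c [rho0 cs hF]] hg.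
have s0 := abs_bound_ge0 cs.
have q01 : 0 <= sg / rho < 1.
  by rewrite divr_ge0 ?(ltW rho0) // ltr_pdivrMr // mul1r.
have q0 : 0 <= sg / rho by case/andP: q01.
pose w z : 'I_d -> C := fun k => g k z - b 0 k.
pose h k z := \sum_(v : bmultinom d k.+1 | (mdeg v == k)%N) c v * mon (w z) v.
apply: (analytic_norm_series (h := h)) => // [k|z az].
  apply: (@analytic_norm_weaken _ _ _ _ _ (\sum_(v : bmultinom d k.+1 | (mdeg v == k)%N)
      `|c v| * sg ^+ mdeg v)).
    apply: analytic_norm_sum => // v; apply: analytic_norm_mul; first exact: analytic_norm_cst.
    have -> : sg ^+ mdeg v = \prod_(i < d) sg ^+ v i by rewrite mdegE -prodrXr.
    exact: (analytic_norm_prod (index_enum 'I_d) r0 (fun i => analytic_norm_exp (v i) r0 (hg i))).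
  rewrite (eq_bigr (fun v : bmultinom d k.+1 =>
      (`|c v| * rho ^+ mdeg v) * (sg / rho) ^+ k)); last first.
    move=> v /eqP vk; rewrite -mulrA; congr (_ * _).
    by rewrite vk expr_div_n mulrC divfK // expf_neq0 // gt_eqF.
  rewrite -mulr_suml ler_wpM2r ?exprn_ge0 //.
  apply: le_trans (cs k.+1); rewrite [leRHS](bigID (fun v : bmultinom d k.+1 => mdeg v == k)) /=.
  rewrite lerDl sumr_ge0 // => v _.
  by rewrite mulr_ge0 // exprn_ge0 // ltW.
have wz k : `|w z k| <= sg by apply: analytic_norm_le (hg k) az.
have bz : ball b rho (\row_k g k z).
  by apply/rV_ballP; split=> // i; rewrite mxE; apply: le_lt_trans (wz i) sgr.
have := hF _ bz; rewrite (_ : disp _ _ = w z); last first.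
  by apply/funext => k; rewrite /disp mxE.
rewrite (_ : psum c (w z) = fun K => \sum_(k < K) h k z) //.
by apply/funext => K; exact: psum_homog.
Qed.

Section Fixed.
Variable n : nat.
Implicit Types (a z : 'rV[C]_n) (r s t : C) (f g : 'rV[C]_n -> C).

Lemma analytic_normP f a : analytic_at f a <->
  exists r s, analytic_norm a r f s.
Proof.
split=> [[c [r [B [r0 cB cf]]]]|[r [s [c [r0 cs hf]]]]].
  (* At half the radius the uniform bound [B] on the terms becomes [B / 2 ^ mdeg u], which is
     summable. *)
  have r20 : 0 < r / 2 by rewrite divr_gt0.
  have r2r : r / 2 <= r by rewrite ler_pdivrMr // mulr_natr mulr2n lerDl ltW.
  exists (r / 2), (B * ((1 - 2^-1)^-1) ^+ n), c; split=> // [N|z /(ball_shrink r2r)/cf//].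
  have q01 : 0 <= (2^-1 : C) < 1 by rewrite invr_ge0 ler0n invf_lt1 // ltr1n.
  have B0 : 0 <= B.
    by apply: le_trans (cB mnm0); rewrite mulr_ge0 // exprn_ge0 // ltW.
  apply: le_trans (ler_wpM2l B0 (sum_geom_bmultinom n N q01)).
  rewrite mulr_sumr; apply: ler_sum => u _.
  by rewrite exprMn mulrA ler_wpM2r // exprn_ge0 // invr_ge0 ler0n.
exists c, r, s; split=> // u; apply: le_trans (cs (mdeg u).+1).
rewrite (bigD1 (BMultinom (ltnSn (mdeg u)))) //= lerDl sumr_ge0 // => v _.
by rewrite mulr_ge0 // exprn_ge0 // ltW.
Qed.

(** Recentring is substitution of the coordinate functions, whose displacements from [a] have norm
    at most [t + r'] on the ball of radius [r'] about [z]. *)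
Lemma analytic_norm_recenter a r r' s t f z : analytic_norm a r f s ->
  (forall i, `|z 0 i - a 0 i| <= t) -> 0 <= t -> 0 < r' -> t + r' < r ->
  analytic_norm z r' f (s / (1 - (t + r') / r)).
Proof.
move=> fa zt t0 r'0 tr.
have sr : 0 <= t + r' < r by rewrite tr addr_ge0 // ltW.
have := @analytic_norm_subst n n a z r' r (t + r') s f (fun k z => z 0 k) r'0 sr fa.
have h k : analytic_norm z r' (fun z => z 0 k - a 0 k) (t + r').
  apply: (@analytic_norm_weaken _ _ _ _ _ (r' + `|z 0 k - a 0 k|)); last first.
    by rewrite addrC lerD2r.
  apply: analytic_norm_ext (analytic_norm_add (analytic_norm_disp z k r'0) (analytic_norm_cst z
    (z 0 k - a 0 k) r'0)) => y _.
  by rewrite addrA subrK.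
move=> /(_ h); apply: analytic_norm_ext => y _; congr f; apply/rowP => k.
by rewrite mxE.
Qed.

Lemma analytic_norm_analytic_at a r f s z : analytic_norm a r f s -> ball a r z ->
  analytic_at f z.
Proof.
move=> fa az; have [t /andP[t0 tr] wt] := ball_margin az.
have r'0 : 0 < (r - t) / 2 by rewrite divr_gt0 // subr_gt0.
apply/analytic_normP; exists ((r - t) / 2).
eexists; apply: analytic_norm_recenter fa wt t0 r'0 _.
rewrite -ltrBrDl ltr_pdivrMr // ltr_pMr ?subr_gt0 // ltr1n //.
Qed.

(** The constant coefficient vanishes, so every other term contains the radius at least once:
    shrinking the radius by a factor [l <= 1] shrinks the norm by [l]. *)
Lemma analytic_norm_small a r f s : analytic_norm a r f s -> f a = 0 ->
  forall e, 0 < e -> exists2 r', 0 < r' & forall r'', 0 < r'' <= r' ->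
    analytic_norm a r'' f e.
Proof.
move=> [c fs] fa0 e e0; have [r0 cs hf] := fs.
have c0 : c mnm0 = 0 by rewrite (has_series_coef0 fs).
have s0 := abs_bound_ge0 cs.
have s10 : 0 < s + 1 by rewrite ltr_wpDl.
have es : 0 < e + s + 1 by rewrite -addrA addr_gt0.
(* The factor [l = e / (e + s + 1)] is at most [1] and satisfies [l * s <= e]; the summand [1] is
   not essential to the size but serves the case [s = 0] uniformly. *)
have q0 : 0 < e / (e + s + 1) by rewrite divr_gt0.
have q1 : e / (e + s + 1) <= 1.
  by rewrite ler_pdivrMr // mul1r -addrA lerDl; exact: ltW.
have shr l : 0 < l <= 1 -> analytic_norm a (l * r) f (l * s).
  move=> /andP[l0 l1]; exists c; split=> [|N|z].
  - by rewrite mulr_gt0.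
  - apply: le_trans (ler_wpM2l (ltW l0) (cs N)).
    rewrite mulr_sumr; apply: ler_sum => u _.
    have [->|u0] := eqVneq (u : multinom n) mnm0.
      by rewrite c0 normr0 !mul0r mulr0.
    rewrite mulrCA ler_wpM2l // exprMn ler_wpM2r ?exprn_ge0 ?(ltW r0) //.
    have : mdeg u != 0%N by rewrite mdeg_eq0.
    case: (mdeg u) => // k _.
    by rewrite exprS ler_piMr ?(ltW l0) // exprn_ile1 ?(ltW l0).
  - by move=> /(@ball_shrink _ _ a z r (l * r)) h; apply/hf/h; rewrite ger_pMl.
exists (e / (e + s + 1) * r); first by rewrite mulr_gt0.
move=> r'' r''r; apply: analytic_norm_shrink r''r _.
have /shr : 0 < e / (e + s + 1) <= 1 by rewrite q0.
move=> /analytic_norm_weaken; apply; rewrite mulrAC ler_pdivrMr //.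
by rewrite ler_wpM2l ?(ltW e0) // addrAC lerDr addr_ge0 // ltW.
Qed.

Lemma common_radius (I : finType) (P : I -> C -> Prop) :
  (forall i, exists2 r : C, 0 < r & forall r', 0 < r' <= r -> P i r') ->
  exists2 r : C, 0 < r & forall i r', 0 < r' <= r -> P i r'.
Proof.
move=> h.
suff [r r0 hr] : exists2 r : C, 0 < r & forall i, i \in enum I ->
    forall r', 0 < r' <= r -> P i r'.
  by exists r => // i; apply: hr; rewrite mem_enum.
elim: (enum I) => [|i l [r r0 IH]]; first by exists 1.
have [t t0 ht] := h i.
have tr : t >=< r by apply: real_comparable; rewrite gtr0_real.
case/comparable_leP: tr => [tr|rt].
  exists t => // k; rewrite inE => /predU1P[->//|kl r' /andP[r'0 r't]].
  by apply: IH => //; rewrite r'0 (le_trans r't).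
exists r => // k; rewrite inE => /predU1P[->|kl r' h'] ; last exact: IH.
by move=> r' /andP[r'0 r't]; apply: ht; rewrite r'0 (le_trans r't) // ltW.
Qed.

Lemma analytic_small f a e : analytic_at f a -> 0 < e ->
  exists2 r, 0 < r & forall r', 0 < r' <= r ->
    analytic_norm a r' (fun z => f z - f a) e.
Proof.
move=> /analytic_normP[r [s fa]] e0; have r0 := analytic_norm_gt0 fa.
apply: analytic_norm_small (analytic_norm_add fa (analytic_norm_cst a (- f a) r0)) _ _ e0.
by rewrite subrr.
Qed.

Lemma analytic_near f a : analytic_at f a -> \forall z \near a, analytic_at f z.
Proof.
move=> /analytic_normP[r [s fa]]; apply/nbhs_ballP; exists r.
  exact: analytic_norm_gt0 fa.
by move=> z; exact: analytic_norm_analytic_at fa.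
Qed.

Lemma analytic_cst (x : C) a : analytic_at (fun=> x) a.
Proof.
by apply/analytic_normP; exists 1, `|x|; apply: analytic_norm_cst.
Qed.

Lemma analytic_common f g a : analytic_at f a -> analytic_at g a ->
  exists r s t, [/\ 0 < r, analytic_norm a r f s & analytic_norm a r g t].
Proof.
move=> /analytic_normP[r [s fa]] /analytic_normP[r' [s' ga]].
have r0 := analytic_norm_gt0 fa; have r'0 := analytic_norm_gt0 ga.
have rr : r >=< r' by apply: real_comparable; rewrite gtr0_real.
case/comparable_leP: rr => rr.
  exists r, s, s'; split; [exact: r0|exact: fa|apply: analytic_norm_shrink ga].
  by rewrite r0.
exists r', s, s'; split; [exact: r'0|apply: analytic_norm_shrink fa|exact: ga].
by rewrite r'0 ltW.
Qed.

Lemma analytic_add f g a : analytic_at f a -> analytic_at g a ->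
  analytic_at (fun z => f z + g z) a.
Proof.
move=> fa ga; have [r [s [t [r0 h1 h2]]]] := analytic_common fa ga.
by apply/analytic_normP; exists r, (s + t); apply: analytic_norm_add.
Qed.

Lemma analytic_mul f g a : analytic_at f a -> analytic_at g a ->
  analytic_at (fun z => f z * g z) a.
Proof.
move=> fa ga; have [r [s [t [r0 h1 h2]]]] := analytic_common fa ga.
by apply/analytic_normP; exists r, (s * t); apply: analytic_norm_mul.
Qed.

Lemma analytic_opp f a : analytic_at f a -> analytic_at (fun z => - f z) a.
Proof.
move=> fa; rewrite (_ : (fun z => _) = fun z => -1 * f z); last first.
  by apply/funext => z; rewrite mulN1r.
by apply: analytic_mul fa; exact: analytic_cst.
Qed.

Lemma analytic_near_close f a e : analytic_at f a -> 0 < e ->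
  \forall z \near a, `|f z - f a| < e.
Proof.
move=> fa e0.
have e20 : 0 < e / 2 by rewrite divr_gt0.
have [r r0 h] := analytic_small fa e20.
apply/near_rV_ball; exists r => // z az.
have /h germ_quot : 0 < r <= r by rewrite r0 lexx.
apply: le_lt_trans (analytic_norm_le germ_quot az) _.
by rewrite ltr_pdivrMr // ltr_pMr // ltr1n.
Qed.

Lemma analytic_near_neq0 f a : analytic_at f a -> f a != 0 ->
  \forall z \near a, f z != 0.
Proof.
move=> fa fa0; have e0 : 0 < `|f a| by rewrite normr_gt0.
apply: near_rV_mono (analytic_near_close fa e0) => z h.
by apply/eqP => fz0; move: h; rewrite fz0 sub0r normrN ltxx.
Qed.

Lemma geom_sum_cvg (x : C) : `|x| < 1 ->
  (fun K => \sum_(k < K) x ^+ k) @ \oo --> (1 - x)^-1.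
Proof.
move=> x1; have x1' : 1 - x != 0.
  by rewrite subr_eq0; apply/eqP => E; move: x1; rewrite -E normr1 ltxx.
apply/cvgrPdist_lt => e e0.
have q01 : 0 <= `|x| < 1 by rewrite normr_ge0.
have B0 : 0 <= `|(1 - x)^-1| by [].
have [N hN] := expr_small q01 e0 B0.
exists N => // k /= /hN; apply: le_lt_trans.
rewrite (_ : \sum_(i < k) x ^+ i = (1 - x ^+ k) / (1 - x)); last first.
  by rewrite -opprB subrX1 -mulNr opprB mulrC mulKf.
by rewrite mulrBl mul1r subKr normrM normrX.
Qed.

(** Geometric series in [1 - f z / f a], on a ball where [f - f a] has norm at most half of [|f a|],
    so that the ratio is [1 / 2]. *)
Lemma analytic_inv f a : analytic_at f a -> f a != 0 ->
  analytic_at (fun z => (f z)^-1) a.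
Proof.
move=> fa fa0; have e0 : 0 < `|f a| by rewrite normr_gt0.
have e20 : 0 < `|f a| / 2 by rewrite divr_gt0.
have [r r0 h] := analytic_small fa e20.
have /h {h} germ_quot : 0 < r <= r by rewrite r0 lexx.
apply/analytic_normP; exists r, (`|(f a)^-1| / (1 - 2^-1)).
have q01 : 0 <= (2^-1 : C) < 1 by rewrite invr_ge0 ler0n invf_lt1 // ltr1n.
pose h k z := (f a)^-1 * (((f z - f a) * (- (f a)^-1)) ^+ k).
apply: (@analytic_norm_series _ n a r h _ _ _ r0 q01 (normr_ge0 _)) => [k|z az].
  apply: analytic_norm_mul; first exact: analytic_norm_cst.
  apply: (analytic_norm_exp k r0).
  rewrite (_ : 2^-1 = `|f a| / 2 * `|- (f a)^-1|); last first.
    by rewrite normrN normfV mulrAC mulfV ?mul1r // gt_eqF.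
  by apply: analytic_norm_mul; [exact: germ_quot|exact: analytic_norm_cst].
have fz : `|f z - f a| <= `|f a| / 2 by apply: analytic_norm_le germ_quot az.
pose x := (f z - f a) * - (f a)^-1.
have x1 : `|x| < 1.
  rewrite /x normrM normrN normfV ltr_pdivrMr // mul1r.
  by apply: le_lt_trans fz _; rewrite ltr_pdivrMr // ltr_pMr // ltr1n.
have xE : 1 - x = f z / f a by rewrite /x; field.
rewrite (_ : (fun K => \sum_(k < K) h k z) = fun K => (f a)^-1 * \sum_(k < K) x ^+ k).
  rewrite (_ : (f z)^-1 = (f a)^-1 * (1 - x)^-1).
    by apply: cvgMl_tmp; exact: geom_sum_cvg.
  by rewrite xE invf_div mulrA mulVf // mul1r.
by apply/funext => K; rewrite mulr_sumr.
Qed.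

End Fixed.

Lemma analytic_comp d n (F : 'rV[C]_d -> C) (g : 'rV[C]_n -> 'rV[C]_d) a :
  analytic_at F (g a) -> analytic_vect_at g a -> analytic_at (fun z => F (g z)) a.
Proof.
move=> /analytic_normP[rho [s Fa]] ga; have rho0 := analytic_norm_gt0 Fa.
have rho20 : 0 < rho / 2 by rewrite divr_gt0.
have [r r0 hr] := common_radius (fun k => analytic_small (ga k) rho20).
have sr : 0 <= rho / 2 < rho.
  by rewrite (ltW rho20) ltr_pdivrMr // ltr_pMr // ltr1n.
apply/analytic_normP; exists r; eexists.
have := @analytic_norm_subst d n (g a) a r rho (rho / 2) s F (fun k z => g z 0 k) r0 sr Fa.
move=> h; apply: analytic_norm_ext (h _) => [z _|k].
  by congr F; apply/rowP => k; rewrite mxE.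
by apply: hr; rewrite r0 lexx.
Qed.

End Analytic.

(** * Derivatives of power series *)

Section Derivatives.
Variable R : realType.
Local Notation C := (Cx R).

(* Expanding, the left-hand side is at most the sum of [C(k, m) |h|^m |x|^(k-m)]
   over [m >= 2], and [|h|^m <= (|h| / d)^2 d^m] there. *)
Lemma taylor1_bound (x h d : C) k : 0 < d -> `|h| <= d ->
  `|(x + h) ^+ k - x ^+ k - h * k%:R * x ^+ k.-1| <=
  (`|h| / d) ^+ 2 * (`|x| + d) ^+ k.
Proof.
move=> d0 hd; set A := `|x|; set T := A + d.
have A0 : 0 <= A by rewrite /A.
have T0 : 0 <= T by rewrite addr_ge0 // ltW.
(* [e] is the same remainder formed from the nonnegative numbers [A] and [d]. Both remainders obey
   the recurrence [step], so the comparison passes through the induction. *)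
pose e k := T ^+ k - A ^+ k - d * k%:R * A ^+ k.-1.
have step (y g : C) m : (y + g) ^+ m.+1 - y ^+ m.+1 - g * m.+1%:R * y ^+ m =
    (y + g) * ((y + g) ^+ m - y ^+ m - g * m%:R * y ^+ m.-1) +
    g ^+ 2 * m%:R * y ^+ m.-1.
  case: m => [|m] /=; first by rewrite !expr0 expr1; ring.
  by rewrite !exprS -[m.+2]addn1 -[m.+1]addn1 !natrD; ring.
have q0 : 0 <= (`|h| / d) ^+ 2 by rewrite exprn_ge0 // divr_ge0 // ltW.
suff H : `|(x + h) ^+ k - x ^+ k - h * k%:R * x ^+ k.-1| <=
    (`|h| / d) ^+ 2 * e k.
  apply: le_trans H _; rewrite ler_wpM2l // /e -addrA gerDl -opprD oppr_le0.
  by rewrite addr_ge0 ?exprn_ge0 // !mulr_ge0 ?exprn_ge0 ?ler0n // ltW.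
elim: k => [|k IH].
  rewrite /e /= !expr0 !mulr0 !mul0r !subr0 subrr normr0 mulr0.
  by [].
rewrite [in leLHS]/= step /e /= step -/T -/(e k).
apply: le_trans (ler_normD _ _) _; rewrite [leRHS]mulrDr; apply: lerD.
  rewrite normrM mulrCA; apply: ler_pM => //.
  by apply: le_trans (ler_normD _ _) _; rewrite lerD2l.
rewrite !normrM !normrX normr_nat le_eqVlt; apply/orP; left; apply/eqP.
by rewrite /A; field; rewrite gt_eqF.
Qed.

Section Fixed.
Variable n : nat.
Implicit Types (a z : 'rV[C]_n) (r s t : C) (f g : 'rV[C]_n -> C).
Implicit Types (c : multinom n -> C) (i : 'I_n) (w : 'I_n -> C).

(** Coefficients of the formal partial derivative. *)
Definition dcoef i c (u : multinom n) : C :=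
  (u i).+1%:R * c (mnm_add u (mnm1 i)).

Lemma sum_bmultinom_shift N i (F : multinom n -> C) :
  \sum_(u : bmultinom n N) F (mnm_add u (mnm1 i)) =
  \sum_(v : bmultinom n N.+1 | v i != 0%N) F v.
Proof.
have hN (u : bmultinom n N) : (mdeg (mnm_add u (mnm1 i)) < N.+1)%N.
  by rewrite mdegD mdeg1 addn1 ltnS bmdeg.
rewrite [RHS](reindex_omap (fun u => BMultinom (hN u))
  (fun v : bmultinom n N.+1 => insub (mnm_sub v (mnm1 i)))) /=.
  apply: eq_bigl => u; rewrite mnmDE mnm1E eqxx addn1 /=.
  by rewrite addmK valK eqxx.
move=> v vi; have e := mnm_sub1K vi.
have vN : (mdeg (mnm_sub v (mnm1 i)) < N)%N.
  by have := bmdeg v; rewrite -{1}e mdegD mdeg1 addn1 ltnS.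
by rewrite insubT /=; congr Some; apply: val_inj.
Qed.

(** The loss of radius pays for the factor brought down by differentiation: factoring a difference
    of powers gives [m.+1 * r' ^ m * (r - r') <= r ^ m.+1 - r' ^ m.+1]. This takes the place of
    Cauchy's inequality. *)
Lemma dcoef_bound i c r r' s : 0 < r' < r -> abs_bound r c s ->
  abs_bound r' (dcoef i c) (s / (r - r')).
Proof.
move=> /andP[r'0 rr'] cs N; have d0 : 0 < r - r' by rewrite subr_gt0.
have r0 : 0 < r by apply: lt_trans rr'.
rewrite ler_pdivlMr // mulr_suml; apply: le_trans (cs N.+1).
apply: (@le_trans _ _ (\sum_(v : bmultinom n N.+1 | v i != 0%N) `|c v| * r ^+ mdeg v)); last first.
  rewrite [leRHS](bigID (fun v : bmultinom n N.+1 => v i != 0%N)) /= lerDl.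
  by rewrite sumr_ge0 // => v _; rewrite mulr_ge0 // exprn_ge0 // ltW.
rewrite -(sum_bmultinom_shift N i (fun v => `|c v| * r ^+ mdeg v)).
apply: ler_sum => u _; rewrite /dcoef normrM normr_nat.
rewrite -!mulrA [leLHS]mulrCA ler_wpM2l //.
rewrite mdegD mdeg1 addn1; set m := mdeg u.
have um : (u i <= m)%N by rewrite /m mdegE (bigD1 i) //= leq_addr.
apply: (@le_trans _ _ (r ^+ m.+1 - r' ^+ m.+1)); last first.
  by rewrite gerBl exprn_ge0 // ltW.
rewrite subrXX mulrA [leLHS]mulrC ler_wpM2l ?(ltW d0) //.
apply: (@le_trans _ _ (m.+1%:R * r' ^+ m)).
  by rewrite ler_wpM2r ?exprn_ge0 ?(ltW r'0) // ler_nat.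
rewrite -[X in X%:R * _]card_ord -sumr_const mulr_suml.
apply: ler_sum => k _; rewrite mul1r.
have km : (k <= m)%N by rewrite -ltnS.
rewrite -{1}(subnK km) exprD /= ler_wpM2r ?exprn_ge0 ?(ltW r'0) //.
by rewrite lerXn2r ?nnegrE ?(ltW r0) ?(ltW r'0) ?(ltW rr').
Qed.

Lemma abs_bound_series a r c s : 0 < r -> abs_bound r c s ->
  exists f, has_series a r c s f.
Proof.
move=> r0 cs; have s0 := abs_bound_ge0 cs.
suff h z : exists l : C, ball a r z -> psum c (disp a z) @ \oo --> l.
  by have [f hf] := choice h; exists f.
have [az|naz] := pselect (ball a r z); last by exists 0 => /naz.
have [t /andP[t0 tr] wt] := ball_margin az.
have q01 : 0 <= t / r < 1.
  by rewrite divr_ge0 ?(ltW r0) // ltr_pdivrMr // mul1r.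
pose x k := \sum_(v : bmultinom n k.+1 | (mdeg v == k)%N) c v * mon (disp a z) v.
have xk k : `|x k| <= s * (t / r) ^+ k.
  rewrite expr_div_n mulrA ler_pdivlMr ?exprn_gt0 //.
  apply: (@le_trans _ _ (\sum_(v : bmultinom n k.+1 | (mdeg v == k)%N)
     (`|c v| * r ^+ mdeg v) * t ^+ k)); last first.
    rewrite -mulr_suml ler_wpM2r ?exprn_ge0 //; apply: le_trans (cs k.+1).
    rewrite [leRHS](bigID (fun v : bmultinom n k.+1 => mdeg v == k)) /=.
    rewrite lerDl sumr_ge0 // => v _.
    by rewrite mulr_ge0 // exprn_ge0 // ltW.
  apply: le_trans (ler_wpM2r _ (ler_norm_sum _ _ _)) _.
    by rewrite exprn_ge0 // ltW.
  rewrite mulr_suml; apply: ler_sum => v /eqP vk.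
  rewrite normrM -!mulrA ler_wpM2l // mulrC vk ler_wpM2l ?exprn_ge0 ?(ltW r0) //.
  by have := mon_le v wt; rewrite vk.
have [l hl] := geom_cvg q01 s0 xk; exists l => _.
rewrite (_ : psum c (disp a z) = fun K => \sum_(k < K) x k); first exact: hl.
by apply/funext => K; exact: psum_homog.
Qed.

(** Only the [i]-th coordinate moves, so this is [taylor1_bound] in that coordinate times a factor
    common to all terms. *)
Lemma mon_diff w i (h d : C) (rho : C) (u : multinom n) :
  0 < d -> `|h| <= d -> (forall k, `|w k| + d <= rho) ->
  `|mon (fun k => w k + h * (k == i)%:R) u - mon w u
     - h * ((u i)%:R * mon w (mnm_sub u (mnm1 i)))| <=
  (`|h| / d) ^+ 2 * rho ^+ mdeg u.
Proof.
move=> d0 hd wr.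
have rho0 : 0 <= rho by apply: le_trans (wr i); rewrite addr_ge0 // ltW.
pose p := \prod_(k < n | k != i) w k ^+ u k.
have E1 : mon (fun k => w k + h * (k == i)%:R) u = (w i + h) ^+ u i * p.
  rewrite /mon (bigD1 i) //= eqxx mulr1; congr (_ * _).
  by apply: eq_bigr => k /negbTE ki; rewrite ki mulr0 addr0.
have E2 : mon w u = w i ^+ u i * p by rewrite /mon (bigD1 i).
have E3 : mon w (mnm_sub u (mnm1 i)) = w i ^+ (u i).-1 * p.
  rewrite /mon (bigD1 i) //= mnmBE mnm1E eqxx subn1; congr (_ * _).
  apply: eq_bigr => k /negbTE ki.
  by rewrite mnmBE mnm1E eq_sym ki subn0.
rewrite E1 E2 E3.
have -> : (w i + h) ^+ u i * p - w i ^+ u i * p -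
    h * ((u i)%:R * (w i ^+ (u i).-1 * p)) =
  ((w i + h) ^+ u i - w i ^+ u i - h * (u i)%:R * w i ^+ (u i).-1) * p by ring.
rewrite normrM mdegE (bigD1 i) //= exprD mulrA.
apply: ler_pM => //.
  apply: le_trans (taylor1_bound _ _ d0 hd) _.
  rewrite ler_wpM2l ?exprn_ge0 ?divr_ge0 ?(ltW d0) //.
  by rewrite lerXn2r ?nnegrE ?addr_ge0 ?(ltW d0).
rewrite /p normr_prod -prodrXr; apply: ler_prod => k _.
rewrite normr_ge0 normrX lerXn2r ?nnegrE //.
by apply: le_trans (wr k); rewrite lerDl ltW.
Qed.

Lemma psum_dcoef i c w N : psum (dcoef i c) w N =
  \sum_(v : bmultinom n N.+1) c v * ((v i)%:R * mon w (mnm_sub v (mnm1 i))).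
Proof.
rewrite [RHS](bigID (fun v : bmultinom n N.+1 => v i != 0%N)) /=.
rewrite [X in _ + X]big1 ?addr0; last first.
  by move=> v; rewrite negbK => /eqP ->; rewrite mul0r mulr0.
rewrite -(sum_bmultinom_shift N i
  (fun v => c v * ((v i)%:R * mon w (mnm_sub v (mnm1 i))))).
apply: eq_bigr => u _; rewrite /dcoef addmK mnmDE mnm1E eqxx addn1.
by rewrite -mulrA mulrCA.
Qed.

(** The quadratic error of each monomial, summed with the weights of [c], is bounded independently
    of the truncation and so survives the limit. *)
Lemma series_quotient i a r r' c s f g : 0 < r' < r ->
  has_series a r c s f -> has_series a r' (dcoef i c) (s / (r - r')) g ->
  forall z h, ball a r' z -> `|h| <= r - r' ->
  `|f (h *: delta_mx 0 i + z) - f z - h * g z| <= (`|h| / (r - r')) ^+ 2 * s.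
Proof.
move=> /andP[r'0 rr'] [r0 cs hf] [_ _ hg] z h az hd.
have d0 : 0 < r - r' by rewrite subr_gt0.
set z' := h *: _ + z; set w := disp a z.
have wr k : `|w k| < r' by have /rV_ballP[_] := az; apply.
have w'E : disp a z' = fun k => w k + h * (k == i)%:R.
  by apply/funext => k; rewrite /disp /z' /w /disp !mxE eqxx /=; ring.
have az' : ball a r z'.
  apply/rV_ballP; split=> // k.
  have -> : z' 0 k - a 0 k = w k + h * (k == i)%:R by have := congr1 (@^~ k) w'E.
  apply: le_lt_trans (ler_normD _ _) _; rewrite normrM.
  have -> : r = r' + (r - r') by rewrite addrC subrK.
  apply: ltr_leD => //; apply: le_trans hd.
  by case: (k == i); rewrite ?normr1 ?mulr1 // normr0 mulr0.
have h1 := hf _ (ball_shrink (ltW rr') az).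
have h2 := hf _ az'; have h3 := hg _ az.
(* Differentiation lowers the degree by one, so truncating [f] at [N.+1] and its derivative at [N]
   makes the difference termwise. *)
pose S N := psum c (disp a z') N.+1 - psum c w N.+1 - h * psum (dcoef i c) w N.
apply: (@cvg_norm_le _ S _ _ 0).
  move=> N _; rewrite /S psum_dcoef /psum w'E -sumrB mulr_sumr -sumrB.
  apply: le_trans (ler_norm_sum _ _ _) _.
  apply: (@le_trans _ _ (\sum_(v : bmultinom n N.+1)
     (`|h| / (r - r')) ^+ 2 * (`|c v| * r ^+ mdeg v))); last first.
    by rewrite -mulr_sumr ler_wpM2l // exprn_ge0 // divr_ge0 // ltW.
  apply: ler_sum => v _.
  rewrite [X in `|X|](_ : _ = c v * (mon (fun k => w k + h * (k == i)%:R) v -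
     mon w v - h * ((v i)%:R * mon w (mnm_sub v (mnm1 i))))); last by ring.
  rewrite normrM [leRHS]mulrCA ler_wpM2l //; apply: mon_diff => // k.
  by rewrite -lerBrDr opprB addrCA subrr addr0 ltW.
rewrite /S; apply: cvgB.
  apply: cvgB; [rewrite (cvg_shiftS (psum c (disp a z'))); exact: h2|].
  by rewrite (cvg_shiftS (psum c w)); exact: h1.
by apply: cvgMl_tmp; exact: h3.
Qed.

Lemma series_derive i a r r' c s f : 0 < r' < r -> has_series a r c s f ->
  has_series a r' (dcoef i c) (s / (r - r')) ('D_(delta_mx 0 i) f) /\
  forall z, ball a r' z -> derivable f z (delta_mx 0 i).
Proof.
move=> rr fs; have [r0 cs _] := fs; have [r'0 rr'] := andP rr.
have s0 := abs_bound_ge0 cs.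
have d0 : 0 < r - r' by rewrite subr_gt0.
have [g gs] := abs_bound_series a r'0 (dcoef_bound i rr cs).
have cvg_g z : ball a r' z ->
    (fun h => h^-1 *: ((f \o shift z) (h *: delta_mx 0 i) - f z)) @ 0^' --> g z.
  move=> az; apply/cvgrPdist_lt => e e0.
  (* This bound on [|h|] makes the error of the difference quotient, at most
     [|h| * s / (r - r') ^+ 2], smaller than [e]; [s + 1] avoids dividing by zero. *)
  have b0 : 0 < e * (r - r') ^+ 2 / (s + 1).
    by rewrite divr_gt0 ?mulr_gt0 ?exprn_gt0 // ltr_wpDl.
  near=> h.
  have h0 : h != 0 by near: h; exact: nbhs_dnbhs_neq.
  have hd : `|h| <= r - r' by near: h; exact: dnbhs0_le.
  have hb : `|h| < e * (r - r') ^+ 2 / (s + 1) by near: h; exact: dnbhs0_lt.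
  have := series_quotient rr fs gs az hd.
  rewrite /= -/(shift z _) => hq.
  have -> : g z - h^-1 *: (f (shift z (h *: delta_mx 0 i)) - f z) =
     - h^-1 * (f (h *: delta_mx 0 i + z) - f z - h * g z).
    by rewrite /shift /= /GRing.scale /=; field.
  rewrite normrM normrN normfV mulrC ltr_pdivrMr ?normr_gt0 //.
  apply: le_lt_trans hq _.
  have -> : (`|h| / (r - r')) ^+ 2 * s = `|h| * (`|h| * s / (r - r') ^+ 2).
    by field; rewrite gt_eqF.
  rewrite [ltRHS]mulrC ltr_pM2l ?normr_gt0 // ltr_pdivrMr ?exprn_gt0 //.
  move: hb; rewrite ltr_pdivlMr; last by rewrite ltr_wpDl.
  by apply: le_lt_trans; rewrite mulrDr mulr1 lerDl.
split; last by move=> z az; apply/cvg_ex; exists (g z); exact: cvg_g.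
apply: has_series_ext gs => z az.
by apply/esym/cvg_lim; [exact: norm_hausdorff|exact: cvg_g].
Unshelve. all: by end_near. Qed.

Lemma has_series_gt0 a r c s f : has_series a r c s f -> 0 < r.
Proof. by case. Qed.

Lemma derive_near0 f v a : (\forall z \near a, f z = 0) ->
  \forall z \near a, 'D_v f z = 0.
Proof.
move=> /near_rV_near; apply: near_rV_mono => z fz.
by rewrite (@near_eq_derive _ _ _ f (cst 0) z v fz) derive_cst.
Qed.

(** Induction on the degree: the partial derivatives also vanish near [a], and a coefficient of
    degree [m.+1] is, up to a nonzero integer, a coefficient of degree [m] of one of them. *)
Lemma has_series0 a r c s f : has_series a r c s f ->
  (\forall z \near a, f z = 0) -> forall u, c u = 0.
Proof.
move=> fs f0 u; move E: (mdeg u) => m.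
elim: m r c s f fs f0 u E => [|m IH] r c s f fs f0 u um.
  have -> : u = mnm0 by apply/eqP; rewrite -mdeg_eq0 um.
  by rewrite (has_series_coef0 fs); apply: near_rV_self f0.
have [i ui] : exists i, u i != 0%N by apply: mnm_neq0P; rewrite -mdeg_eq0 um.
have r0 := has_series_gt0 fs.
have rr := half_itv r0.
have [ds _] := series_derive i rr fs.
have e := mnm_sub1K ui.
have := IH _ _ _ _ ds (derive_near0 _ f0) (mnm_sub u (mnm1 i)) _.
rewrite /dcoef e => H; have : (((mnm_sub u (mnm1 i)) i).+1%:R : C) * c u = 0.
  by apply: H; have := um; rewrite -{1}e mdegD mdeg1 addn1 => -[].
by move/eqP; rewrite mulf_eq0 pnatr_eq0 /= => /eqP.
Qed.

Lemma has_series_zero a r c s f : has_series a r c s f -> (forall u, c u = 0) ->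
  forall z, ball a r z -> f z = 0.
Proof.
move=> [_ _ hf] c0 z /hf h.
have h2 : psum c (disp a z) @ \oo --> (0 : C).
  apply: cvg_near_cst; apply: nearW => N; rewrite /psum big1 // => u _.
  by rewrite c0 mul0r.
exact: (cvg_unique _ h h2).
Qed.

Lemma analytic_derive f a i : analytic_at f a ->
  analytic_at ('D_(delta_mx 0 i) f) a /\
  \forall z \near a, derivable f z (delta_mx 0 i).
Proof.
move=> /analytic_normP[r [s [c fs]]]; have r0 := has_series_gt0 fs.
have rr := half_itv r0.
have [ds df] := series_derive i rr fs; split.
  by apply/analytic_normP; exists (r / 2); eexists; eexists; exact: ds.
by apply/near_rV_ball; exists (r / 2) => //; case/andP: rr.
Qed.

(** Each mixed derivative at the centre is the constant coefficient of a twice differentiated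
    series, and the two formal coefficients agree. *)
Lemma analytic_deriveC f a i k : analytic_at f a ->
  'D_(delta_mx 0 i) ('D_(delta_mx 0 k) f) a =
  'D_(delta_mx 0 k) ('D_(delta_mx 0 i) f) a.
Proof.
move=> /analytic_normP[r [s [c fs]]]; have r0 := has_series_gt0 fs.
have rr := half_itv r0.
have r20 : 0 < r / 2 by case/andP: rr.
have rr2 := half_itv r20.
have [di _] := series_derive i rr fs; have [dk _] := series_derive k rr fs.
have [dik _] := series_derive k rr2 di; have [dki _] := series_derive i rr2 dk.
have e1 := has_series_coef0 dik; have e2 := has_series_coef0 dki.
refine (etrans (esym e2) (etrans _ e1)); rewrite /dcoef.
rewrite !mnmDE !mnm1E !mnm0E !add0n [k == i]eq_sym.
by congr (_ * (_ * c _)); apply/mnmP => l; rewrite !mnmDE addnAC.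
Qed.

Lemma analytic_locally_const f a :
  analytic_at f a -> (forall i, \forall z \near a, 'D_(delta_mx 0 i) f z = 0) ->
  \forall z \near a, f z = f a.
Proof.
move=> /analytic_normP[r [s [c fs]]] h; have r0 := has_series_gt0 fs.
have rr := half_itv r0.
apply/near_rV_ball; exists r => // z az.
have c0 u : u != mnm0 -> c u = 0.
  move=> /mnm_neq0P[i ui].
  have [ds _] := series_derive i rr fs.
  have := has_series0 ds (h i) (mnm_sub u (mnm1 i)).
  rewrite /dcoef mnm_sub1K // => /eqP.
  by rewrite mulf_eq0 pnatr_eq0 /= => /eqP.
have [_ _ /(_ z az) h1] := fs.
rewrite -(has_series_coef0 fs).
have h2 : psum c (disp a z) @ \oo --> c mnm0.
  by apply: psum_cvg_coef0 => u u0; rewrite c0 // mul0r.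
exact: (cvg_unique _ h1 h2).
Qed.

(** A uniform radius: about any [w] within [r / 4] of [a] the series still converges on
    [ball w (r / 2)], which contains every [w'] within [r / 4] of [a]. *)
Lemma analytic_zero_propagate f a : analytic_at f a ->
  exists2 r, 0 < r & forall w w' : 'rV[C]_n, ball a r w -> ball a r w' ->
    (\forall z \near w, f z = 0) -> \forall z \near w', f z = 0.
Proof.
move=> /analytic_normP[r [s fa]]; have r0 := analytic_norm_gt0 fa.
have r40 : 0 < r / 4 by rewrite divr_gt0.
have r20 : 0 < r / 2 by rewrite divr_gt0.
exists (r / 4); [exact: r40|move=> w w' aw aw' f0].
have wr i : `|w 0 i - a 0 i| <= r / 4 by have /rV_ballP[_ /(_ i)/ltW] := aw.
have tr : r / 4 + r / 2 < r.
  have -> : r / 4 + r / 2 = r - r / 4 by field.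
  by rewrite gtrBl.
have [c cs] := analytic_norm_recenter fa wr (ltW r40) r20 tr.
have h := has_series_zero cs (has_series0 cs f0).
have ww' : ball w (r / 2) w'.
  have -> : r / 2 = r / 4 + r / 4 by field.
  by apply: ball_triangle aw'; apply: ball_sym.
have : \forall z \near w', ball w (r / 2) z.
  by apply: open_nbhs_nbhs; split; [exact: ball_open|exact: ww'].
by apply: near_rV_mono => z; exact: h.
Qed.

End Fixed.
End Derivatives.

(** * The identity theorem on convex sets *)

(** Connectedness of the unit interval, shaped for continuation along a segment. Local propagation
    goes in both directions, so it carries [P] both to the supremum of the good times and past
    it. *)
Lemma real_induction (R : realType) (P : R -> Prop) : P 0 ->
  (forall t, 0 <= t <= 1 -> exists2 e : R, 0 < e &
     forall s s', 0 <= s <= 1 -> 0 <= s' <= 1 ->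
       `|s - t| < e -> `|s' - t| < e -> P s -> P s') ->
  P 1.
Proof.
move=> P0 loc; pose A := [set t : R | 0 <= t <= 1 /\ P t].
have A0 : A 0 by split; rewrite ?lexx ?ler01.
have ubA : has_sup A.
  by split; [exists 0|exists 1 => t [/andP[]]].
set t0 := sup A.
have t01 : 0 <= t0 <= 1.
  by rewrite (ub_le_sup ubA.2 A0) ge_sup //; [exists 0|move=> t [/andP[]]].
have [e e0 he] := loc _ t01.
have [s [s01 Ps] st] := sup_adherent e0 ubA.
have st0 : s <= t0 by apply: (ub_le_sup ubA.2).
have se : `|s - t0| < e.
  by rewrite distrC ger0_norm ?subr_ge0 // ltrBlDr addrC -ltrBlDr.
have [t1|t1] := ltP t0 1; last first.
  have -> : 1 = t0 :> R by apply/le_anti; rewrite t1; case/andP: t01.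
  by apply: (he s) => //; rewrite subrr normr0.
pose s' := Num.min 1 (t0 + e / 2).
have e20 : 0 < e / 2 by rewrite divr_gt0.
have ts' : t0 < s' by rewrite lt_min t1 ltrDl.
have s'01 : 0 <= s' <= 1.
  by rewrite ge_min lexx (le_trans _ (ltW ts')) //; case/andP: t01.
have s'e : `|s' - t0| < e.
  rewrite ger0_norm ?subr_ge0 ?(ltW ts') // ltrBlDl.
  rewrite gt_min; apply/orP; right; rewrite ltrD2l.
  by rewrite ltr_pdivrMr // ltr_pMr // ltr1n.
have Ps' := he _ _ s01 s'01 se s'e Ps.
have : s' <= t0 by apply: (ub_le_sup ubA.2).
by rewrite leNgt ts'.
Qed.

Section Segments.
Variables (R : realType) (n : nat).
Local Notation C := (Cx R).
Implicit Types (a z w : 'rV[C]_n) (D : set 'rV[C]_n) (r : C).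

Definition seg a z (t : R) : 'rV[C]_n := a + ((t%:C)%C : C) *: (z - a).

Lemma seg0 a z : seg a z 0 = a.
Proof. by rewrite /seg scale0r addr0. Qed.

Lemma seg1 a z : seg a z 1 = z.
Proof. by rewrite /seg scale1r addrC subrK. Qed.

Lemma segE a z t i : seg a z t 0 i = a 0 i + ((t%:C)%C : C) * (z 0 i - a 0 i).
Proof. by rewrite !mxE. Qed.

Definition convex_set D := forall a z, D a -> D z ->
  forall t : R, 0 <= t <= 1 -> D (seg a z t).

Lemma norm_real_complex (t : R) : `|(t%:C)%C : C| = (`|t|%:C)%C.
Proof. by rewrite normc_def /= expr0n addr0 sqrtr_sqr. Qed.

Lemma convex_ball c r : convex_set (ball c r).
Proof.
move=> a z /rV_ballP[r0 ha] /rV_ballP[_ hz] t /andP[t0 t1].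
apply/rV_ballP; split; first exact: r0.
move=> i; rewrite segE.
have [<-|t0'] := eqVneq 0 t; first by rewrite mul0r addr0.
have tp : (0 : C) < (t%:C)%C by rewrite ltcE /= eqxx lt_neqAle t0'.
have -> : a 0 i + ((t%:C)%C : C) * (z 0 i - a 0 i) - c 0 i =
  (1 - (t%:C)%C) * (a 0 i - c 0 i) + (t%:C)%C * (z 0 i - c 0 i) :> C by ring.
have t1' : (0 : C) <= 1 - (t%:C)%C by rewrite subr_ge0 lecE /= eqxx.
apply: le_lt_trans (ler_normD _ _) _.
rewrite !normrM (ger0_norm t1') (gtr0_norm tp).
have -> : r = (1 - (t%:C)%C) * r + (t%:C)%C * r by ring.
apply: ler_ltD; first by rewrite ler_wpM2l // ltW.
by rewrite ltr_pM2l.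
Qed.

Lemma convex_set1 a : convex_set [set a].
Proof. by move=> _ _ -> -> t _; rewrite /seg subrr scaler0 addr0. Qed.

Lemma convex_setI D D' : convex_set D -> convex_set D' ->
  convex_set (D `&` D').
Proof. by move=> h h' a z [? ?] [? ?] t t01; split; [apply: h|apply: h']. Qed.

Lemma affine_difference (k k' : C) a z i :
  (a + k *: (z - a)) 0 i - (a + k' *: (z - a)) 0 i = (k - k') * (z 0 i - a 0 i).
Proof. by rewrite !mxE; ring. Qed.

Lemma seg_near a z (t : R) r : 0 < r ->
  exists2 d : R, 0 < d & forall s, `|s - t| < d ->
    ball (seg a z t) r (seg a z s).
Proof.
move=> r0; have [q q0 rq] := ge0_complexP (ltW r0).
have {}q0 : 0 < q by move: r0; rewrite rq ltcE /= eqxx.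
have [M M0 hM] : exists2 M : R, 0 < M & forall i, `|z 0 i - a 0 i| <= (M%:C)%C.
  pose S := 1 + \sum_i `|z 0 i - a 0 i|.
  have S0 : 0 < S by rewrite ltr_wpDr // sumr_ge0.
  have [M M0 SM] := ge0_complexP (ltW S0).
  exists M => [|i]; first by move: S0; rewrite SM ltcE /= eqxx.
  rewrite -SM /S (bigD1 i) //= addrCA lerDl addr_ge0 //.
  by rewrite sumr_ge0.
exists (q / M) => [|s st]; first by rewrite divr_gt0.
apply/rV_ballP; split; first exact: r0.
move=> i; have -> : seg a z s 0 i - seg a z t 0 i =
    ((s - t)%:C)%C * (z 0 i - a 0 i) :> C.
  rewrite -[LHS]/((a + (_ : C) *: (z - a)) 0 i - (a + (_ : C) *: (z - a)) 0 i).
  rewrite rmorphB /=; exact: affine_difference.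
rewrite normrM norm_real_complex.
apply: (@le_lt_trans _ _ ((`|s - t|%:C)%C * (M%:C)%C)).
  by rewrite ler_wpM2l // lecE /= eqxx normr_ge0.
by rewrite -rmorphM rq ltcE /= eqxx /= -ltr_pdivlMr.
Qed.

Lemma convex_propagate D (P : 'rV[C]_n -> Prop) : convex_set D ->
  (forall z, D z -> exists2 r : C, 0 < r & forall w w', D w -> D w' ->
     ball z r w -> ball z r w' -> P w -> P w') ->
  forall a z, D a -> D z -> P a -> P z.
Proof.
move=> cD loc a z Da Dz Pa; rewrite -(seg1 a z).
apply: (real_induction (P := fun t => P (seg a z t))); first by rewrite seg0.
move=> t t01; have [r r0 h] := loc _ (cD _ _ Da Dz _ t01).
have [d d0 hd] := seg_near a z t r0; exists d; first exact: d0.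
move=> s s' s01 s'01 st s't.
by apply: h; [apply: cD|apply: cD|apply: hd|apply: hd].
Qed.

Lemma analytic_identity D (f : 'rV[C]_n -> C) : convex_set D ->
  (forall z, D z -> analytic_at f z) -> forall a z, D a -> D z ->
  (\forall w \near a, f w = 0) -> \forall w \near z, f w = 0.
Proof.
move=> cD fD; apply: (convex_propagate (P := fun z => \forall w \near z, f w = 0) cD).
move=> z /fD /analytic_zero_propagate[r r0 h]; exists r; first exact: r0.
move=> w w' _ _ zw zw'.
exact: h.
Qed.

(** Germs of analytic functions form a domain: if [g] is not zero near [a], then [f] vanishes near
    some point where [g] does not, and the identity theorem on a ball brings this back to [a]. *)
Lemma analytic_mul_eq0 (f g : 'rV[C]_n -> C) a :
  analytic_at f a -> analytic_at g a -> (\forall z \near a, f z * g z = 0) ->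
  (\forall z \near a, f z = 0) \/ (\forall z \near a, g z = 0).
Proof.
move=> fa ga fg0; have [|gn0] := pselect (\forall z \near a, g z = 0); first by right.
left.
have : \forall z \near a, (analytic_at f z /\ analytic_at g z) /\ f z * g z = 0.
  apply: near_rV_mono2 fg0; last first.
    by apply: near_rV_mono2 (analytic_near fa) (analytic_near ga) => w h1 h2; exact: conj h1 h2.
  by move=> w h1 h2; split.
move=> /near_rV_ball[r r0 h].
have [z az gz] : exists2 z, ball a r z & g z != 0.
  apply: contrapT => H; apply: gn0; apply/near_rV_ball; exists r; first exact: r0.
  move=> z az.
  by apply/eqP; apply: contrapT => gz; apply: H; exists z; [exact: az|apply/negP].
have [[_ gaz] _] := h z az.
have fz0 : \forall w \near z, f w = 0.
  apply: near_rV_mono2 (analytic_near_neq0 gaz gz) (_ : \forall w \near z, ball a r w).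
    by move=> w gw /h[_ /eqP]; rewrite mulf_eq0 (negbTE gw) orbF => /eqP.
  by apply: open_nbhs_nbhs; split; [exact: ball_open|exact: az].
apply: (analytic_identity (@convex_ball a r) _ az (ballxx a r0) fz0).
by move=> w /h[[]].
Qed.

End Segments.

(** * Fields of meromorphic germs *)

Section Generic.
Variables (R : realType) (n : nat).
Local Notation C := (Cx R).
Local Notation V := 'rV[C]_n.
Implicit Types (D : set V) (f g h : V -> C) (P Q : V -> Prop).

Definition analytic_all D f := forall d, D d -> analytic_at f d.

Definition nonzero_germs D f :=
  analytic_all D f /\ forall d, D d -> ~ (\forall z \near d, f z = 0).

(* A nonzero denominator [h] may vanish on a hypersurface through the points
   of [D], so identities between quotients are only asserted where [h] does not
   vanish. *)
Definition generically D P := exists2 h, nonzero_germs D h &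
  forall d, D d -> \forall z \near d, h z != 0 -> P z.

Lemma nonzero_germs_mul D f g : nonzero_germs D f -> nonzero_germs D g ->
  nonzero_germs D (fun z => f z * g z).
Proof.
move=> [fD f0] [gD g0]; split=> d Dd; first by apply: analytic_mul; [exact: fD|exact: gD].
by case/(analytic_mul_eq0 (fD _ Dd) (gD _ Dd)); [exact: f0|exact: g0].
Qed.

Lemma nonzero_germs1 D : nonzero_germs D (fun=> 1).
Proof.
split=> d Dd; first exact: analytic_cst.
by move=> /near_rV_self /eqP; rewrite oner_eq0.
Qed.

Lemma gen_mono D P Q : (forall z, P z -> Q z) -> generically D P -> generically D Q.
Proof.
move=> PQ [h h0 hP]; exists h => // d /hP; apply: near_rV_mono => z Pz /Pz.
exact: PQ.
Qed.

Lemma gen_near D P : (forall d, D d -> \forall z \near d, P z) -> generically D P.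
Proof.
move=> h; exists (fun=> 1); first exact: nonzero_germs1.
by move=> d /h; apply: near_rV_mono.
Qed.

Lemma gen_all D P : (forall z, P z) -> generically D P.
Proof. by move=> h; apply: gen_near => d _; exact: near_rV_all. Qed.

Lemma gen_and D P Q : generically D P -> generically D Q ->
  generically D (fun z => P z /\ Q z).
Proof.
move=> [h h0 hP] [g g0 gQ]; exists (fun z => h z * g z).
  exact: nonzero_germs_mul.
move=> d Dd; apply: near_rV_mono2 (hP d Dd) (gQ d Dd) => z Pz Qz.
by rewrite mulf_eq0 negb_or => /andP[/Pz ? /Qz].
Qed.

Lemma gen_mono2 D P Q S : (forall z, P z -> Q z -> S z) ->
  generically D P -> generically D Q -> generically D S.
Proof.
move=> PQ hP hQ; apply: gen_mono (gen_and hP hQ) => z [].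
exact: PQ.
Qed.

Lemma gen_forall (I : finType) D (P : I -> V -> Prop) :
  (forall i, generically D (P i)) -> generically D (fun z => forall i, P i z).
Proof.
move=> h; suff H : generically D (fun z => forall i, i \in enum I -> P i z).
  by apply: gen_mono H => z Hz i; apply: Hz; rewrite mem_enum.
elim: (enum I) => [|i l IH]; first exact: gen_all.
apply: gen_mono2 (h i) IH => z hi hl k.
by rewrite inE => /predU1P[->|/hl].
Qed.

Lemma gen_nonzero D f : nonzero_germs D f -> generically D (fun z => f z != 0).
Proof. by move=> f0; exists f => // d _; exact: near_rV_all. Qed.

(** Turns a generic statement into one on an actual ball, centred where the exceptional denominator
    is nonzero; this ball may miss [d]. *)
Lemma gen_ex D P d r : D d -> 0 < r -> generically D P ->
  exists c r', [/\ 0 < r', ball c r' `<=` ball d r & forall z, ball c r' z -> P z].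
Proof.
move=> Dd r0 [h [hD h0] hP].
have : \forall z \near d, analytic_at h z /\ (h z != 0 -> P z).
  by apply: near_rV_mono2 (analytic_near (hD _ Dd)) (hP _ Dd).
move=> /near_rV_ball[e e0 he].
have [t t0 [tr te]] : exists2 t, 0 < t & t <= r /\ t <= e.
  have re : r >=< e by apply: real_comparable; rewrite gtr0_real.
  by case/comparable_leP: re => h'; [exists r|exists e => //; rewrite ltW].
have [c dc hc] : exists2 c, ball d t c & h c != 0.
  apply: contrapT => H; apply: (h0 _ Dd); apply/near_rV_ball; exists t.
    exact: t0.
  move=> z az.
  by apply/eqP; apply: contrapT => gz; apply: H; exists z; [exact: az|apply/negP].
have [hca _] := he c (ball_shrink te dc).
have : \forall z \near c, h z != 0 /\ ball d t z.
  apply: near_rV_mono2 (analytic_near_neq0 hca hc) (_ : \forall w \near c, ball d t w).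
    by move=> w h1 h2; split.
  by apply: open_nbhs_nbhs; split; [exact: ball_open|exact: dc].
move=> /near_rV_ball[r' r'0 hr']; exists c, r'; split; first exact: r'0.
  by move=> z /hr'[_ /(ball_shrink tr)].
by move=> z /hr'[hz /(ball_shrink te)/he[_]]; apply.
Qed.

Lemma gen_false D d : D d -> ~ generically D (fun=> False).
Proof.
move=> Dd /(gen_ex Dd ltr01) [c [r [r0 _ h]]].
exact: (h c (ballxx c r0)).
Qed.

(** Between analytic functions no exceptional set remains: [h * (f - g)] vanishes near [d], and the
    germ of [h] is not a zero divisor. *)
Lemma gen_eq_near D f g : analytic_all D f -> analytic_all D g ->
  generically D (fun z => f z = g z) ->
  forall d, D d -> \forall z \near d, f z = g z.
Proof.
move=> fD gD [h [hD h0] hfg] d Dd.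
have an : analytic_at (fun z => f z - g z) d.
  by apply: analytic_add; [exact: fD|apply: analytic_opp; exact: gD].
have : \forall z \near d, h z * (f z - g z) = 0.
  apply: near_rV_mono (hfg _ Dd) => z hz.
  have [->|/hz ->] := eqVneq (h z) 0; first by rewrite mul0r.
  by rewrite subrr mulr0.
case/(analytic_mul_eq0 (hD _ Dd) an) => [/(h0 _ Dd)//|].
by apply: near_rV_mono => z /eqP; rewrite subr_eq0 => /eqP.
Qed.

(** By the identity theorem, one zero germ on a convex set forces all of them to vanish. This
    dichotomy is what makes nonzero classes invertible. *)
Lemma gen_zero_dec D f d0 : convex_set D -> D d0 -> analytic_all D f ->
  nonzero_germs D f \/ generically D (fun z => f z = 0).
Proof.
move=> cD Dd0 fD.
have [[d Dd f0]|h] := pselect (exists2 d, D d & \forall z \near d, f z = 0).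
  right; apply: gen_near => d' Dd'.
  exact: (analytic_identity cD fD Dd Dd' f0).
by left; split=> // d Dd f0; apply: h; exists d.
Qed.

(** Such functions are total, with arbitrary values where [h] vanishes; the quotient by [gen_zero]
    below forgets those values. *)
Definition meromorphic D f := exists g h,
  [/\ analytic_all D g, nonzero_germs D h &
      generically D (fun z => f z = g z / h z)].

End Generic.

(** * The ring of meromorphic functions modulo generic equality *)

Section MeroField.
Variables (R : realType) (n : nat).
Local Notation C := (Cx R).
Local Notation V := 'rV[C]_n.

(* Points and balls are the two domains used; convexity is what makes the ring of
   functions meromorphic near [D] an integral domain modulo generic equality. *)
Record convex_domain := ConvexDomain {
  cdom :> set V ;
  cdom_pt : V ;
  cdom_in : cdom cdom_pt ;
  cdom_convex : convex_set cdom }.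

Section Fixed.
Variable D : convex_domain.
Implicit Types (f g h : V -> C).

Definition mero_pred : {pred V -> C} := fun f => `[< meromorphic D f >].

Lemma mero_predP f : reflect (meromorphic D f) (f \in mero_pred).
Proof. exact: asboolP. Qed.

Lemma gen_div_add f g h h' : nonzero_germs D h -> nonzero_germs D h' ->
  generically D (fun z => f z / h z - g z / h' z =
    (f z * h' z + - (g z * h z)) / (h z * h' z)).
Proof.
move=> h0 h'0; apply: gen_mono2 (gen_nonzero h0) (gen_nonzero h'0) => z hz h'z.
by field; rewrite hz h'z.
Qed.

Lemma mero_subring : subring_closed mero_pred.
Proof.
split.
- apply/mero_predP; exists (fun=> 1), (fun=> 1); split.
  + by move=> d _; exact: analytic_cst.
  + exact: nonzero_germs1.
  + by apply: gen_all => z; rewrite divr1.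
- move=> f f' /mero_predP[g [h [gD h0 fE]]] /mero_predP[g' [h' [gD' h0' fE']]].
  apply/mero_predP; exists (fun z => g z * h' z + - (g' z * h z)),
    (fun z => h z * h' z); split.
  + move=> d Dd; apply: analytic_add; first by apply: analytic_mul; [exact: gD|exact: h0'.1].
    by apply: analytic_opp; apply: analytic_mul; [exact: gD'|exact: h0.1].
  + exact: nonzero_germs_mul.
  + apply: gen_mono2 (gen_and fE fE') (gen_div_add g g' h0 h0') => z [e1 e2] <-.
    by rewrite -e1 -e2.
- move=> f f' /mero_predP[g [h [gD h0 fE]]] /mero_predP[g' [h' [gD' h0' fE']]].
  apply/mero_predP; exists (fun z => g z * g' z), (fun z => h z * h' z); split.
  + by move=> d Dd; apply: analytic_mul; [exact: gD|exact: gD'].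
  + exact: nonzero_germs_mul.
  + by apply: gen_mono2 fE fE' => z e1 e2; rewrite /GRing.mul /= e1 e2 mulf_div.
Qed.

HB.instance Definition _ :=
  GRing.isSubringClosed.Build (V -> C) mero_pred mero_subring.

Record mero_fun := MeroFun { mero_val :> V -> C ; _ : mero_val \in mero_pred }.
HB.instance Definition _ := [isSub for mero_val].
HB.instance Definition _ := [Choice of mero_fun by <:].
HB.instance Definition _ := [SubChoice_isSubComNzRing of mero_fun by <:].

Definition gen_zero : {pred mero_fun} :=
  fun u => `[< generically D (fun z => mero_val u z = 0) >].

Lemma gen_zero_closed : idealr_closed gen_zero.
Proof.
split.
- by apply/asboolP; apply: gen_all.
- by apply/negP => /asboolP h; apply: (gen_false (cdom_in D)); apply: gen_mono h => z /eqP;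
    rewrite oner_eq0.
- move=> u v w /asboolP f0 /asboolP g0; apply/asboolP.
  by apply: gen_mono2 f0 g0 => z e1 e2; rewrite /= /GRing.add /GRing.mul /= e1 e2 mulr0 addr0.
Qed.

HB.instance Definition _ := GRing.isZmodClosed.Build mero_fun gen_zero
  (idealr_closedB gen_zero_closed).
HB.instance Definition _ := isProperIdeal.Build mero_fun gen_zero
  (idealr_closed_nontrivial gen_zero_closed).

Definition mero_germ := {ideal_quot gen_zero}.
HB.instance Definition _ := GRing.ComNzRing.on mero_germ.

(** Made total by sending functions that are not meromorphic to the class of [0]. *)
Definition germ_class f : mero_germ :=
  \pi_({ideal_quot gen_zero})%qT (insubd (0 : mero_fun) f).

Lemma germ_class_val (x : mero_fun) : germ_class x = \pi_({ideal_quot gen_zero})%qT x.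
Proof. by rewrite /germ_class /= valKd. Qed.

Lemma germ_class_eq f g : meromorphic D f -> meromorphic D g ->
  germ_class f = germ_class g <-> generically D (fun z => f z = g z).
Proof.
move=> /mero_predP fD /mero_predP gD; rewrite /germ_class.
have ef : val (insubd (0 : mero_fun) f) = f by apply: insubdK.
have eg : val (insubd (0 : mero_fun) g) = g by apply: insubdK.
split=> [/eqmodP/=|h].
  rewrite Quotient.equivE => /asboolP; apply: gen_mono => z.
  by rewrite /= ef eg => /eqP; rewrite subr_eq0 => /eqP.
apply/eqmodP => /=; rewrite Quotient.equivE; apply/asboolP; apply: gen_mono h => z h.
by rewrite /= ef eg /GRing.add /GRing.opp /= h subrr.
Qed.

End Fixed.
End MeroField.

Section QuotientRule.
Variables (F : fieldType) (g g' h h' dg dg' dh dh' : F).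
Hypotheses (h0 : h != 0) (h'0 : h' != 0).

(** The hypotheses are the cross-multiplied equality of two fractions and its derivative. *)
Lemma quotient_rule_wd : g * h' = g' * h ->
  dg * h' + g * dh' = dg' * h + g' * dh ->
  (dg * h + - (g * dh)) / (h * h) = (dg' * h' + - (g' * dh')) / (h' * h').
Proof.
move=> e1 e2; have gE : g = g' * h / h' by rewrite -e1 mulfK.
have dgE : dg = (dg' * h + g' * dh - g * dh') / h' by rewrite -e2 addrK mulfK.
by rewrite dgE gE; field; rewrite h0 h'0.
Qed.

Lemma quotient_rule_add :
  (dg * h + - (g * dh)) / (h * h) + (dg' * h' + - (g' * dh')) / (h' * h') =
  (((dg * h' + g * dh') + (dg' * h + g' * dh)) * (h * h') +
   - ((g * h' + g' * h) * (dh * h' + h * dh'))) / ((h * h') * (h * h')).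
Proof. by field; rewrite h0 h'0. Qed.

Lemma quotient_rule_mul :
  (dg * h + - (g * dh)) / (h * h) * (g' / h') +
  g / h * ((dg' * h' + - (g' * dh')) / (h' * h')) =
  ((dg * g' + g * dg') * (h * h') +
   - ((g * g') * (dh * h' + h * dh'))) / ((h * h') * (h * h')).
Proof. by field; rewrite h0 h'0. Qed.

End QuotientRule.

(** * The field structure and the quotient rule *)

Section MeroField.
Variables (R : realType) (n : nat).
Local Notation C := (Cx R).
Local Notation V := 'rV[C]_n.

Section Fixed.
Variable D : convex_domain R n.
Implicit Types (f g h : V -> C) (x y : mero_germ D).

Lemma germ_class_surj x : exists2 f, meromorphic D f & x = germ_class D f.
Proof.
exists (mero_val (repr x)); first by apply/mero_predP; case: (repr x).
by rewrite germ_class_val reprK.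
Qed.

Lemma mero_sub f : meromorphic D f -> exists u : mero_fun D, mero_val u = f.
Proof. by move=> /mero_predP fD; exists (MeroFun fD). Qed.

Lemma germ_class_add f g : meromorphic D f -> meromorphic D g ->
  germ_class D (fun z => f z + g z) = germ_class D f + germ_class D g.
Proof.
move=> /mero_sub[u <-] /mero_sub[v <-].
by rewrite -[fun z => _]/(mero_val (u + v)) !germ_class_val rmorphD.
Qed.

Lemma germ_class_mul f g : meromorphic D f -> meromorphic D g ->
  germ_class D (fun z => f z * g z) = germ_class D f * germ_class D g.
Proof.
move=> /mero_sub[u <-] /mero_sub[v <-].
by rewrite -[fun z => _]/(mero_val (u * v)) !germ_class_val rmorphM.
Qed.

Lemma mero_add f g : meromorphic D f -> meromorphic D g ->
  meromorphic D (fun z => f z + g z).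
Proof.
move=> /mero_sub[u <-] /mero_sub[v <-].
by apply/mero_predP; exact: (valP (u + v)).
Qed.

Lemma mero_mul f g : meromorphic D f -> meromorphic D g ->
  meromorphic D (fun z => f z * g z).
Proof.
move=> /mero_sub[u <-] /mero_sub[v <-].
by apply/mero_predP; exact: (valP (u * v)).
Qed.

Lemma germ_class_1 : germ_class D (fun=> 1) = 1.
Proof. by rewrite -[fun z => _]/(mero_val (1 : mero_fun D)) !germ_class_val rmorph1. Qed.

Lemma germ_class_0 : germ_class D (fun=> 0) = 0.
Proof. by rewrite -[fun z => _]/(mero_val (0 : mero_fun D)) !germ_class_val rmorph0. Qed.

Lemma mero_frac g h : analytic_all D g -> nonzero_germs D h ->
  meromorphic D (fun z => g z / h z).
Proof. by move=> gD h0; exists g, h; split=> //; exact: gen_all. Qed.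

Lemma analytic_mero g : analytic_all D g -> meromorphic D g.
Proof.
move=> gD; exists g, (fun=> 1); split; [exact: gD|exact: nonzero_germs1|].
by apply: gen_all => z; rewrite divr1.
Qed.

Lemma mero_inv f : meromorphic D f -> meromorphic D (fun z => (f z)^-1).
Proof.
move=> [g [h [gD h0 fE]]].
case: (gen_zero_dec (@cdom_convex _ _ D) (cdom_in D) gD) => g0.
  exists h, g; split; [exact: h0.1|exact: g0|].
  by apply: gen_mono fE => z ->; rewrite invf_div.
exists (fun=> 0), (fun=> 1); split.
- by move=> d _; exact: analytic_cst.
- exact: nonzero_germs1.
- by apply: gen_mono2 fE g0 => z -> ->; rewrite mul0r invr0 mul0r.
Qed.

Lemma mero_gen_neq0 f : meromorphic D f -> germ_class D f != 0 ->
  generically D (fun z => f z != 0).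
Proof.
move=> fD; have [g [h [gD h0 fE]]] := fD; rewrite -germ_class_0 => /eqP f0.
case: (gen_zero_dec (@cdom_convex _ _ D) (cdom_in D) gD) => g0; last first.
  case: f0; apply/germ_class_eq => //; last first.
    by apply: gen_mono2 fE g0 => z -> ->; rewrite mul0r.
  by apply: analytic_mero => d _; exact: analytic_cst.
apply: gen_mono2 fE (gen_and (gen_nonzero g0) (gen_nonzero h0)) => z -> [gz hz].
by rewrite mulf_neq0 // invr_neq0.
Qed.

Definition mero_germ_inv x : mero_germ D :=
  germ_class D (fun z => (mero_val (repr x) z)^-1).

Lemma mero_germ_mulV x : x != 0 -> mero_germ_inv x * x = 1.
Proof.
have fD : meromorphic D (mero_val (repr x)) by apply/mero_predP; case: (repr x).
have xE : x = germ_class D (mero_val (repr x)) by rewrite germ_class_val reprK.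
move=> x0; rewrite /mero_germ_inv; set f := mero_val _ in fD xE *.
have f0 : generically D (fun z => f z != 0) by apply: mero_gen_neq0; rewrite -?xE.
rewrite xE -germ_class_mul //; last exact: mero_inv.
rewrite -germ_class_1; apply/germ_class_eq.
- by apply: mero_mul => //; exact: mero_inv.
- by apply: analytic_mero => d _; exact: analytic_cst.
- by apply: gen_mono f0 => z fz; rewrite mulVf.
Qed.

Lemma mero_germ_inv0 : mero_germ_inv 0 = 0.
Proof.
rewrite /mero_germ_inv -{2}germ_class_0; set f := mero_val _.
have fD : meromorphic D f by apply/mero_predP; rewrite /f; case: (repr 0).
have cD : meromorphic D (fun=> 0) by apply: analytic_mero => d _; exact: analytic_cst.
apply/germ_class_eq; [exact: mero_inv|exact: cD|].
have : germ_class D f = germ_class D (fun=> 0) by rewrite germ_class_0 germ_class_val reprK.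
by move=> /(germ_class_eq fD cD); apply: gen_mono => z ->; rewrite invr0.
Qed.

HB.instance Definition _ :=
  GRing.ComNzRing_isField.Build (mero_germ D) mero_germ_mulV mero_germ_inv0.

Definition germ_quot g h : mero_germ D := germ_class D (fun z => g z / h z).

Lemma germ_quot_surj x : exists g h,
  [/\ analytic_all D g, nonzero_germs D h & x = germ_quot g h].
Proof.
have [f fD ->] := germ_class_surj x; have [g [h [gD h0 fE]]] := fD.
exists g, h; split=> //; apply/germ_class_eq => //; exact: mero_frac.
Qed.

(** Since the cross products are analytic, generic equality of the quotients improves to equality
    near every point of [D]. *)
Lemma germ_quot_eq g h g' h' : analytic_all D g -> nonzero_germs D h ->
  analytic_all D g' -> nonzero_germs D h' ->
  germ_quot g h = germ_quot g' h' <-> forall d, cdom D d -> \forall z \near d, g z * h' z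
    = g' z * h z.
Proof.
move=> gD h0 gD' h0'; rewrite /germ_quot germ_class_eq; [|exact: mero_frac|exact: mero_frac].
split=> H.
  apply: gen_eq_near.
  - by move=> d Dd; apply: analytic_mul; [exact: gD|exact: h0'.1].
  - by move=> d Dd; apply: analytic_mul; [exact: gD'|exact: h0.1].
  - apply: gen_mono2 H (gen_and (gen_nonzero h0) (gen_nonzero h0')).
    by move=> z h1 [hz h'z]; apply/eqP; rewrite -eqr_div // h1.
apply: gen_mono2 (gen_near H) (gen_and (gen_nonzero h0) (gen_nonzero h0')).
by move=> z h1 [hz h'z]; apply/eqP; rewrite eqr_div // h1.
Qed.

Lemma germ_quot_add g h g' h' : analytic_all D g -> nonzero_germs D h ->
  analytic_all D g' -> nonzero_germs D h' ->
  germ_quot g h + germ_quot g' h' = germ_quot (fun z => g z * h' z + g' z * h z) (fun z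
    => h z * h' z).
Proof.
move=> gD h0 gD' h0'.
have hh := nonzero_germs_mul h0 h0'.
have m : meromorphic D (fun z => (g z * h' z + g' z * h z) / (h z * h' z)).
  apply: (mero_frac _ hh) => d Dd; apply: analytic_add; apply: analytic_mul.
  - exact: gD.
  - exact: h0'.1.
  - exact: gD'.
  - exact: h0.1.
rewrite /germ_quot -germ_class_add; [|exact: mero_frac|exact: mero_frac].
apply/germ_class_eq; [by apply: mero_add; exact: mero_frac|exact: m|].
apply: gen_mono2 (gen_nonzero h0) (gen_nonzero h0') => z hz h'z.
by field; rewrite hz h'z.
Qed.

Lemma germ_quot_mul g h g' h' : analytic_all D g -> nonzero_germs D h ->
  analytic_all D g' -> nonzero_germs D h' ->
  germ_quot g h * germ_quot g' h' = germ_quot (fun z => g z * g' z) (fun z => h z * h' z).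
Proof.
move=> gD h0 gD' h0'; rewrite /germ_quot -germ_class_mul; [|exact: mero_frac|exact: mero_frac].
by congr (germ_class D _); apply/funext => z; rewrite mulf_div.
Qed.

Notation "''d_' i f" := ('D_(delta_mx 0 i) f) (at level 10, i at next level, f at next level).

Lemma analytic_all_derive i f : analytic_all D f -> analytic_all D ('d_i f).
Proof. by move=> fD d /fD/(analytic_derive i)[]. Qed.

Lemma near_deriv i f d : analytic_all D f -> cdom D d ->
  \forall z \near d, derivable f z (delta_mx 0 i).
Proof. by move=> fD /fD/(analytic_derive i)[]. Qed.

Lemma derive_addE f g z v : derivable f z v -> derivable g z v ->
  'D_v (fun z => f z + g z) z = 'D_v f z + 'D_v g z.
Proof. by move=> df dg; rewrite -(deriveD df dg). Qed.

Lemma derive_mulE f g z v : derivable f z v -> derivable g z v ->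
  'D_v (fun z => f z * g z) z = 'D_v f z * g z + f z * 'D_v g z.
Proof.
move=> df dg; have := deriveM df dg; rewrite addrC [g z *: _]mulrC => <-.
by [].
Qed.

(** Numerator of the quotient rule. *)
Definition qnum i g h : V -> C := fun z => 'd_i g z * h z + - (g z * 'd_i h z).

Lemma qnum_analytic i g h : analytic_all D g -> analytic_all D h ->
  analytic_all D (qnum i g h).
Proof.
move=> gD hD d Dd; apply: analytic_add.
  by apply: analytic_mul; [exact: analytic_all_derive|exact: hD].
apply: analytic_opp; apply: analytic_mul; first exact: gD.
exact: analytic_all_derive.
Qed.

(** The cross-multiplied identity holds on a neighbourhood of each point, so it may be
    differentiated; this supplies the second hypothesis of [quotient_rule_wd]. *)
Lemma germ_quot_deriv_wd i g h g' h' : analytic_all D g -> nonzero_germs D h ->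
  analytic_all D g' -> nonzero_germs D h' -> germ_quot g h = germ_quot g' h' ->
  germ_quot (qnum i g h) (fun z => h z * h z) = germ_quot (qnum i g' h') (fun z => h' z * h' z).
Proof.
move=> gD h0 gD' h0' /(germ_quot_eq gD h0 gD' h0') E.
have hh := nonzero_germs_mul h0 h0; have hh' := nonzero_germs_mul h0' h0'.
rewrite /germ_quot; apply/germ_class_eq.
- exact: (mero_frac (qnum_analytic i gD h0.1) hh).
- exact: (mero_frac (qnum_analytic i gD' h0'.1) hh').
have E' : generically D (fun z =>
    'd_i g z * h' z + g z * 'd_i h' z = 'd_i g' z * h z + g' z * 'd_i h z).
  apply: gen_near => d Dd.
  have N1 : \forall z \near d, derivable g z (delta_mx 0 i) /\ derivable h' z (delta_mx 0 i).
    apply: near_rV_mono2 (near_deriv i gD Dd) (near_deriv i h0'.1 Dd).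
    by move=> z ? ?; split.
  have N2 : \forall z \near d, derivable g' z (delta_mx 0 i) /\ derivable h z (delta_mx 0 i).
    apply: near_rV_mono2 (near_deriv i gD' Dd) (near_deriv i h0.1 Dd).
    by move=> z ? ?; split.
  have N3 := near_rV_near (E d Dd).
  apply: near_rV_mono2 N3 (near_rV_mono2 (fun (z : V) a b => conj a b) N1 N2).
  move=> z e [[d1 d2] [d3 d4]].
  refine (etrans (esym (derive_mulE d1 d2)) (etrans _ (derive_mulE d3 d4))).
  exact: (near_eq_derive _ e).
apply: gen_mono2 (gen_and (gen_nonzero h0) (gen_nonzero h0')) (gen_and (gen_near E) E').
move=> z [hz h'z] [e1 e2]; exact: quotient_rule_wd.
Qed.

End Fixed.
End MeroField.

(** The names encode derivatives: [ig] is the [i]-derivative of [g], [ikg] that of [kg], [xik] that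
    of the numerator for [k], and [hi] that of [h * h]. *)
Lemma quotient_rule_comm (F : fieldType)
    (g h ig kg ih kh ikg kig ikh kih xik xki hi hk w : F) :
  xik = (ikg * h + kg * ih) - (ig * kh + g * ikh) ->
  xki = (kig * h + ig * kh) - (kg * ih + g * kih) ->
  ikg = kig -> ikh = kih -> hi = ih * h + h * ih -> hk = kh * h + h * kh ->
  (xik * (h * h) + - ((kg * h + - (g * kh)) * hi)) / w =
  (xki * (h * h) + - ((ig * h + - (g * ih)) * hk)) / w.
Proof. by move=> -> -> -> -> -> ->; congr (_ / _); ring. Qed.

Lemma quotient_rule_eq0 (F : fieldType) (f df h dh : F) : h != 0 ->
  (df * h + f * dh) * h + - (f * h * dh) = 0 -> df = 0.
Proof.
move=> h0 E; have : df * (h * h) = 0 by rewrite -E; ring.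
by move/eqP; rewrite !mulf_eq0 (negbTE h0) !orbF => /eqP.
Qed.

(** * Derivations and constants of the field *)

Section MeroDeriv.
Variables (R : realType) (n : nat).
Local Notation C := (Cx R).
Local Notation V := 'rV[C]_n.
Local Notation "''d_' i f" := ('D_(delta_mx 0 i) f)
  (at level 10, i at next level, f at next level).

Section Fixed.
Variable D : convex_domain R n.
Implicit Types (f g h : V -> C) (x y : mero_germ D).

(** Numerators and denominators are chosen once, as data, so that derivations and restrictions are
    functions of classes; [gderiv_quot] and [mero_restrict_quot] show independence of the choice. *)
Lemma mero_repr : {nd : mero_germ D -> (V -> C) * (V -> C) | forall x,
  [/\ analytic_all D (nd x).1, nonzero_germs D (nd x).2 & x = germ_quot D (nd x).1 (nd x).2]}.
Proof.
apply: cid.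
have H x : exists nd : (V -> C) * (V -> C),
    [/\ analytic_all D nd.1, nonzero_germs D nd.2 & x = germ_quot D nd.1 nd.2].
  by have [g [h H]] := germ_quot_surj x; exists (g, h).
by have [nd hnd] := choice H; exists nd.
Qed.

Definition gnum x : V -> C := (sval mero_repr x).1.
Definition gden x : V -> C := (sval mero_repr x).2.

Lemma gnum_analytic x : analytic_all D (gnum x).
Proof. by rewrite /gnum; case: mero_repr => nd /= /(_ x)[]. Qed.

Lemma gden_nonzero x : nonzero_germs D (gden x).
Proof. by rewrite /gden; case: mero_repr => nd /= /(_ x)[]. Qed.

Lemma germ_quotK x : x = germ_quot D (gnum x) (gden x).
Proof. by rewrite /gnum /gden; case: mero_repr => nd /= /(_ x)[]. Qed.

Definition gderiv i x : mero_germ D :=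
  germ_quot D (qnum i (gnum x) (gden x)) (fun z => gden x z * gden x z).

Lemma gderiv_quot i g h : analytic_all D g -> nonzero_germs D h ->
  gderiv i (germ_quot D g h) = germ_quot D (qnum i g h) (fun z => h z * h z).
Proof.
move=> gD h0; apply: germ_quot_deriv_wd.
- exact: gnum_analytic.
- exact: gden_nonzero.
- exact: gD.
- exact: h0.
- exact: (esym (germ_quotK _)).
Qed.

Lemma gen_deriveM i f g : analytic_all D f -> analytic_all D g ->
  generically D (fun z => 'd_i (fun w => f w * g w) z =
    'd_i f z * g z + f z * 'd_i g z).
Proof.
move=> fD gD; apply: gen_near => d Dd.
apply: near_rV_mono2 (near_deriv i fD Dd) (near_deriv i gD Dd) => z dz dz'.
exact: derive_mulE.
Qed.

Lemma gen_deriveD i f g : analytic_all D f -> analytic_all D g ->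
  generically D (fun z => 'd_i (fun w => f w + g w) z =
    'd_i f z + 'd_i g z).
Proof.
move=> fD gD; apply: gen_near => d Dd.
apply: near_rV_mono2 (near_deriv i fD Dd) (near_deriv i gD Dd) => z dz dz'.
exact: derive_addE.
Qed.

Lemma gen_deriveN i f : analytic_all D f ->
  generically D (fun z => 'd_i (fun w => - f w) z = - 'd_i f z).
Proof.
move=> fD; apply: gen_near => d Dd.
apply: near_rV_mono (near_deriv i fD Dd) => z dz.
exact: (deriveN dz).
Qed.

Lemma analytic_all_mul f g : analytic_all D f -> analytic_all D g ->
  analytic_all D (fun z => f z * g z).
Proof. by move=> fD gD d Dd; apply: analytic_mul; [exact: fD|exact: gD]. Qed.

Lemma analytic_all_add f g : analytic_all D f -> analytic_all D g ->
  analytic_all D (fun z => f z + g z).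
Proof. by move=> fD gD d Dd; apply: analytic_add; [exact: fD|exact: gD]. Qed.

Lemma analytic_all_opp f : analytic_all D f -> analytic_all D (fun z => - f z).
Proof. by move=> fD d Dd; apply: analytic_opp; exact: fD. Qed.

Lemma germ_quot_ext g h g' h' : analytic_all D g -> nonzero_germs D h ->
  analytic_all D g' -> nonzero_germs D h' ->
  generically D (fun z => g z / h z = g' z / h' z) -> germ_quot D g h = germ_quot D g' h'.
Proof.
move=> gD h0 gD' h0' E; rewrite /germ_quot; apply/germ_class_eq; last exact: E.
  exact: mero_frac.
exact: mero_frac.
Qed.

Lemma gderivD i x y : gderiv i (x + y) = gderiv i x + gderiv i y.
Proof.
have [g [h [gD h0 ->]]] := germ_quot_surj x; have [g' [h' [gD' h0' ->]]] := germ_quot_surj y.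
have hD := h0.1; have hD' := h0'.1.
have hh := nonzero_germs_mul h0 h0; have hh' := nonzero_germs_mul h0' h0'.
have hm := nonzero_germs_mul h0 h0'.
have gh := analytic_all_mul gD hD'; have gh' := analytic_all_mul gD' hD.
have gs := analytic_all_add gh gh'.
have q := qnum_analytic i gD hD; have q' := qnum_analytic i gD' hD'.
rewrite (germ_quot_add gD h0 gD' h0') (gderiv_quot i gs hm) (gderiv_quot i gD h0).
rewrite (gderiv_quot i gD' h0') (germ_quot_add q hh q' hh').
apply: germ_quot_ext.
- exact: (qnum_analytic i gs hm.1).
- exact: (nonzero_germs_mul hm hm).
- exact: (analytic_all_add (analytic_all_mul q hh'.1) (analytic_all_mul q' hh.1)).
- exact: (nonzero_germs_mul hh hh').
apply: gen_mono2 (gen_and (gen_and (gen_nonzero h0) (gen_nonzero h0'))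
  (gen_deriveM i hD hD')) (gen_and (gen_deriveD i gh gh')
  (gen_and (gen_deriveM i gD hD') (gen_deriveM i gD' hD))).
move=> z [[hz h'z] e1] [e2 [e3 e4]]; rewrite /qnum e1 e2 e3 e4.
by rewrite -quotient_rule_add // addf_div // mulf_neq0.
Qed.

Lemma gderivM i x y : gderiv i (x * y) = gderiv i x * y + x * gderiv i y.
Proof.
have [g [h [gD h0 ->]]] := germ_quot_surj x; have [g' [h' [gD' h0' ->]]] := germ_quot_surj y.
have hD := h0.1; have hD' := h0'.1.
have hh := nonzero_germs_mul h0 h0; have hh' := nonzero_germs_mul h0' h0'.
have hm := nonzero_germs_mul h0 h0'.
have gm := analytic_all_mul gD gD'.
have q := qnum_analytic i gD hD; have q' := qnum_analytic i gD' hD'.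
rewrite (germ_quot_mul gD h0 gD' h0') (gderiv_quot i gm hm) (gderiv_quot i gD h0).
rewrite (gderiv_quot i gD' h0') (germ_quot_mul q hh gD' h0') (germ_quot_mul gD h0 q' hh').
have a1 := analytic_all_mul q gD'; have a2 := analytic_all_mul gD q'.
have n1 := nonzero_germs_mul hh h0'; have n2 := nonzero_germs_mul h0 hh'.
rewrite (germ_quot_add a1 n1 a2 n2).
apply: germ_quot_ext.
- exact: (qnum_analytic i gm hm.1).
- exact: (nonzero_germs_mul hm hm).
- exact: (analytic_all_add (analytic_all_mul a1 n2.1) (analytic_all_mul a2 n1.1)).
- exact: (nonzero_germs_mul n1 n2).
apply: gen_mono2 (gen_and (gen_nonzero h0) (gen_nonzero h0'))
  (gen_and (gen_deriveM i hD hD') (gen_deriveM i gD gD')).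
move=> z [hz h'z] [e1 e2]; rewrite /qnum e1 e2.
rewrite -quotient_rule_mul // -addf_div ?mulf_neq0 //.
by rewrite !mulf_div.
Qed.

Lemma gderivCA i k x : gderiv i (gderiv k x) = gderiv k (gderiv i x).
Proof.
have [g [h [gD h0 ->]]] := germ_quot_surj x; have hD := h0.1.
have hh := nonzero_germs_mul h0 h0; have hhhh := nonzero_germs_mul hh hh.
have q l := qnum_analytic l gD hD.
rewrite !(gderiv_quot _ gD h0) !(gderiv_quot _ (q _) hh).
apply: germ_quot_ext; [exact: (qnum_analytic i (q k) hh.1)|exact: hhhh|
  exact: (qnum_analytic k (q i) hh.1)|exact: hhhh|].
have qd l m : generically D (fun z => 'd_l (qnum m g h) z =
    ('d_l ('d_m g) z * h z + 'd_m g z * 'd_l h z) -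
    ('d_l g z * 'd_m h z + g z * 'd_l ('d_m h) z)).
  have a1 := analytic_all_mul (analytic_all_derive m gD) hD.
  have a2 := analytic_all_mul gD (analytic_all_derive m hD).
  apply: gen_mono2 (gen_and (gen_deriveD l a1 (analytic_all_opp a2)) (gen_deriveN l a2))
    (gen_and (gen_deriveM l (analytic_all_derive m gD) hD)
             (gen_deriveM l gD (analytic_all_derive m hD))).
  by move=> z [e1 e2] [e3 e4]; rewrite [LHS]e1 e2 e3 e4.
have comm f : analytic_all D f ->
    generically D (fun z => 'd_i ('d_k f) z = 'd_k ('d_i f) z).
  move=> fD; apply: gen_near => d /fD /analytic_near.
  by apply: near_rV_mono => z; exact: analytic_deriveC.
apply: gen_mono2 (gen_and (gen_and (qd i k) (qd k i)) (gen_and (comm g gD) (comm h hD)))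
  (gen_and (gen_deriveM i hD hD) (gen_deriveM k hD hD)).
move=> z [[e1 e2] [e3 e4]] [e5 e6].
exact: (quotient_rule_comm _ e1 e2 e3 e4 e5 e6).
Qed.

Definition gconst (c : C) : mero_germ D := germ_class D (fun=> c).

Lemma cst_analytic (c : C) : analytic_all D (fun=> c).
Proof. by move=> d _; exact: analytic_cst. Qed.

Lemma gconst_quot c : gconst c = germ_quot D (fun=> c) (fun=> 1).
Proof. by rewrite /germ_quot; congr (germ_class D _); apply/funext => z; rewrite divr1. Qed.

Lemma germ_quot_zero : 0 = germ_quot D (fun=> 0) (fun=> 1).
Proof. by rewrite /germ_quot -germ_class_0; congr (germ_class D _); apply/funext => z;
  rewrite mul0r. Qed.

Lemma gconst_zmod_morphism : zmod_morphism gconst.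
Proof.
move=> c c'; have e : gconst (c - c' + c') = gconst (c - c') + gconst c'.
  rewrite /gconst -germ_class_add; first by [].
    exact: (analytic_mero (cst_analytic (c - c'))).
  exact: (analytic_mero (cst_analytic c')).
by move: e; rewrite subrK => ->; rewrite addrK.
Qed.

Lemma gconst_monoid_morphism : monoid_morphism gconst.
Proof.
split=> [|c c']; first exact: germ_class_1.
rewrite /gconst -germ_class_mul; first by [].
  exact: (analytic_mero (cst_analytic c)).
exact: (analytic_mero (cst_analytic c')).
Qed.

HB.instance Definition _ := GRing.isZmodMorphism.Build C (mero_germ D) gconst
  gconst_zmod_morphism.
HB.instance Definition _ := GRing.isMonoidMorphism.Build C (mero_germ D) gconst
  gconst_monoid_morphism.

Lemma mero_germ_char0 : [pchar mero_germ D] =i pred0.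
Proof.
move=> l; apply/negP; rewrite inE => /andP[lp /eqP].
rewrite -(rmorph_nat gconst) => /eqP; rewrite fmorph_eq0 pnatr_eq0.
by move=> /eqP l0; rewrite l0 in lp.
Qed.

Definition mero_diff_field : diffFieldType n :=
  DiffField gderivD gderivM gderivCA mero_germ_char0.

(** If all derivatives vanish, the quotient is constant near a point [z0] where its denominator is
    nonzero, and the identity theorem spreads the relation between numerator and denominator. *)
Lemma gconst_constants : @constants_are n mero_diff_field C gconst.
Proof.
move=> x; split=> [|[c ->] i]; last first.
  rewrite /= gconst_quot (gderiv_quot i (cst_analytic c) (nonzero_germs1 D)).
  rewrite germ_quot_zero; apply: germ_quot_ext.
  - exact: (qnum_analytic i (cst_analytic c) (cst_analytic 1)).
  - exact: (nonzero_germs_mul (nonzero_germs1 D) (nonzero_germs1 D)).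
  - exact: (cst_analytic 0).
  - exact: (nonzero_germs1 D).
  apply: gen_all => z; rewrite /qnum.
  by rewrite -[fun=> c]/(cst c) -[fun=> 1]/(cst 1) !derive_cst mul0r mulr0 oppr0 addr0 !mul0r.
have [g [h [gD h0 ->]]] := germ_quot_surj x; have hD := h0.1.
have hh := nonzero_germs_mul h0 h0.
move=> dx.
have q0 i : forall d, cdom D d -> \forall z \near d, qnum i g h z = 0.
  have := dx i; rewrite /= (gderiv_quot i gD h0) germ_quot_zero.
  move=> /(germ_quot_eq (qnum_analytic i gD hD) hh (cst_analytic 0) (nonzero_germs1 D)) H d /H.
  by apply: near_rV_mono => z; rewrite mul0r mulr1.
pose d0 := cdom_pt D; have Dd0 : cdom D d0 := cdom_in D.
have N : \forall z \near d0, (analytic_at g z /\ analytic_at h z) /\ forall i, qnum i g h z = 0.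
  apply: near_rV_mono2 (near_rV_mono2 _ (analytic_near (gD _ Dd0)) (analytic_near (hD _ Dd0)))
    (near_rV_forall (fun i => q0 i _ Dd0)); first by move=> z H1 H2; exact: (conj H1 H2).
  by move=> z H1 H2; exact: (conj H1 H2).
have /near_rV_ball[r r0 hr] := N.
have [z0 rz hz] : exists2 z, ball d0 r z & h z != 0.
  apply: contrapT => H; apply: (h0.2 _ Dd0); apply/near_rV_ball; exists r.
    exact: r0.
  move=> z az; apply/eqP; apply: contrapT => gz; apply: H.
  by exists z; [exact: az|apply/negP].
have [[gz0 hz0] _] := hr _ rz.
pose f z := g z * (h z)^-1.
have fz0 : analytic_at f z0.
  by apply: analytic_mul; [exact: gz0|apply: analytic_inv; [exact: hz0|exact: hz]].
have bz : \forall w \near z0, ball d0 r w.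
  by apply: open_nbhs_nbhs; split; [exact: ball_open|exact: rz].
have hn0 := analytic_near_neq0 hz0 hz.
have fconst : \forall z \near z0, f z = f z0.
  apply: (analytic_locally_const fz0) => i.
  have [_ df] := analytic_derive i fz0; have [_ dh] := analytic_derive i hz0.
  have N1 := near_rV_mono2 (fun (z : V) a b => conj a b) df dh.
  have N2 := near_rV_mono2 (fun (z : V) a b => conj a b) bz hn0.
  have N3 : \forall z \near z0, \forall w \near z, g w = f w * h w.
    apply: near_rV_near; apply: near_rV_mono hn0 => w hw.
    by rewrite /f mulfVK.
  apply: near_rV_mono2 (near_rV_mono2 (fun (z : V) a b => conj a b) N1 N2) N3.
  move=> z [[dfz dhz] [zb hz']] e.
  have dg : 'd_i g z = 'd_i f z * h z + f z * 'd_i h z.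
    by refine (etrans _ (derive_mulE dfz dhz)); exact: (near_eq_derive _ e).
  have ge := near_rV_self e; have [_ /(_ i)] := hr _ zb.
  rewrite /qnum dg ge => E; exact: (quotient_rule_eq0 hz' E).
exists (f z0); rewrite /= gconst_quot; apply/(germ_quot_eq gD h0 (cst_analytic _)
  (nonzero_germs1 D)).
have k0 : \forall z \near z0, g z + - (f z0 * h z) = 0.
  apply: near_rV_mono2 fconst hn0 => z e hz'.
  by rewrite -e /f mulfVK // subrr.
(* [z0] may lie outside [D], for instance when [D] is a point: the relation travels from [z0] to
   [d0] inside a ball, and then from [d0] over [D]. *)
have kd0 : \forall z \near d0, g z + - (f z0 * h z) = 0.
  apply: (analytic_identity (@convex_ball _ _ d0 r) _ rz (ballxx d0 r0) k0).
  move=> z /hr[[ga ha] _]; apply: analytic_add; first exact: ga.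
  by apply: analytic_opp; apply: analytic_mul; [exact: analytic_cst|exact: ha].
have kD : analytic_all D (fun z => g z + - (f z0 * h z)).
  apply: (analytic_all_add gD); apply: analytic_all_opp.
  exact: (analytic_all_mul (cst_analytic _) hD).
move=> d Dd; have := analytic_identity (@cdom_convex _ _ D) kD Dd0 Dd kd0.
by apply: near_rV_mono => z /eqP; rewrite subr_eq0 mulr1 => /eqP.
Qed.

End Fixed.
End MeroDeriv.

(** * Realization of germs, restriction maps and the embedding of [M] *)

Section GermFields.
Variables (R : realType) (n : nat).
Local Notation C := (Cx R).
Local Notation V := 'rV[C]_n.
Local Notation "''d_' i f" := ('D_(delta_mx 0 i) f)
  (at level 10, i at next level, f at next level).

Definition point_domain (q : V) : convex_domain R n :=
  @ConvexDomain R n [set q] q erefl (@convex_set1 R n q).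

Definition ball_domain (q : V) (r : C) (r0 : 0 < r) : convex_domain R n :=
  @ConvexDomain R n (ball q r) q (ballxx q r0) (@convex_ball R n q r).

Section Realization.
Variable q : V.
Local Notation D := (point_domain q).
Local Notation K := (mero_diff_field D).

Let gn (x : K) : analytic_all D (gnum x) := gnum_analytic x.
Let gd (x : K) : nonzero_germs D (gden x) := gden_nonzero x.

(** Kept transparent, so that its numerators and denominators compute to [gnum] and [gden]. *)
Lemma germ_realization : germ_field (K := K) (gconst D) q.
Proof.
apply: (@GermField R n K (gconst D) q (@gnum R n D) (@gden R n D)).
- by move=> x; exact: (gn x erefl).
- by move=> x; exact: ((gd x).1 q erefl).
- by move=> x; exact: ((gd x).2 q erefl).
- move=> c; have := germ_quotK (gconst D c); rewrite {1}gconst_quot => /esym.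
  move=> /(germ_quot_eq (gn _) (gd _) (cst_analytic c) (nonzero_germs1 D))/(_ q erefl).
  by apply: near_rV_mono => z; rewrite mulr1.
- move=> x y.
  have := germ_quotK (x + y : K); rewrite {1}(germ_quotK x) {1}(germ_quotK y).
  rewrite (germ_quot_add (gn x) (gd x) (gn y) (gd y)) => /esym.
  have a := analytic_all_add (analytic_all_mul (gn x) (gd y).1)
    (analytic_all_mul (gn y) (gd x).1).
  move=> /(germ_quot_eq (gn _) (gd _) a (nonzero_germs_mul (gd x) (gd y)))/(_ q erefl).
  by apply: near_rV_mono => z ->; rewrite mulrC.
- move=> x y.
  have := germ_quotK (x * y : K); rewrite {1}(germ_quotK x) {1}(germ_quotK y).
  rewrite (germ_quot_mul (gn x) (gd x) (gn y) (gd y)) => /esym.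
  have a := analytic_all_mul (gn x) (gn y).
  move=> /(germ_quot_eq (gn _) (gd _) a (nonzero_germs_mul (gd x) (gd y)))/(_ q erefl).
  by apply: near_rV_mono => z ->; rewrite mulrC.
- move=> i x.
  have := germ_quotK (@Defs.deriv n K i x); rewrite {1}/Defs.deriv /= /gderiv => /esym.
  have a := qnum_analytic i (gn x) (gd x).1.
  move=> /(germ_quot_eq (gn _) (gd _) a (nonzero_germs_mul (gd x) (gd x)))/(_ q erefl).
  by apply: near_rV_mono => z ->; rewrite mulrC.
Defined.

End Realization.

Section Restriction.
Variables (D D' : convex_domain R n) (sub : cdom D' `<=` cdom D).

Lemma analytic_all_sub f : analytic_all D f -> analytic_all D' f.
Proof. by move=> fD d /sub; exact: fD. Qed.

Lemma nonzero_germs_sub f : nonzero_germs D f -> nonzero_germs D' f.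
Proof. by move=> [fD f0]; split=> d /sub; [exact: fD|exact: f0]. Qed.

Definition mero_restrict (_ : cdom D' `<=` cdom D) (x : mero_diff_field D) :
  mero_diff_field D' := germ_quot D' (gnum x) (gden x).
Local Notation phi := (mero_restrict sub).

Lemma mero_restrict_quot g h : analytic_all D g -> nonzero_germs D h ->
  phi (germ_quot D g h) = germ_quot D' g h.
Proof.
move=> gD h0; have gx := @gnum_analytic _ _ _ (germ_quot D g h).
have hx := @gden_nonzero _ _ _ (germ_quot D g h).
have := germ_quotK (germ_quot D g h) => /(germ_quot_eq gD h0 gx hx) E.
apply/(germ_quot_eq (analytic_all_sub gx) (nonzero_germs_sub hx) (analytic_all_sub gD)
  (nonzero_germs_sub h0)) => d /sub/E.
by apply: near_rV_mono => z ->.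
Qed.

Lemma mero_restrictD x y : phi (x + y) = phi x + phi y.
Proof.
have [g [h [gD h0 ->]]] := germ_quot_surj x; have [g' [h' [gD' h0' ->]]] := germ_quot_surj y.
have a := analytic_all_add (analytic_all_mul gD h0'.1) (analytic_all_mul gD' h0.1).
rewrite (germ_quot_add gD h0 gD' h0') (mero_restrict_quot a (nonzero_germs_mul h0 h0')).
rewrite (mero_restrict_quot gD h0) (mero_restrict_quot gD' h0').
by rewrite (germ_quot_add (analytic_all_sub gD) (nonzero_germs_sub h0)
  (analytic_all_sub gD') (nonzero_germs_sub h0')).
Qed.

Lemma mero_restrict_zmod_morphism : zmod_morphism phi.
Proof.
by move=> x y; have := mero_restrictD (x - y) y; rewrite subrK => ->; rewrite addrK.
Qed.

Lemma mero_restrict_const c : phi (gconst D c) = gconst D' c.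
Proof.
rewrite !gconst_quot.
exact: (mero_restrict_quot (cst_analytic c) (nonzero_germs1 D)).
Qed.

Lemma mero_restrict_monoid_morphism : monoid_morphism phi.
Proof.
split=> [|x y].
  have := mero_restrict_const 1; rewrite !(rmorph1 (@gconst R n _)).
  exact.
have [g [h [gD h0 ->]]] := germ_quot_surj x; have [g' [h' [gD' h0' ->]]] := germ_quot_surj y.
have a := analytic_all_mul gD gD'.
rewrite (germ_quot_mul gD h0 gD' h0') (mero_restrict_quot a (nonzero_germs_mul h0 h0')).
rewrite (mero_restrict_quot gD h0) (mero_restrict_quot gD' h0').
by rewrite (germ_quot_mul (analytic_all_sub gD) (nonzero_germs_sub h0)
  (analytic_all_sub gD') (nonzero_germs_sub h0')).
Qed.

HB.instance Definition _ := GRing.isZmodMorphism.Build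
  (mero_diff_field D) (mero_diff_field D') phi mero_restrict_zmod_morphism.
HB.instance Definition _ := GRing.isMonoidMorphism.Build
  (mero_diff_field D) (mero_diff_field D') phi mero_restrict_monoid_morphism.

Lemma mero_restrict_diff : diff_hom phi.
Proof.
move=> i x; have [g [h [gD h0 ->]]] := germ_quot_surj x.
have hh := nonzero_germs_mul h0 h0; have q := qnum_analytic i gD h0.1.
rewrite /Defs.deriv /= (gderiv_quot i gD h0) (mero_restrict_quot q hh).
rewrite (mero_restrict_quot gD h0).
by rewrite (gderiv_quot i (analytic_all_sub gD) (nonzero_germs_sub h0)).
Qed.

End Restriction.

Section Embedding.
Variables (M : diffFieldType n) (iota : {rmorphism C -> M}) (p : V).
Variable real : germ_field iota p.
Local Notation D := (point_domain p).

Definition germ_embed (x : M) : mero_diff_field D :=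
  germ_quot D (Defs.num real x) (den real x).
Local Notation phi := germ_embed.

Let na x : analytic_all D (Defs.num real x).
Proof. by move=> _ ->; exact: num_analytic. Qed.

Let dn x : nonzero_germs D (den real x).
Proof. by split=> _ ->; [exact: den_analytic|exact: den_neq0]. Qed.

Lemma germ_embedD x y : phi (x + y) = phi x + phi y.
Proof.
rewrite /germ_embed (germ_quot_add (na x) (dn x) (na y) (dn y)).
have a := analytic_all_add (analytic_all_mul (na x) (dn y).1)
  (analytic_all_mul (na y) (dn x).1).
apply/(germ_quot_eq (na _) (dn _) a (nonzero_germs_mul (dn x) (dn y))) => _ ->.
by apply: near_rV_mono (germ_add real x y) => z ->; rewrite mulrC.
Qed.

Lemma germ_embed_zmod_morphism : zmod_morphism phi.
Proof.
by move=> x y; have := germ_embedD (x - y) y; rewrite subrK => ->; rewrite addrK.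
Qed.

Lemma germ_embed_const c : phi (iota c) = gconst D c.
Proof.
rewrite gconst_quot.
apply/(germ_quot_eq (na _) (dn _) (cst_analytic c) (nonzero_germs1 D)) => _ ->.
by apply: near_rV_mono (germ_const real c) => z ->; rewrite mulr1.
Qed.

Lemma germ_embed_monoid_morphism : monoid_morphism phi.
Proof.
split=> [|x y].
  have := germ_embed_const 1; rewrite (rmorph1 iota) (rmorph1 (@gconst R n D)).
  exact.
rewrite /germ_embed (germ_quot_mul (na x) (dn x) (na y) (dn y)).
have a := analytic_all_mul (na x) (na y).
apply/(germ_quot_eq (na _) (dn _) a (nonzero_germs_mul (dn x) (dn y))) => _ ->.
by apply: near_rV_mono (germ_mul real x y) => z ->; rewrite mulrC.
Qed.

HB.instance Definition _ := GRing.isZmodMorphism.Build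
  M (mero_diff_field D) phi germ_embed_zmod_morphism.
HB.instance Definition _ := GRing.isMonoidMorphism.Build
  M (mero_diff_field D) phi germ_embed_monoid_morphism.

Lemma germ_embed_diff : diff_hom phi.
Proof.
move=> i x; rewrite [RHS]/Defs.deriv /= {2}/germ_embed (gderiv_quot i (na x) (dn x)).
rewrite /germ_embed.
have q := qnum_analytic i (na x) (dn x).1.
apply/(germ_quot_eq (na _) (dn _) q (nonzero_germs_mul (dn x) (dn x))) => _ ->.
by apply: near_rV_mono (germ_deriv real i x) => z ->; rewrite mulrC.
Qed.

End Embedding.
End GermFields.

(** * Points of varieties under field embeddings *)

Section Points.
Variable R : realType.
Local Notation C := (Cx R).

Lemma varietyP (W : variety R) : is_variety W.
Proof. by case: W. Qed.

Section Field.
Variables (K : fieldType) (iota : {rmorphism C -> K}) (W : variety R).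
Implicit Types (p q : pt iota W).

Lemma glued_equiv :
  [/\ forall i j (x : 'rV[K]_(@dim R W i)) (y : 'rV[K]_(@dim R W j)) f,
        List.In f (glue i j) -> chart_pt iota x -> frac_at iota f x y ->
        chart_pt iota y,
      forall i (x y : 'rV[K]_(@dim R W i)),
        glued iota x y <-> chart_pt iota x /\ x = y,
      forall i j (x : 'rV[K]_(@dim R W i)) (y : 'rV[K]_(@dim R W j)),
        glued iota x y -> glued iota y x &
      forall i j k (x : 'rV[K]_(@dim R W i)) (y : 'rV[K]_(@dim R W j))
        (z : 'rV[K]_(@dim R W k)),
        glued iota x y -> glued iota y z -> glued iota x z].
Proof. by have [/(_ K iota)] := varietyP W. Qed.

Lemma glued_refl i (x : 'rV[K]_(@dim R W i)) : chart_pt iota x -> glued iota x x.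
Proof. by case: glued_equiv => _ + _ _ => /(_ i x x) h xc; apply/h. Qed.

Lemma glued_eq i (x y : 'rV[K]_(@dim R W i)) : glued iota x y -> x = y.
Proof. by case: glued_equiv => _ + _ _ => /(_ i x y) h /h[]. Qed.

Lemma glued_sym i j (x : 'rV[K]_(@dim R W i)) (y : 'rV[K]_(@dim R W j)) :
  glued iota x y -> glued iota y x.
Proof. by case: glued_equiv => _ _ + _; apply. Qed.

Lemma glued_trans i j k (x : 'rV[K]_(@dim R W i)) (y : 'rV[K]_(@dim R W j))
    (z : 'rV[K]_(@dim R W k)) :
  glued iota x y -> glued iota y z -> glued iota x z.
Proof. by case: glued_equiv => _ _ _; apply. Qed.

Lemma ptP p : exists i (x : 'rV[K]_(dim i)), chart_pt iota x /\
  forall j (y : 'rV[K]_(dim j)), coord p y <-> glued iota x y.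
Proof.
by case: p => P h /=; have [i [x [xc e]]] := h; exists i, x; rewrite e.
Qed.

Lemma coord_ex p : exists i (x : 'rV[K]_(dim i)), coord p x.
Proof.
have [i [x [xc e]]] := ptP p; exists i, x; apply/e; exact: glued_refl.
Qed.

Lemma coord_glued p i (x : 'rV[K]_(dim i)) : coord p x ->
  forall j (y : 'rV[K]_(dim j)), coord p y <-> glued iota x y.
Proof.
have [i0 [x0 [xc e]]] := ptP p; rewrite e => x0x j y; rewrite e; split=> h.
  exact: glued_trans (glued_sym x0x) h.
exact: glued_trans x0x h.
Qed.

Lemma coord_chart p i (x : 'rV[K]_(dim i)) : coord p x -> chart_pt iota x.
Proof. by move=> px; case: ((coord_glued px x).1 px). Qed.

Lemma coord_fun p i (x y : 'rV[K]_(dim i)) : coord p x -> coord p y -> x = y.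
Proof. by move=> px /(coord_glued px); exact: glued_eq. Qed.

(** Both coordinate predicates are the gluing class of [x]; the existence proofs are identified by
    proof irrelevance. *)
Lemma pt_eq p q i (x : 'rV[K]_(dim i)) : coord p x -> coord q x -> p = q.
Proof.
move=> px qx.
have E : @coord _ _ _ _ p = @coord _ _ _ _ q.
  apply: functional_extensionality_dep => j; apply/funext => y; apply/propext.
  by rewrite (coord_glued px) (coord_glued qx).
case: p q E {px qx} => P hP [Q hQ] /= E.
by subst Q; congr Pt; exact: Prop_irrelevance.
Qed.

Lemma pt_ex i (x : 'rV[K]_(dim i)) : chart_pt iota x -> exists p, coord p x.
Proof.
move=> xc.
have h : exists i0 (x0 : 'rV[K]_(@dim R W i0)), chart_pt iota x0 /\
    (fun j y => @glued R K iota W i x j y) = fun j y => @glued R K iota W i0 x0 j y.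
  by exists i, x.
by exists (@Pt R K iota W _ h); exact: glued_refl.
Qed.

End Field.

Section PtOver.
Variables (A B : comNzRingType) (iA : C -> A) (iB : C -> B) (phi : {rmorphism A -> B}).
Hypothesis phiE : forall c, phi (iA c) = iB c.

(** Working over rings covers both field embeddings and the Taylor map into truncated
    polynomials. *)
Lemma peval_map N (x : 'rV[A]_N) P :
  peval iB (map_mx phi x) P = phi (peval iA x P).
Proof.
rewrite /peval /mmap rmorph_sum; apply: eq_bigr => a _.
rewrite rmorphM phiE /mmap1 rmorph_prod; congr (_ * _).
by apply: eq_bigr => i _; rewrite mxE rmorphXn.
Qed.

Lemma chart_pt_map (W : atlas R) i (x : 'rV[A]_(@dim R W i)) :
  chart_pt iA x -> chart_pt iB (map_mx phi x).
Proof. by move=> h P /h e; rewrite peval_map e rmorph0. Qed.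

Lemma frac_at_map N d (f : frac R N d) (x : 'rV[A]_N) (y : 'rV[A]_d) :
  frac_at iA f x y -> frac_at iB f (map_mx phi x) (map_mx phi y).
Proof.
move=> [[u hu] hy]; split.
  by exists (phi u); rewrite peval_map -rmorphM hu rmorph1.
by move=> c; rewrite !peval_map mxE -rmorphM hy.
Qed.

Lemma glued_map (W : atlas R) i j (x : 'rV[A]_(@dim R W i)) (y : 'rV[A]_(@dim R W j)) :
  glued iA x y -> glued iB (map_mx phi x) (map_mx phi y).
Proof.
move=> [xc yc [f fi fxy]]; split; [exact: chart_pt_map|exact: chart_pt_map|].
by exists f => //; exact: frac_at_map.
Qed.

Lemma zeros_map N (E : seq (mpoly N C)) (x : 'rV[A]_N) :
  zeros iA E x -> zeros iB E (map_mx phi x).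
Proof. by move=> h P /h e; rewrite peval_map e rmorph0. Qed.

Hypothesis phi_inj : injective phi.

Lemma zeros_map_inj N (E : seq (mpoly N C)) (x : 'rV[A]_N) :
  zeros iB E (map_mx phi x) -> zeros iA E x.
Proof.
by move=> h P /h; rewrite peval_map -[RHS](rmorph0 phi); exact: phi_inj.
Qed.

Lemma chart_pt_map_inj (W : atlas R) i (x : 'rV[A]_(@dim R W i)) :
  chart_pt iB (map_mx phi x) -> chart_pt iA x.
Proof.
by move=> h P /h; rewrite peval_map -[RHS](rmorph0 phi); exact: phi_inj.
Qed.

End PtOver.

Lemma frac_at_uniq (K : fieldType) (iota : C -> K) N d (f : frac R N d)
    (x : 'rV[K]_N) (y y' : 'rV[K]_d) :
  frac_at iota f x y -> frac_at iota f x y' -> y = y'.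
Proof.
move=> [[u hu] hy] [_ hy']; apply/rowP => c.
have d0 : peval iota x (fden f) != 0.
  by apply/eqP => e; move: hu; rewrite e mul0r => /esym/eqP; rewrite oner_eq0.
by apply: (mulIf d0); rewrite hy hy'.
Qed.

Section FieldMap.
Variables (K L : fieldType) (iK : {rmorphism C -> K}) (iL : {rmorphism C -> L}).
Variables (phi : {rmorphism K -> L}).
Hypothesis phiE : forall c, phi (iK c) = iL c.

(** Base change of points along [phi], kept as a relation because a point is a class of coordinates
    in several charts. *)
Definition pt_over W (p : pt iK W) (p' : pt iL W) :=
  exists i (x : 'rV[K]_(dim i)), coord p x /\ coord p' (map_mx phi x).

Lemma pt_over_coord W (p : pt iK W) (p' : pt iL W) i (x : 'rV[K]_(dim i)) :
  pt_over p p' -> coord p x -> coord p' (map_mx phi x).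
Proof.
move=> [j [y [py p'y]]] px; apply/(coord_glued p'y); apply: (glued_map phiE).
by apply/(coord_glued py).
Qed.

Lemma pt_over_ex W (p : pt iK W) : exists p' : pt iL W, pt_over p p'.
Proof.
have [i [x px]] := coord_ex p.
have [p' p'x] := pt_ex (chart_pt_map phiE (coord_chart px)).
by exists p', i, x.
Qed.

(* Separatedness: the graph of the gluing of two charts is closed, so equality
   of points is tested by equations, which an injective morphism reflects. *)
Lemma pt_over_inj W (p q : pt iK W) (p' : pt iL W) :
  pt_over p p' -> pt_over q p' -> p = q.
Proof.
move=> [i [x [px p'x]]] [j [y [qy p'y]]].
suff g : glued iK x y by apply: (pt_eq _ qy); apply/(coord_glued px).
have [_ /(_ i j)[E hE]] := varietyP W.
apply/(hE K iK x y (coord_chart px) (coord_chart qy)).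
apply: (zeros_map_inj phiE (@fmorph_inj _ _ phi)).
rewrite map_row_mx; apply/hE; [exact: coord_chart p'x|exact: coord_chart p'y|].
by apply/(coord_glued p'x).
Qed.

Lemma local_value_map N W (fs : seq (local_map N W)) (x : 'rV[K]_N)
    (q : pt iK W) (q' : pt iL W) : pt_over q q' ->
  local_value fs x q -> local_value fs (map_mx phi x) q'.
Proof.
move=> qq' [j [f [y [fi fxy qy]]]]; exists j, f, (map_mx phi y); split=> //.
  exact: (frac_at_map phiE).
exact: (pt_over_coord qq').
Qed.

Lemma in_piece_map N Z (s : piece N Z) (x : 'rV[K]_N) :
  in_piece iK s x -> in_piece iL s (map_mx phi x).
Proof.
move=> [h [P Pi P0]]; split; first exact: (zeros_map phiE).
exists P => //; rewrite (peval_map phiE) => /eqP; rewrite fmorph_eq0 => /eqP.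
exact: P0.
Qed.

(** Transition maps have coefficients in [C], so they can be evaluated already over [K]: a point
    with coordinates in [K] in one chart has them in every chart in which it lies. *)
Lemma rational_coord W (c : pt iL W) :
  rational_pt phi c -> forall i (x : 'rV[L]_(dim i)), coord c x ->
  exists2 y : 'rV[K]_(dim i), x = map_mx phi y & chart_pt iK y.
Proof.
move=> [j [y cy]] i x cx.
have yc := chart_pt_map_inj phiE (@fmorph_inj _ _ phi) (coord_chart cy).
have [_ _ [f fi fyx]] := (coord_glued cy x).1 cx.
have [[u hu] hx] := fyx.
have d0 : peval iK y (fden f) != 0.
  apply/eqP => e; move: hu; rewrite (peval_map phiE) e rmorph0 mul0r => /esym/eqP.
  by rewrite oner_eq0.
pose x' := \row_k (peval iK y (fnum f k) / peval iK y (fden f)).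
have fx' : frac_at iK f y x'.
  split; first by exists (peval iK y (fden f))^-1; rewrite mulfV.
  by move=> k; rewrite mxE divfK.
exists x'; first exact: (frac_at_uniq fyx (frac_at_map phiE fx')).
by case: (glued_equiv iK W) => h _ _ _; exact: (h _ _ _ _ _ fi yc fx').
Qed.

End FieldMap.
End Points.

(** * Taylor jets and differential constructible functions *)

Section Taylor.
Variables (n : nat) (K : diffFieldType n).
Implicit Types (a b : multinom n) (x y : K).

Lemma natK_eq0 k : (k%:R == 0 :> K) = (k == 0)%N.
Proof. by have /pcharf0P := @diff_char0 n K; apply. Qed.

Lemma deriv0 i : deriv i (0 : K) = 0.
Proof. by apply: (@addrI _ (deriv i 0)); rewrite -derivD !addr0. Qed.

Lemma deriv1 i : deriv i (1 : K) = 0.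
Proof.
have := derivM i (1 : K) 1; rewrite !mulr1 mul1r => e.
by apply: (@addrI _ (deriv i (1 : K))); rewrite -e addr0.
Qed.

Lemma iter_deriv_comm i k x m : deriv i (iter m (deriv k) x) = iter m (deriv k) (deriv i x).
Proof. by elim: m => //= m <-; rewrite derivCA. Qed.

Lemma foldr_deriv_comm (s : seq 'I_n) a i x :
  foldr (fun k => iter (a k) (deriv k)) (deriv i x) s =
  deriv i (foldr (fun k => iter (a k) (deriv k)) x s).
Proof. by elim: s => //= k s ->; rewrite iter_deriv_comm. Qed.

Lemma derivs0 x : derivs mnm0 x = x.
Proof. by rewrite /derivs; elim: (enum _) => //= i s ->; rewrite mnm0E. Qed.

(** [derivs] applies the derivations in a fixed order; commutation moves the additional one next to
    [x]. *)
Lemma derivsS a i x : derivs (mnm_add a (mnm1 i)) x = derivs a (deriv i x).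
Proof.
rewrite /derivs foldr_deriv_comm.
have : i \in enum 'I_n by rewrite mem_enum.
have := enum_uniq 'I_n; elim: (enum _) => //= k s IH /andP[ks us].
rewrite inE; have [E _|ik /= si] := eqVneq i k.
  subst k; rewrite mnmDE mnm1E eqxx addn1 /=; congr (deriv _ (iter _ _ _)).
  elim: s ks {IH us} => //= l s IH; rewrite inE negb_or => /andP[il ls].
  by rewrite IH // mnmDE mnm1E (negbTE il) addn0.
rewrite mnmDE mnm1E (negbTE ik) addn0 IH //.
by rewrite iter_deriv_comm.
Qed.

Lemma derivsD a x y : derivs a (x + y) = derivs a x + derivs a y.
Proof.
rewrite /derivs; elim: (enum _) => //= k s ->.
by elim: (a k) => //= m ->; rewrite derivD.
Qed.

Lemma mnm_ind (P : multinom n -> Prop) : P mnm0 ->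
  (forall a i, P a -> P (mnm_add a (mnm1 i))) -> forall a, P a.
Proof.
move=> P0 PS a; move E: (mdeg a) => m; elim: m a E => [|m IH] a am.
  by have -> : a = mnm0 by apply/eqP; rewrite -mdeg_eq0 am.
have [i ai] : exists i, a i != 0%N by apply: mnm_neq0P; rewrite -mdeg_eq0 am.
have e := mnm_sub1K ai.
rewrite -e; apply: PS; apply: IH.
by have := am; rewrite -{1}e mdegD mdeg1 addn1 => -[].
Qed.

Lemma derivs_const a x : (forall i, deriv i x = 0) ->
  derivs a x = if a == mnm0 then x else 0.
Proof.
move=> dx; have [->|] := eqVneq a mnm0; first exact: derivs0.
elim/mnm_ind: a => [|a i IH _]; first by rewrite eqxx.
rewrite derivsS dx; elim/mnm_ind: (a) => [|b k]; first exact: derivs0.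
by rewrite derivsS deriv0.
Qed.

Definition tcoef a x : K := derivs a x / (\prod_(i < n) (a i)`!)%:R.

Lemma tcoefD a x y : tcoef a (x + y) = tcoef a x + tcoef a y.
Proof. by rewrite /tcoef derivsD mulrDl. Qed.

Lemma tcoef0 x : tcoef mnm0 x = x.
Proof.
by rewrite /tcoef derivs0 big1 ?divr1 // => i _; rewrite mnm0E.
Qed.

(** In terms of Taylor polynomials: the formal derivative in the [i]-th variable corresponds to the
    [i]-th derivation of the field. *)
Lemma tcoefS a i x : tcoef (mnm_add a (mnm1 i)) x *+ (a i).+1 = tcoef a (deriv i x).
Proof.
rewrite /tcoef derivsS -[LHS]mulr_natr -mulrA; congr (_ * _).
have -> : (\prod_(k < n) (mnm_add a (mnm1 i) k)`! =
    (\prod_(k < n) (a k)`!) * (a i).+1)%N.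
  rewrite (bigD1 i) //= [in RHS](bigD1 i) //= mnmDE mnm1E eqxx addn1 factS.
  rewrite -mulnA mulnC; congr (_ * _)%N; congr (_ * _)%N.
  by apply: eq_bigr => k ki; rewrite mnmDE mnm1E eq_sym (negbTE ki) addn0.
by rewrite natrM invfM -mulrA mulVf ?mulr1 // natK_eq0.
Qed.

Variable m : nat.

Definition taylor_poly k x : mpoly n K :=
  \sum_(a : bmultinom n k.+1) tcoef a x *: mpolyX K a.

Lemma mcoeff_taylor_poly k x a : (mdeg a <= k)%N -> mcoeff a (taylor_poly k x) = tcoef a x.
Proof. by move=> ak; rewrite (mcoeff_mpoly (fun a => tcoef a x)). Qed.

Lemma mcoeff_taylor_poly_gt k x a : (k < mdeg a)%N -> mcoeff a (taylor_poly k x) = 0.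
Proof.
move=> ka; rewrite raddf_sum /= big1 // => b _.
rewrite mcoeffZ mcoeffX; case: eqP => [ba|_]; last by rewrite mulr0.
by have := bmdeg b; rewrite ba ltnS leqNgt ka.
Qed.

Lemma mderiv_taylor_poly k i x : mderiv i (taylor_poly k.+1 x) = taylor_poly k (deriv i x).
Proof.
apply/mpolyP => a; rewrite mcoeff_mderiv.
have [ak|ka] := leqP (mdeg a) k; last first.
  by rewrite !mcoeff_taylor_poly_gt ?mul0rn // mdegD mdeg1 addn1.
by rewrite !mcoeff_taylor_poly ?tcoefS // mdegD mdeg1 addn1.
Qed.

Lemma eps_mcoeffM k (p q p' q' : mpoly n K) :
  (forall a, (mdeg a <= k)%N -> mcoeff a p = mcoeff a p') ->
  (forall a, (mdeg a <= k)%N -> mcoeff a q = mcoeff a q') ->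
  forall a, (mdeg a <= k)%N -> mcoeff a (p * q) = mcoeff a (p' * q').
Proof.
move=> pp qq a ak; rewrite !mcoeffM; apply: eq_bigr => -[u v] _ /=.
by rewrite pp ?qq //; apply: leq_trans ak; rewrite -ltnS bmdeg.
Qed.

(** The higher Leibniz rule without binomial sums. A nonconstant coefficient is recovered, in
    characteristic zero, from a formal partial derivative of the product, and the induction
    hypothesis applies to the two terms of that derivative. *)
Lemma taylor_polyM k x y a : (mdeg a <= k)%N ->
  mcoeff a (taylor_poly k x * taylor_poly k y) = tcoef a (x * y).
Proof.
elim: k x y a => [|k IH] x y a ak.
  have -> : a = mnm0 by apply/eqP; rewrite -mdeg_eq0 -leqn0.
  by rewrite (rmorphM (mcoeff mnm0)) /= !mcoeff_taylor_poly ?mdeg0 // !tcoef0.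
have [->|a0] := eqVneq a mnm0.
  by rewrite (rmorphM (mcoeff mnm0)) /= !mcoeff_taylor_poly ?mdeg0 // !tcoef0.
have [i ai] := mnm_neq0P a0; have e := mnm_sub1K ai.
set b := mnm_sub a _ in e.
have bk : (mdeg b <= k)%N by move: ak; rewrite -e mdegD mdeg1 addn1.
have b0 : ((b i).+1%:R : K) != 0 by rewrite natK_eq0.
apply: (mulIf b0); rewrite !mulr_natr -e tcoefS.
have tr z c : (mdeg c <= k)%N -> mcoeff c (taylor_poly k.+1 z) = mcoeff c (taylor_poly k z).
  by move=> ck; rewrite !mcoeff_taylor_poly // leqW.
rewrite -mcoeff_mderiv mderivM !mderiv_taylor_poly mcoeffD.
rewrite (eps_mcoeffM (fun c _ => erefl) (tr y) bk).
rewrite (eps_mcoeffM (tr x) (fun c _ => erefl) bk).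
by rewrite !IH // -tcoefD derivM.
Qed.

Lemma to_trunc_eq (p q : mpoly n K) :
  (forall a, (mdeg a <= m)%N -> mcoeff a p = mcoeff a q) ->
  to_trunc n m K p = to_trunc n m K q.
Proof.
move=> h; apply/eqmodP => /=; rewrite Quotient.equivE; apply/eps_idealP => a am.
by rewrite mcoeffB h // subrr.
Qed.

(** [trunc_coef] reads a chosen representative; up to degree [m] the choice has no effect, since
    elements of [eps_ideal] have no terms there. *)
Lemma trunc_coefE (p : mpoly n K) a : (mdeg a <= m)%N ->
  trunc_coef a (to_trunc n m K p) = mcoeff a p.
Proof.
move=> am; rewrite /trunc_coef.
have e : (\pi_({ideal_quot (@eps_ideal n m K)}) (repr (to_trunc n m K p : {ideal_quot
  (@eps_ideal n m K)})) =
    \pi_({ideal_quot (@eps_ideal n m K)}) p)%qT := reprK _.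
have /eqmodP /= := e.
rewrite Quotient.equivE => /eps_idealP /(_ a am) /eqP.
by rewrite mcoeffB subr_eq0 => /eqP.
Qed.

Lemma taylor_taylor_poly x : taylor m x = to_trunc n m K (taylor_poly m x).
Proof. by []. Qed.

Lemma trunc_coef_taylor a x : (mdeg a <= m)%N ->
  trunc_coef a (taylor m x) = tcoef a x.
Proof. by move=> am; rewrite taylor_taylor_poly trunc_coefE // mcoeff_taylor_poly. Qed.

Lemma taylor_zmod_morphism : zmod_morphism (@taylor n m K).
Proof.
move=> x y; have D (u v : K) : taylor m (u + v) = taylor m u + taylor m v.
  rewrite !taylor_taylor_poly -rmorphD; apply: to_trunc_eq => a am.
  by rewrite mcoeffD !mcoeff_taylor_poly // tcoefD.
by have := D (x - y) y; rewrite subrK => ->; rewrite addrK.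
Qed.

Lemma taylor_const x : (forall i, deriv i x = 0) ->
  taylor m x = to_trunc n m K (mpolyC n x).
Proof.
move=> dx; rewrite taylor_taylor_poly; apply: to_trunc_eq => a am.
rewrite mcoeff_taylor_poly // mcoeffC; have [->|a0] := eqVneq a mnm0.
  by rewrite tcoef0 mulr1.
by rewrite /tcoef derivs_const // (negbTE a0) mul0r mulr0.
Qed.

Lemma taylor_monoid_morphism : monoid_morphism (@taylor n m K).
Proof.
split=> [|x y].
  by rewrite taylor_const ?mpolyC1 ?rmorph1 // => i; exact: deriv1.
rewrite !taylor_taylor_poly -rmorphM; apply: to_trunc_eq => a am.
by rewrite mcoeff_taylor_poly // taylor_polyM.
Qed.

HB.instance Definition _ := GRing.isZmodMorphism.Build K (trunc n m K)
  (@taylor n m K) taylor_zmod_morphism.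
HB.instance Definition _ := GRing.isMonoidMorphism.Build K (trunc n m K)
  (@taylor n m K) taylor_monoid_morphism.


End Taylor.

Section TaylorHom.
Variables (n : nat) (K L : diffFieldType n) (phi : {rmorphism K -> L}).
Hypothesis phi_diff : diff_hom phi.

Lemma derivs_hom a x : phi (derivs a x) = derivs a (phi x).
Proof.
rewrite /derivs; elim: (enum _) => //= i s <-.
by elim: (a i) => //= m <-; rewrite phi_diff.
Qed.

Lemma tcoef_hom a x : phi (tcoef a x) = tcoef a (phi x).
Proof. by rewrite /tcoef fmorph_div derivs_hom rmorph_nat. Qed.

Lemma jet_taylor_hom m d (x : 'rV[K]_d) :
  map_mx phi (jet_coord (map_mx (@taylor n m K) x)) =
  jet_coord (map_mx (@taylor n m L) (map_mx phi x)).
Proof.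
apply/rowP => k; rewrite !mxE.
have am : (mdeg ((jet_index k).2 : multinom n) <= m)%N.
  by rewrite -ltnS bmdeg.
by rewrite (trunc_coef_taylor (phi _) am) (trunc_coef_taylor (x 0 _) am) tcoef_hom.
Qed.

End TaylorHom.

(** * Values of differential constructible functions *)

Section Values.
Variables (R : realType) (n : nat).
Local Notation C := (Cx R).

Lemma dconstrP W Z (f : @dconstr R n W Z) : is_constructible (cdata f).
Proof. by case: f. Qed.

Section Single.
Variables (K : diffFieldType n) (iota : {rmorphism C -> K}).
Hypothesis iota_const : forall i c, deriv i (iota c) = 0.

Lemma taylor_emb m c : taylor m (iota c) = trunc_emb n m iota c.
Proof. by rewrite taylor_const. Qed.

Lemma dvalue_ex W Z (f : @dconstr R n W Z) (p : pt iota W) :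
  exists q : pt iota Z, dvalue f p q.
Proof.
have [i [x px]] := coord_ex p.
have [_ _ ex _] := @dconstrP _ _ f K iota.
have xc := chart_pt_map (taylor_emb (cord f)) (coord_chart px).
by have [q hq] := ex i _ xc; exists q, i, x.
Qed.

(** The Taylor map is a ring morphism fixing constants, so it carries two glued coordinate vectors
    of [p] to glued jets, on which a constructible function takes one value. *)
Lemma dvalue_uniq W Z (f : @dconstr R n W Z) (p : pt iota W) (q q' : pt iota Z) :
  dvalue f p q -> dvalue f p q' -> q = q'.
Proof.
move=> [i [x [px xq]]] [j [y [py yq]]].
have [_ _ _ un] := @dconstrP _ _ f K iota.
apply: (un i j _ _ q q' _ xq yq); apply: (glued_map (taylor_emb (cord f))).
exact/(coord_glued px).
Qed.

Lemma same_dvalue_sym W1 W2 Z (f : @dconstr R n W1 Z) (g : @dconstr R n W2 Z)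
    (p : pt iota W1) (p' : pt iota W2) :
  same_dvalue f g p p' -> same_dvalue g f p' p.
Proof. by move=> [q h h']; exists q. Qed.

Lemma same_dvalue_trans W1 W2 W3 Z (f : @dconstr R n W1 Z)
    (g : @dconstr R n W2 Z) (h : @dconstr R n W3 Z)
    (p : pt iota W1) (p' : pt iota W2) (p'' : pt iota W3) :
  same_dvalue f g p p' -> same_dvalue g h p' p'' -> same_dvalue f h p p''.
Proof.
move=> [q hf hg] [q' hg' hh]; exists q; first exact: hf.
by rewrite (dvalue_uniq hg hg').
Qed.

End Single.

Section Map.
Variables (K L : diffFieldType n).
Variables (iK : {rmorphism C -> K}) (iL : {rmorphism C -> L}).
Variables (phi : {rmorphism K -> L}).
Hypothesis phiE : forall c, phi (iK c) = iL c.
Hypothesis phi_diff : diff_hom phi.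
Hypothesis iK_const : forall i c, deriv i (iK c) = 0.

Lemma hom_const i c : deriv i (iL c) = 0.
Proof. by rewrite -phiE -phi_diff iK_const rmorph0. Qed.

Lemma dvalue_map W Z (f : @dconstr R n W Z) (p : pt iK W) (p' : pt iL W)
    (q : pt iK Z) (q' : pt iL Z) :
  pt_over phi p p' -> pt_over phi q q' -> dvalue f p q -> dvalue f p' q'.
Proof.
move=> pp qq [i [x [px [s si [sx fq]]]]].
exists i, (map_mx phi x); split; first exact: (pt_over_coord phiE pp px).
exists s => //; rewrite -(jet_taylor_hom phi_diff); split.
  exact: (in_piece_map phiE).
exact: (local_value_map phiE qq).
Qed.

(** For the converse, both values already exist over [K]; their images coincide by uniqueness over
    [L], and [pt_over_inj] brings the equality back. *)
Lemma same_dvalue_map W1 W2 Z (f : @dconstr R n W1 Z) (g : @dconstr R n W2 Z)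
    (p1 : pt iK W1) (p1' : pt iL W1) (p2 : pt iK W2) (p2' : pt iL W2) :
  pt_over phi p1 p1' -> pt_over phi p2 p2' ->
  same_dvalue f g p1 p2 <-> same_dvalue f g p1' p2'.
Proof.
move=> h1 h2; split=> [[q fq gq]|[q' fq' gq']].
  have [q' qq] := pt_over_ex phiE q.
  by exists q'; [exact: dvalue_map h1 qq fq|exact: dvalue_map h2 qq gq].
have [q1 fq1] := dvalue_ex iK_const f p1; have [q2 gq2] := dvalue_ex iK_const g p2.
have [q1' e1] := pt_over_ex phiE q1; have [q2' e2] := pt_over_ex phiE q2.
have E1 := dvalue_uniq hom_const (dvalue_map h1 e1 fq1) fq'.
have E2 := dvalue_uniq hom_const (dvalue_map h2 e2 gq2) gq'.
rewrite E1 in e1; rewrite E2 in e2.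
exists q1; first exact: fq1.
by rewrite (pt_over_inj phiE e1 e2).
Qed.

End Map.
End Values.

(** * Analytic maps into varieties *)

Section AnalyticMaps.
Variables (R : realType) (n : nat).
Local Notation C := (Cx R).
Local Notation V := 'rV[C]_n.

Lemma analytic_sum (I : Type) (l : seq I) (f : I -> V -> C) a :
  (forall i, analytic_at (f i) a) ->
  analytic_at (fun z => \sum_(i <- l) f i z) a.
Proof.
move=> h; elim: l => [|i l IH].
  rewrite (_ : (fun z => _) = fun=> 0); first exact: analytic_cst.
  by apply/funext => z; rewrite big_nil.
rewrite (_ : (fun z => _) = fun z => f i z + \sum_(i <- l) f i z).
  by apply: analytic_add; [exact: h|exact: IH].
by apply/funext => z; rewrite big_cons.
Qed.

Lemma analytic_prod (I : Type) (l : seq I) (f : I -> V -> C) a :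
  (forall i, analytic_at (f i) a) ->
  analytic_at (fun z => \prod_(i <- l) f i z) a.
Proof.
move=> h; elim: l => [|i l IH].
  rewrite (_ : (fun z => _) = fun=> 1); first exact: analytic_cst.
  by apply/funext => z; rewrite big_nil.
rewrite (_ : (fun z => _) = fun z => f i z * \prod_(i <- l) f i z).
  by apply: analytic_mul; [exact: h|exact: IH].
by apply/funext => z; rewrite big_cons.
Qed.

Lemma analytic_exp (f : V -> C) k a : analytic_at f a ->
  analytic_at (fun z => f z ^+ k) a.
Proof.
move=> fa; elim: k => [|k IH]; first exact: (analytic_cst 1 a).
rewrite (_ : (fun z => _) = fun z => f z * f z ^+ k).
  exact: analytic_mul fa IH.
by apply/funext => z; rewrite exprS.
Qed.

Lemma peval_sum (k A : nzRingType) (iota : k -> A) N (x : 'rV[A]_N) (P : mpoly N k) :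
  peval iota x P = \sum_(m <- msupp P) iota (mcoeff m P) * \prod_(i < N) x 0 i ^+ m i.
Proof. by []. Qed.

Lemma analytic_peval d (F : V -> 'rV[C]_d) a (P : mpoly d C) :
  analytic_vect_at F a -> analytic_at (fun z => peval idfun (F z) P) a.
Proof.
move=> Fa.
apply: (@analytic_sum _ (msupp P) (fun m z => idfun (mcoeff m P) * \prod_(i
  < d) F z 0 i ^+ m i)) => m.
apply: analytic_mul; first exact: analytic_cst.
apply: (@analytic_prod _ _ (fun i z => F z 0 i ^+ m i)) => i.
exact: analytic_exp.
Qed.

Definition frac_val N d (f : frac R N d) (x : 'rV[C]_N) : 'rV[C]_d :=
  \row_k (peval idfun x (fnum f k) / peval idfun x (fden f)).

Lemma frac_at_val N d (f : frac R N d) (x : 'rV[C]_N) :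
  peval idfun x (fden f) != 0 -> frac_at idfun f x (frac_val f x).
Proof.
move=> d0; split; first by exists (peval idfun x (fden f))^-1; rewrite mulfV.
by move=> k; rewrite mxE divfK.
Qed.

Lemma frac_def_neq0 (K : fieldType) (iota : C -> K) N d (f : frac R N d) (x : 'rV[K]_N) :
  frac_def iota f x -> peval iota x (fden f) != 0.
Proof.
move=> [u hu]; apply/eqP => e; move: hu; rewrite e mul0r => /esym/eqP.
by rewrite oner_eq0.
Qed.

Lemma frac_analytic N d (f : frac R N d) (F : V -> 'rV[C]_N) a :
  analytic_vect_at F a -> frac_def idfun f (F a) ->
  analytic_vect_at (fun z => frac_val f (F z)) a /\
  \forall z \near a, frac_at idfun f (F z) (frac_val f (F z)).
Proof.
move=> Fa /frac_def_neq0 d0; have da := analytic_peval (fden f) Fa; split.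
  move=> k; rewrite (_ : (fun z => _) =
    fun z => peval idfun (F z) (fnum f k) * (peval idfun (F z) (fden f))^-1).
    by apply: analytic_mul; [exact: analytic_peval|exact: analytic_inv].
  by apply/funext => z; rewrite mxE.
by apply: near_rV_mono (analytic_near_neq0 da d0) => z; exact: frac_at_val.
Qed.

(** A transition map defined at the given point is rational with denominator nonzero there, hence
    analytic nearby. *)
Lemma chart_switch (W : variety R) (f : V -> Cpt W) a
    i (F : V -> 'rV[C]_(@dim R W i)) j (y : 'rV[C]_(@dim R W j)) :
  analytic_vect_at F a -> (\forall z \near a, coord (f z) (F z)) ->
  coord (f a) y ->
  exists H : V -> 'rV[C]_(@dim R W j),
    [/\ analytic_vect_at H a, \forall z \near a, coord (f z) (H z) & H a = y].
Proof.
move=> Fa Fc fy; have Fca := near_rV_self Fc.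
have [_ _ [g gi gy]] := (coord_glued Fca y).1 fy.
have [Ha Hg] := frac_analytic Fa gy.1.
exists (fun z => frac_val g (F z)); split; first exact: Ha.
  apply: near_rV_mono2 Fc Hg => z fz gz; apply/(coord_glued fz).
  have cz := coord_chart fz.
  have [h _ _ _] := glued_equiv (idfun : {rmorphism C -> C}) W.
  by split; [exact: cz|exact: h gi cz gz|exists g].
exact: frac_at_uniq (near_rV_self Hg) gy.
Qed.

Lemma analytic_map_chart (W : variety R) (U : set V) (f : V -> Cpt W) a
    j (y : 'rV[C]_(@dim R W j)) :
  analytic_map U f -> U a -> coord (f a) y ->
  exists H : V -> 'rV[C]_(@dim R W j),
    [/\ analytic_vect_at H a, \forall z \near a, coord (f z) (H z) & H a = y].
Proof. by move=> fU /fU[i [F [Fa Fc]]]; exact: chart_switch Fa Fc. Qed.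

Lemma analytic_vect_near d (F : V -> 'rV[C]_d) a (P : 'rV[C]_d -> Prop) :
  analytic_vect_at F a -> (\forall y \near F a, P y) -> \forall z \near a, P (F z).
Proof.
move=> Fa /near_rV_ball[r r0 h].
have : \forall z \near a, forall k, `|F z 0 k - F a 0 k| < r.
  by apply: near_rV_forall => k; exact: analytic_near_close (Fa k) r0.
by apply: near_rV_mono => z hz; apply: h; apply/rV_ballP.
Qed.

Lemma analytic_map_open (W : variety R) (U : set V) (f : V -> Cpt W) a (S : set (Cpt W)) :
  analytic_map U f -> U a -> open_pts S -> S (f a) -> \forall z \near a, S (f z).
Proof.
move=> fU Ua oS /oS[i [x [fx hx]]].
have [H [Ha Hc Hx]] := analytic_map_chart fU Ua fx.
rewrite -Hx in hx.
by apply: near_rV_mono2 (analytic_vect_near Ha hx) Hc => z; apply.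
Qed.

Lemma analytic_map_sub (W : variety R) (U U' : set V) (f : V -> Cpt W) :
  U' `<=` U -> analytic_map U f -> analytic_map U' f.
Proof. by move=> UU fU z /UU; exact: fU. Qed.

Lemma analytic_vect_comp d e (F : 'rV[C]_d -> 'rV[C]_e) (g : V -> 'rV[C]_d) a :
  analytic_vect_at F (g a) -> analytic_vect_at g a ->
  analytic_vect_at (fun z => F (g z)) a.
Proof. by move=> Fa ga k; apply: (analytic_comp (F := fun z => F z 0 k)). Qed.

Lemma analytic_on_comp (W1 W2 : variety R) (D : set (Cpt W1))
    (s : Cpt W1 -> Cpt W2) (U : set V) (f : V -> Cpt W1) a :
  analytic_on D s -> analytic_map U f -> U a -> D (f a) ->
  (\forall z \near a, D (f z)) ->
  exists i (F : V -> 'rV[C]_(@dim R W2 i)),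
    analytic_vect_at F a /\ \forall z \near a, coord (s (f z)) (F z).
Proof.
move=> sD fU Ua Da nD; have [i [x [j [F [fx Fx hF]]]]] := sD _ Da.
have [H [Ha Hc Hx]] := analytic_map_chart fU Ua fx.
rewrite -Hx in Fx hF.
exists j, (fun z => F (H z)); split; first exact: analytic_vect_comp.
have N := near_rV_mono2 (fun (z : V) h1 h2 => conj h1 h2) Hc nD.
apply: near_rV_mono2 (analytic_vect_near Ha hF) N => z hz [h1 h2].
exact: hz.
Qed.

Lemma analytic_row_mx d e (F : V -> 'rV[C]_d) (H : V -> 'rV[C]_e) a :
  analytic_vect_at F a -> analytic_vect_at H a ->
  analytic_vect_at (fun z => row_mx (F z) (H z)) a.
Proof.
move=> Fa Ha k; case: (split_ordP k) => l ->.
  rewrite (_ : (fun z => _) = fun z => F z 0 l); first exact: Fa.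
  by apply/funext => z; rewrite row_mxEl.
rewrite (_ : (fun z => _) = fun z => H z 0 l); first exact: Ha.
by apply/funext => z; rewrite row_mxEr.
Qed.

End AnalyticMaps.

(** * Evaluation of germs *)

Section Evaluation.
Variables (R : realType) (n : nat).
Local Notation C := (Cx R).
Local Notation V := 'rV[C]_n.
Variables (K : diffFieldType n) (iota : {rmorphism C -> K}) (p : V).
Variable real : germ_field iota p.
Local Notation D := [set p].
Local Notation gen := (generically D).

(** Where the denominator vanishes this is [0] by convention and carries no information, so the laws
    below hold generically. *)
Definition germ_eval (x : K) (z : V) : C := Defs.num real x z / Defs.den real x z.
Definition germ_eval_row d (x : 'rV[K]_d) (z : V) : 'rV[C]_d := \row_c germ_eval (x 0 c) z.

Lemma den_nonzero x : nonzero_germs D (Defs.den real x).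
Proof. by split=> _ ->; [exact: den_analytic|exact: den_neq0]. Qed.

Lemma gen_den x : gen (fun z => Defs.den real x z != 0).
Proof. exact: gen_nonzero (den_nonzero x). Qed.

Lemma gen_of_near (P : V -> Prop) : (\forall z \near p, P z) -> gen P.
Proof. by move=> h; apply: gen_near => _ ->. Qed.

Lemma germ_evalD x y : gen (fun z => germ_eval (x + y) z = germ_eval x z + germ_eval y z).
Proof.
apply: gen_mono2 (gen_and (gen_den x) (gen_den y))
  (gen_and (gen_den (x + y)) (gen_of_near (germ_add real x y))).
move=> z [hx hy] [hs e]; rewrite /germ_eval addf_div //; apply/eqP.
by rewrite eqr_div ?mulf_neq0 // e mulrC.
Qed.

Lemma germ_evalM x y : gen (fun z => germ_eval (x * y) z = germ_eval x z * germ_eval y z).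
Proof.
apply: gen_mono2 (gen_and (gen_den x) (gen_den y))
  (gen_and (gen_den (x * y)) (gen_of_near (germ_mul real x y))).
move=> z [hx hy] [hs e]; rewrite /germ_eval mulf_div; apply/eqP.
by rewrite eqr_div ?mulf_neq0 // e mulrC.
Qed.

Lemma germ_eval_const c : gen (fun z => germ_eval (iota c) z = c).
Proof.
apply: gen_mono2 (gen_den (iota c)) (gen_of_near (germ_const real c)).
by move=> z h e; rewrite /germ_eval e mulfK.
Qed.

Lemma germ_eval0 : gen (fun z => germ_eval 0 z = 0).
Proof. by have := germ_eval_const 0; rewrite rmorph0. Qed.

Lemma germ_eval1 : gen (fun z => germ_eval 1 z = 1).
Proof. by have := germ_eval_const 1; rewrite rmorph1. Qed.

(** Evaluating [x * x^-1 = 1] at a generic point rules out the value [0]. *)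
Lemma germ_eval_neq0 x : x != 0 -> gen (fun z => germ_eval x z != 0).
Proof.
move=> x0; have := germ_evalM x x^-1; rewrite mulfV // => h.
apply: gen_mono2 germ_eval1 h => z -> e; apply/eqP => e0.
by move: e; rewrite e0 mul0r => /eqP; rewrite oner_eq0.
Qed.

Lemma germ_eval_sum (I : Type) (l : seq I) (x : I -> K) (f : I -> V -> C) :
  (forall i, gen (fun z => germ_eval (x i) z = f i z)) ->
  gen (fun z => germ_eval (\sum_(i <- l) x i) z = \sum_(i <- l) f i z).
Proof.
move=> h; elim: l => [|i l IH].
  by apply: gen_mono germ_eval0 => z; rewrite !big_nil.
rewrite big_cons.
apply: gen_mono2 (gen_and (h i) IH) (germ_evalD (x i) (\sum_(i <- l) x i)) => z [e1 e2] ->.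
by rewrite big_cons e1 e2.
Qed.

Lemma germ_eval_prod (I : Type) (l : seq I) (x : I -> K) (f : I -> V -> C) :
  (forall i, gen (fun z => germ_eval (x i) z = f i z)) ->
  gen (fun z => germ_eval (\prod_(i <- l) x i) z = \prod_(i <- l) f i z).
Proof.
move=> h; elim: l => [|i l IH].
  by apply: gen_mono germ_eval1 => z; rewrite !big_nil.
rewrite big_cons.
apply: gen_mono2 (gen_and (h i) IH) (germ_evalM (x i) (\prod_(i <- l) x i)) => z [e1 e2] ->.
by rewrite big_cons e1 e2.
Qed.

Lemma germ_eval_exp x k : gen (fun z => germ_eval (x ^+ k) z = germ_eval x z ^+ k).
Proof.
elim: k => [|k IH]; first by apply: gen_mono germ_eval1 => z; rewrite !expr0.
rewrite exprS; apply: gen_mono2 IH (germ_evalM x (x ^+ k)) => z e1 ->.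
by rewrite e1 exprS.
Qed.

Lemma germ_eval_peval N (x : 'rV[K]_N) P :
  gen (fun z => germ_eval (peval iota x P) z = peval idfun (germ_eval_row x z) P).
Proof.
rewrite peval_sum.
apply: (@germ_eval_sum _ _ _ (fun m z => idfun (mcoeff m P) * \prod_(i
  < N) germ_eval_row x z 0 i ^+ m i)) => m.
have h : gen (fun z => germ_eval (\prod_(i < N) x 0 i ^+ m i) z =
    \prod_(i < N) germ_eval_row x z 0 i ^+ m i).
  apply: (@germ_eval_prod _ _ _ (fun i z => germ_eval_row x z 0 i ^+ m i)) => i.
  by apply: gen_mono (germ_eval_exp (x 0 i) (m i)) => z ->; rewrite mxE.
apply: gen_mono2 (gen_and h (germ_eval_const (mcoeff m P))) (germ_evalM (iota (mcoeff m P))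
  (\prod_(i < N) x 0 i ^+ m i)) => z [e1 e2] ->.
by rewrite e1 e2.
Qed.

Lemma gen_seq (T : Type) (s : seq T) (P : T -> V -> Prop) :
  (forall x, List.In x s -> gen (P x)) -> gen (fun z => forall x, List.In x s -> P x z).
Proof.
elim: s => [|x s IH] h; first exact: gen_all.
apply: gen_mono2 (h x (or_introl erefl)) (IH (fun y ys => h y (or_intror ys))).
by move=> z hx hs y [<-|/hs].
Qed.

Lemma in_list (T : eqType) (x : T) (s : seq T) : x \in s -> List.In x s.
Proof. by elim: s => //= y s IH; rewrite inE => /predU1P[->|/IH]; [left|right]. Qed.

Lemma list_in (T : eqType) (x : T) (s : seq T) : List.In x s -> x \in s.
Proof. by elim: s => //= y s IH [->|/IH h]; rewrite inE ?eqxx ?h ?orbT. Qed.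

Lemma gen_frac_at N d (f : frac R N d) (x : 'rV[K]_N) (y : 'rV[K]_d) :
  frac_at iota f x y -> gen (fun z => frac_at idfun f (germ_eval_row x z) (germ_eval_row y z)).
Proof.
move=> [/frac_def_neq0 d0 hy].
have h1 : gen (fun z => peval idfun (germ_eval_row x z) (fden f) != 0).
  by apply: gen_mono2 (germ_eval_peval x (fden f)) (germ_eval_neq0 d0) => z <-.
have h2 : gen (fun z => forall c, germ_eval (y 0 c) z * peval idfun (germ_eval_row x z) (fden f) =
    peval idfun (germ_eval_row x z) (fnum f c)).
  apply: gen_forall => c; have := hy c => e.
  have := germ_evalM (y 0 c) (peval iota x (fden f)); rewrite e => h.
  apply: gen_mono2 h (gen_and (germ_eval_peval x (fden f)) (germ_eval_peval x (fnum f c))).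
  by move=> z e1 [<- <-]; rewrite e1.
apply: gen_mono2 h1 h2 => z dz hz; split.
  by exists (peval idfun (germ_eval_row x z) (fden f))^-1; rewrite mulfV.
by move=> c; rewrite mxE hz.
Qed.

(** [chart_pt] imposes infinitely many polynomials, but for complex points the finite list [eqs i]
    implies all of them, and finitely many generic conditions can be intersected. *)
Lemma gen_chart_pt (W : atlas R) i (x : 'rV[K]_(@dim R W i)) :
  chart_pt iota x -> gen (fun z => chart_pt idfun (germ_eval_row x z)).
Proof.
move=> xc.
have h : gen (fun z => forall P, List.In P (eqs i) -> peval idfun (germ_eval_row x z) P = 0).
  apply: gen_seq => P /list_in Pi.
  have P0 : peval iota x P = 0 by apply: xc => w; apply.
  have := germ_eval_peval x P; rewrite P0 => h.
  by apply: gen_mono2 germ_eval0 h => z -> <-.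
apply: gen_mono h => z hz P; apply => Q /in_list; exact: hz.
Qed.

Lemma gen_glued (W : atlas R) i j (x : 'rV[K]_(@dim R W i)) (y : 'rV[K]_(@dim R W j)) :
  glued iota x y -> gen (fun z => glued idfun (germ_eval_row x z) (germ_eval_row y z)).
Proof.
move=> [xc yc [f fi fxy]].
apply: gen_mono2 (gen_and (gen_chart_pt xc) (gen_chart_pt yc)) (gen_frac_at fxy).
by move=> z [h1 h2] h3; split; [exact: h1|exact: h2|exists f].
Qed.

(** [has_germ] speaks of one chart; the gluing relation, evaluated generically, carries it to any
    other coordinates of [a]. *)
Lemma gen_coord (W : variety R) (f : V -> Cpt W) (a : pt iota W) :
  has_germ real f a -> forall j (y : 'rV[K]_(dim j)), coord a y ->
  gen (fun z => coord (f z) (germ_eval_row y z)).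
Proof.
move=> [i [x [w [ax h]]]] j y ay.
have g : glued iota x y by apply/(coord_glued ax).
have hd : gen (fun z => forall c, Defs.den real (x 0 c) z != 0).
  by apply: gen_forall => c; exact: gen_den.
apply: gen_mono2 (gen_and (gen_of_near h) hd) (gen_glued g).
move=> z [[fw e] d0] gz; have : germ_eval_row x z = w z.
  by apply/rowP => c; rewrite mxE /germ_eval -e mulfK.
by move=> E; rewrite E in gz; apply/(coord_glued fw).
Qed.

Lemma near_analytic_coords d (x : 'rV[K]_d) : \forall z \near p, forall c,
  analytic_at (Defs.num real (x 0 c)) z /\ analytic_at (Defs.den real (x 0 c)) z.
Proof.
apply: near_rV_forall => c.
apply: near_rV_mono2 (analytic_near (num_analytic real (x 0 c)))
  (analytic_near (den_analytic real (x 0 c))) => z h1 h2.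
exact: conj h1 h2.
Qed.

(** The conditions that make coordinates analytic and place them in the chart are generic at [p] for
    both points, so [gen_ex] yields one common ball. *)
Lemma realizes_ex2 (W1 W2 : variety R) (a : pt iota W1) (b : pt iota W2) (N : set V) :
  nbhs p N -> exists (c : V) (r : C) fa fb,
    [/\ 0 < r, ball c r `<=` N, realizes real a (ball c r) fa &
        realizes real b (ball c r) fb].
Proof.
move=> /near_rV_ball[r0 r00 hN].
pose good W (a : pt iota W) i (x : 'rV[K]_(@dim R W i)) z :=
  [/\ forall c, analytic_at (Defs.num real (x 0 c)) z /\ analytic_at (Defs.den real (x 0 c)) z,
      forall c, Defs.den real (x 0 c) z != 0 & chart_pt idfun (germ_eval_row x z)].
have good_gen W (a' : pt iota W) i (x : 'rV[K]_(dim i)) : coord a' x -> gen (good W a' i x).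
  move=> ax.
  have hd : gen (fun z => forall c, Defs.den real (x 0 c) z != 0).
    by apply: gen_forall => c; exact: gen_den.
  apply: gen_mono2 (gen_and (gen_of_near (near_analytic_coords x)) hd) (gen_chart_pt
    (coord_chart ax)).
  by move=> z [h1 h2] h3; split; [exact: h1|exact: h2|exact: h3].
have realize W (a' : pt iota W) i (x : 'rV[K]_(dim i)) c r : coord a' x -> 0 < r ->
    (forall z, ball c r z -> good W a' i x z) -> exists f, realizes real a' (ball c r) f.
  move=> ax r1 hg.
  (* [q0] only serves as the value of the map outside the ball. *)
  have [q0 _] : exists q0 : Cpt W, coord q0 (germ_eval_row x c).
    by apply: pt_ex; case: (hg c (ballxx c r1)).
  have hq z : exists q : Cpt W, ball c r z -> coord q (germ_eval_row x z).
    have [zc|nzc] := pselect (ball c r z); last by exists q0 => /nzc.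
    by have [_ _ /pt_ex[q hq]] := hg z zc; exists q.
  have [f hf] := choice hq; exists f; split.
    move=> z zc; exists i, (germ_eval_row x); split.
      move=> k; rewrite (_ : (fun z => _) = fun z => Defs.num real (x 0 k) z *
          (Defs.den real (x 0 k) z)^-1); last by apply/funext => y; rewrite mxE.
      have [ha hd _] := hg z zc; have [h1 h2] := ha k.
      by apply: analytic_mul; [exact: h1|apply: analytic_inv; [exact: h2|exact: hd]].
    have bz : \forall w \near z, ball c r w.
      by apply: open_nbhs_nbhs; split; [exact: ball_open|exact: zc].
    by apply: near_rV_mono bz => w; exact: hf.
  exists i, x; split; first exact: ax.
  move=> z zc; split; last exact: hf.
  by move=> k; have [_ hd _] := hg z zc; exact/eqP.
have [i [x ax]] := coord_ex a; have [j [y bY]] := coord_ex b.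
have [c [r [r1 cN hg]]] := gen_ex erefl r00 (gen_and (good_gen _ a i x ax) (good_gen _ b j y bY)).
have [fa hfa] := realize _ a i x c r ax r1 (fun z zc => (hg z zc).1).
have [fb hfb] := realize _ b j y c r bY r1 (fun z zc => (hg z zc).2).
exists c, r, fa, fb; split; [exact: r1| |exact: hfa|exact: hfb].
by move=> z /cN; exact: hN.
Qed.

End Evaluation.

(** * Points over germ fields *)

Section GermPoints.
Variables (R : realType) (n : nat).
Local Notation C := (Cx R).
Local Notation V := 'rV[C]_n.

Definition germ_const (D : convex_domain R n) : {rmorphism C -> mero_diff_field D} :=
  @gconst R n D.

Lemma deriv_germ_const (D : convex_domain R n) i c : deriv i (germ_const D c) = 0.
Proof. by move: i; apply/(gconst_constants (D := D)); exists c. Qed.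

Definition germ_model (q : V) : germ_field (germ_const (point_domain q)) q :=
  germ_realization q.

Section Domain.
Variable D : convex_domain R n.

Lemma germ_class_sum (I : Type) (l : seq I) (f : I -> V -> C) :
  (forall i, analytic_all D (f i)) ->
  germ_class D (fun z => \sum_(i <- l) f i z) = \sum_(i <- l) germ_class D (f i).
Proof.
move=> h; elim: l => [|i l IH].
  by rewrite big_nil -germ_class_0; congr germ_class; apply/funext => z; rewrite big_nil.
rewrite big_cons -IH -germ_class_add.
- by congr germ_class; apply/funext => z; rewrite big_cons.
- exact: (analytic_mero (h i)).
- by apply: analytic_mero => d Dd; apply: analytic_sum => k; exact: h.
Qed.

Lemma germ_class_prod (I : Type) (l : seq I) (f : I -> V -> C) :
  (forall i, analytic_all D (f i)) ->
  germ_class D (fun z => \prod_(i <- l) f i z) = \prod_(i <- l) germ_class D (f i).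
Proof.
move=> h; elim: l => [|i l IH].
  by rewrite big_nil -germ_class_1; congr germ_class; apply/funext => z; rewrite big_nil.
rewrite big_cons -IH -germ_class_mul.
- by congr germ_class; apply/funext => z; rewrite big_cons.
- exact: (analytic_mero (h i)).
- by apply: analytic_mero => d Dd; apply: analytic_prod => k; exact: h.
Qed.

Lemma germ_class_exp f k : analytic_all D f ->
  germ_class D (fun z => f z ^+ k) = germ_class D f ^+ k.
Proof.
move=> h; elim: k => [|k IH].
  by rewrite expr0 -germ_class_1; congr germ_class; apply/funext => z; rewrite expr0.
rewrite exprS -IH -germ_class_mul.
- by congr germ_class; apply/funext => z; rewrite exprS.
- exact: (analytic_mero h).
- by apply: analytic_mero => d Dd; apply: analytic_exp; exact: h.
Qed.

Definition germ_class_row d (w : V -> 'rV[C]_d) : 'rV[mero_diff_field D]_d :=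
  \row_k germ_class D (fun z => w z 0 k).

Definition analytic_vect_all d (w : V -> 'rV[C]_d) :=
  forall q, cdom D q -> analytic_vect_at w q.

Lemma peval_germ_class_row d (w : V -> 'rV[C]_d) P : analytic_vect_all w ->
  peval (germ_const D) (germ_class_row w) P = germ_class D (fun z => peval idfun (w z) P).
Proof.
move=> wD; rewrite peval_sum.
rewrite -[RHS]/(germ_class D (fun z => \sum_(m <- msupp P)
  (fun m z => idfun (mcoeff m P) * \prod_(i < d) w z 0 i ^+ m i) m z)).
have h1 (m : multinom d) (i : 'I_d) : analytic_all D (fun z => w z 0 i ^+ m i).
  by move=> q /wD wq; apply: analytic_exp; exact: wq.
have h2 (m : multinom d) : analytic_all D (fun z => \prod_(i < d) w z 0 i ^+ m i).
  by move=> q Dq; apply: (@analytic_prod _ _ _ _ (fun i z => w z 0 i ^+ m i)) => i; exact: h1.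
rewrite germ_class_sum => [|m]; last first.
  by move=> q Dq; apply: analytic_mul; [exact: analytic_cst|exact: h2].
apply: eq_bigr => m _; rewrite (germ_class_mul (f := fun=> _)); last 2 first.
- exact: (analytic_mero (cst_analytic _)).
- exact: (analytic_mero (h2 m)).
congr (_ * _); rewrite (@germ_class_prod _ _ (fun i z => w z 0 i ^+ m i)); last exact: h1.
apply: eq_bigr => i _; rewrite (@germ_class_exp (fun z => w z 0 i)) ?mxE // => q /wD.
exact.
Qed.

Lemma germ_class_near_eq f g : analytic_all D f -> analytic_all D g ->
  (forall q, cdom D q -> \forall z \near q, f z = g z) -> germ_class D f = germ_class D g.
Proof.
move=> fD gD h; apply/germ_class_eq.
- exact: (analytic_mero fD).
- exact: (analytic_mero gD).
- exact: gen_near.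
Qed.

Lemma peval_all d (w : V -> 'rV[C]_d) P : analytic_vect_all w ->
  analytic_all D (fun z => peval idfun (w z) P).
Proof. by move=> wD q /wD; exact: analytic_peval. Qed.

Lemma germ_class_row_chart_pt (W : atlas R) i (w : V -> 'rV[C]_(@dim R W i)) :
  analytic_vect_all w -> (forall q, cdom D q -> \forall z \near q, chart_pt idfun (w z)) ->
  chart_pt (germ_const D) (germ_class_row w).
Proof.
move=> wD wc P hP; rewrite peval_germ_class_row // -germ_class_0; apply: germ_class_near_eq.
- exact: peval_all.
- exact: cst_analytic.
- by move=> q /wc; apply: near_rV_mono => z; apply.
Qed.

Lemma germ_class_row_frac_at N d (f : frac R N d) (w : V -> 'rV[C]_N) (y : V -> 'rV[C]_d) :
  analytic_vect_all w -> analytic_vect_all y ->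
  (forall q, cdom D q -> \forall z \near q, frac_at idfun f (w z) (y z)) ->
  frac_at (germ_const D) f (germ_class_row w) (germ_class_row y).
Proof.
move=> wD yD h; split.
  have den0 q : cdom D q -> \forall z \near q, peval idfun (w z) (fden f) != 0.
    by move=> /h; apply: near_rV_mono => z [/frac_def_neq0].
  have invD : analytic_all D (fun z => (peval idfun (w z) (fden f))^-1).
    move=> q Dq; apply: analytic_inv; first exact: peval_all.
    exact: near_rV_self (den0 q Dq).
  exists (germ_class D (fun z => (peval idfun (w z) (fden f))^-1)).
  rewrite peval_germ_class_row // -germ_class_mul -?germ_class_1.
  - apply: germ_class_near_eq.
    + by apply: analytic_all_mul; [exact: peval_all|exact: invD].
    + exact: cst_analytic.
    + by move=> q /den0; apply: near_rV_mono => z hz; rewrite mulfV.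
  - by apply: analytic_mero; exact: peval_all.
  - exact: (analytic_mero invD).
move=> c; have yc : analytic_all D (fun z => y z 0 c) by move=> q /yD; exact.
rewrite !peval_germ_class_row // mxE -germ_class_mul.
- apply: germ_class_near_eq.
  + by apply: analytic_all_mul; [exact: yc|exact: peval_all].
  + exact: peval_all.
  + by move=> q /h; apply: near_rV_mono => z [_]; apply.
- exact: (analytic_mero yc).
- by apply: analytic_mero; exact: peval_all.
Qed.

Lemma germ_class_row_row_mx d e (x : 'rV[C]_d) (w : V -> 'rV[C]_e) :
  row_mx (map_mx (germ_const D) x) (germ_class_row w) = germ_class_row (fun z => row_mx x (w z)).
Proof.
apply/rowP => k; case: (split_ordP k) => l ->.
  by rewrite row_mxEl !mxE; congr germ_class; apply/funext => z; rewrite row_mxEl.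
by rewrite row_mxEr !mxE; congr germ_class; apply/funext => z; rewrite row_mxEr.
Qed.

End Domain.

Section AtPoint.
Variable q : V.
Local Notation D := (point_domain q).

(** The realization uses chosen representatives instead of [g] and [h]. Cross-multiplied equality
    near [q] links the two, and [has_germ] asks for no more, being stated without division. *)
Lemma has_germ_quot (W : variety R) (f : V -> Cpt W) (a : pt (germ_const D) W)
    i (g h : 'I_(@dim R W i) -> V -> C) :
  (forall k, analytic_at (g k) q) -> (forall k, nonzero_germs D (h k)) ->
  (\forall z \near q, (forall k, h k z != 0) /\
     coord (f z) (\row_k (g k z / h k z))) ->
  coord a (\row_k germ_quot D (g k) (h k)) -> has_germ (germ_model q) f a.
Proof.
move=> ga h0 fc ac; exists i, (\row_k germ_quot D (g k) (h k)), (fun z => \row_k (g k z / h k z)).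
split; first exact: ac.
have gD k : analytic_all D (g k) by move=> _ ->.
have e : \forall z \near q, forall k,
    g k z * gden (germ_quot D (g k) (h k)) z = gnum (germ_quot D (g k) (h k)) z * h k z.
  apply: near_rV_forall => k.
  have /(germ_quot_eq (gD k) (h0 k) (gnum_analytic _) (gden_nonzero _)) := germ_quotK
    (germ_quot D (g k) (h k)).
  by move=> /(_ q erefl).
apply: near_rV_mono2 fc e => z [hz fz] ez; split; first exact: fz.
move=> k; rewrite !mxE /=; have := ez k; set u := gden _ z; set v := gnum _ z => E.
by apply: (mulIf (hz k)); rewrite mulrAC divfK // E.
Qed.

Lemma has_germ_class_row (W : variety R) (f : V -> Cpt W) i (F : V -> 'rV[C]_(@dim R W i)) :
  analytic_vect_at F q -> (\forall z \near q, coord (f z) (F z)) ->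
  exists2 a : pt (germ_const D) W, coord a (germ_class_row D F) & has_germ (germ_model q) f a.
Proof.
move=> Fq fc; have FD : analytic_vect_all D F by move=> _ ->.
have cF : chart_pt (germ_const D) (germ_class_row D F).
  apply: (germ_class_row_chart_pt FD) => _ ->; apply: near_rV_mono fc => z.
  exact: coord_chart.
have [a ha] := pt_ex cF; exists a; first exact: ha.
have rowE : germ_class_row D F = \row_k germ_quot D (fun z => F z 0 k) (fun=> 1).
  apply/rowP => k; rewrite !mxE /germ_quot; congr germ_class; apply/funext => z.
  by rewrite divr1.
rewrite rowE in ha; apply: has_germ_quot ha.
- by move=> k; exact: Fq.
- by move=> k; exact: nonzero_germs1.
apply: near_rV_mono fc => z hz; split; first by move=> k; rewrite oner_neq0.
rewrite (_ : \row_k _ = F z) //; apply/rowP => k.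
by rewrite mxE divr1.
Qed.

End AtPoint.

(** * Passage from [M] to the germs at a nearby point *)

Section Transfer.
Variables (M : diffFieldType n) (iota : {rmorphism C -> M}).
Hypothesis M_constants : constants_are iota.
Variables (p : V) (real : germ_field iota p) (rho : C) (rho0 : 0 < rho).
Local Notation B := (ball_domain p rho0).
Variables (c : V) (pc : ball p rho c).

Definition germ_row (D : convex_domain R n) d (x : 'rV[M]_d) : 'rV[mero_diff_field D]_d :=
  \row_k germ_quot D (Defs.num real (x 0 k)) (Defs.den real (x 0 k)).

Definition analytic_coords d (x : 'rV[M]_d) := forall k z, ball p rho z ->
  analytic_at (Defs.num real (x 0 k)) z /\ analytic_at (Defs.den real (x 0 k)) z.

Lemma point_sub_ball q : ball p rho q -> cdom (point_domain q) `<=` cdom B.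
Proof. by move=> h _ ->. Qed.

(** The realization excludes a zero germ only at [p]; the identity theorem excludes it on the whole
    ball. *)
Lemma den_nonzero_ball d (x : 'rV[M]_d) k : analytic_coords x ->
  nonzero_germs B (Defs.den real (x 0 k)).
Proof.
move=> xa; split=> [z zB|z zB h]; first by have [] := xa k z zB.
apply: (@den_neq0 _ _ _ _ _ real (x 0 k)).
apply: (analytic_identity (@convex_ball _ _ p rho) _ zB (ballxx p rho0) h) => w wB.
by have [] := xa k w wB.
Qed.

Lemma germ_row_restrict d (x : 'rV[M]_d) q (pq : ball p rho q) : analytic_coords x ->
  map_mx (mero_restrict (point_sub_ball pq)) (germ_row B x) =
  germ_row (point_domain q) x.
Proof.
move=> xa; apply/rowP => k; rewrite !mxE; apply: mero_restrict_quot.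
  by move=> z zB; have [] := xa k z zB.
exact: den_nonzero_ball.
Qed.

Lemma germ_row_embed d (x : 'rV[M]_d) :
  map_mx (germ_embed real) x = germ_row (point_domain p) x.
Proof. by apply/rowP => k; rewrite !mxE. Qed.

Lemma iota_deriv0 i k : deriv i (iota k) = 0.
Proof. by move: i; apply/M_constants; exists k. Qed.

(** Over the field of the ball the coordinates satisfy the equations of the chart because they do so
    at [p], and restriction is injective as a morphism of fields. *)
Lemma germ_point (X : variety R) (a : pt iota X) i (x : 'rV[M]_(dim i)) :
  coord a x -> analytic_coords x ->
  exists (aL : pt (germ_const B) X) (ap : pt (germ_const (point_domain p)) X)
         (ac : pt (germ_const (point_domain c)) X),
   [/\ pt_over (germ_embed real) a ap,
       pt_over (mero_restrict (point_sub_ball (ballxx p rho0))) aL ap,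
       pt_over (mero_restrict (point_sub_ball pc)) aL ac &
       coord ac (germ_row (point_domain c) x)].
Proof.
move=> ax xa.
have [ap hap] := pt_over_ex (germ_embed_const real) a.
have apx := pt_over_coord (germ_embed_const real) hap ax.
have rE := @mero_restrict_const R n B (point_domain p) (point_sub_ball (ballxx p rho0)).
have cL : chart_pt (germ_const B) (germ_row B x).
  apply: (chart_pt_map_inj rE (@fmorph_inj _ _ _)).
  rewrite germ_row_restrict // -germ_row_embed; exact: coord_chart apx.
have [aL haL] := pt_ex cL.
have rE' := @mero_restrict_const R n B (point_domain c) (point_sub_ball pc).
have [ac hac] := pt_over_ex rE' aL.
exists aL, ap, ac; split; first exact: hap.
- exists i, (germ_row B x); split; first exact: haL.
  by rewrite germ_row_restrict // -germ_row_embed.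
- exact: hac.
- have := pt_over_coord rE' hac haL; rewrite germ_row_restrict //.
Qed.

(* [M] and the germs at [c] are compared through the germs at [p] and the
   meromorphic functions on the ball: M -> germs at p <- ball -> germs at c. *)
Lemma same_dvalue_transfer (X1 X2 Z : variety R)
    (chi1 : @dconstr R n X1 Z) (chi2 : @dconstr R n X2 Z)
    (a : pt iota X1) (b : pt iota X2)
    i (x : 'rV[M]_(dim i)) l (y : 'rV[M]_(dim l)) :
  coord a x -> analytic_coords x -> coord b y -> analytic_coords y ->
  exists (a' : pt (germ_const (point_domain c)) X1) (b' : pt (germ_const (point_domain c)) X2),
  [/\ coord a' (germ_row (point_domain c) x), coord b' (germ_row (point_domain c) y) &
      same_dvalue chi1 chi2 a b <-> same_dvalue chi1 chi2 a' b'].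
Proof.
move=> ax xa bY ya.
have [aL [ap [ac [h1 h2 h3 h4]]]] := germ_point ax xa.
have [bL [bp [bc [k1 k2 k3 k4]]]] := germ_point bY ya.
exists ac, bc; split; [exact: h4|exact: k4|].
have rE := @mero_restrict_const R n B (point_domain p) (point_sub_ball (ballxx p rho0)).
have rE' := @mero_restrict_const R n B (point_domain c) (point_sub_ball pc).
rewrite (same_dvalue_map (germ_embed_const real)
  (germ_embed_diff real) iota_deriv0 chi1 chi2 h1 k1).
rewrite -(same_dvalue_map rE (@mero_restrict_diff R n B (point_domain p) _)
  (@deriv_germ_const B) chi1 chi2 h2 k2).
by rewrite (same_dvalue_map rE' (@mero_restrict_diff R n B (point_domain c) _)
  (@deriv_germ_const B) chi1 chi2 h3 k3).
Qed.

End Transfer.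
End GermPoints.

(** * Lifting through an analytic covering *)

Section ConvexSegments.
Variables (R : realType) (n : nat).
Local Notation C := (Cx R).
Local Notation V := 'rV[C]_n.

Lemma convex_seg_le (D : set V) a z (s t : R) : convex_set D -> D a ->
  D (seg a z s) -> 0 <= t <= s -> D (seg a z t).
Proof.
move=> cD Da Ds /andP[t0 ts].
have [s0|s0] := eqVneq s 0.
  by have -> : t = 0; [apply/le_anti; rewrite t0 -s0 ts|rewrite seg0].
have sp : 0 < s by rewrite lt_neqAle eq_sym s0 (le_trans t0 ts).
have -> : seg a z t = seg a (seg a z s) (t / s).
  rewrite /seg [a + _ *: _ - a]addrC addKr scalerA -rmorphM /=.
  by rewrite divfK.
apply: (cD _ _ Da Ds); rewrite divr_ge0 ?(ltW sp) //=.
by rewrite ler_pdivrMr // mul1r.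
Qed.

Lemma seg_translate (a z v : V) t : seg (a + v) (z + v) t = seg a z t + v.
Proof. by rewrite /seg opprD addrACA subrr addr0 addrAC. Qed.

Lemma convex_translate (D : set V) v : convex_set D ->
  convex_set [set w | D (w + v)].
Proof. by move=> cD a z /= Da Dz t t01 /=; rewrite -seg_translate; exact: cD. Qed.

Lemma ball_translate (a v : V) (r : C) : ball a r (a + v) <-> ball 0 r v.
Proof.
split=> /rV_ballP[r0 h]; apply/rV_ballP; split; try exact: r0;
  move=> i; have := h i.
  by rewrite !mxE addrAC subrr add0r subr0.
by rewrite !mxE [a 0 i + _]addrC addrK subr0.
Qed.

Lemma ball_sub0 (a w : V) (r : C) : ball a r w <-> ball 0 r (w - a).
Proof.
have e : a + (w - a) = w by rewrite addrC subrK.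
by have := ball_translate a (w - a) r; rewrite e.
Qed.

Definition tube (a z : V) (s : R) (d : C) : set V :=
  [set w | exists2 t : R, 0 <= t <= s & ball (seg a z t) d w].

Lemma affine_combination (k k1 k2 : C) (w1 w2 a z : V) :
  (w1 - (a + k1 *: (z - a))) +
    k *: ((w2 - (a + k2 *: (z - a))) - (w1 - (a + k1 *: (z - a)))) =
  (w1 + k *: (w2 - w1)) - (a + ((1 - k) * k1 + k * k2) *: (z - a)).
Proof. by apply/rowP => i; rewrite !mxE; ring. Qed.

(** Displacements from the segment lie in a convex ball about [0], and combining two points combines
    their times and their displacements with the same weights. *)
Lemma convex_tube a z s d : convex_set (tube a z s d).
Proof.
move=> w1 w2 [t1 /andP[t10 t1s] h1] [t2 /andP[t20 t2s] h2] t /andP[t0 tle1].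
have t1' : 0 <= 1 - t by rewrite subr_ge0.
exists ((1 - t) * t1 + t * t2).
  rewrite addr_ge0 ?mulr_ge0 //=.
  have -> : s = (1 - t) * s + t * s by ring.
  by apply: lerD; rewrite ler_wpM2l.
move/ball_sub0: h1 => h1; move/ball_sub0: h2 => h2; apply/ball_sub0.
have := @convex_ball _ _ 0 d _ _ h1 h2 t; rewrite t0 tle1 => /(_ isT).
congr (ball 0 d _); rewrite /seg rmorphD !rmorphM rmorphB rmorph1 /=.
exact: affine_combination.
Qed.

Lemma open_near_ball (a w : V) (r : C) : ball a r w -> \forall y \near w, ball a r y.
Proof.
by move=> h; apply: open_nbhs_nbhs; split; [exact: ball_open|exact: h].
Qed.

End ConvexSegments.

Section Lifting.
Variables (R : realType) (n : nat).
Local Notation C := (Cx R).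
Local Notation V := 'rV[C]_n.
Variables (Y X : variety R) (U : set (Cpt Y)) (pi : Cpt Y -> Cpt X).
Hypothesis cov : analytic_covering U pi.
Variables (B : set V) (f : V -> Cpt X).
Hypothesis fB : analytic_map B f.

Lemma lift_sub W W' l : W' `<=` W -> is_lift U pi W f l -> is_lift U pi W' f l.
Proof.
move=> WW [lW h]; split; first exact: analytic_map_sub lW.
by move=> z /WW; exact: h.
Qed.

(** The whole ball is sent into one evenly covered open set, so the same radius serves every
    starting point [w] in it and every [u] above [f w]: the section over the sheet of [u] is
    composed with [f]. *)
Lemma local_lift z : B z -> (\forall w \near z, B w) ->
  exists2 e : C, 0 < e & ball z e `<=` B /\
    forall w u, ball z e w -> U u -> pi u = f w ->
    exists2 l, is_lift U pi (ball z e) f l & l w = u.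
Proof.
move=> Bz nB; have [_ _ /(_ (f z))[T0 [T0o T0z [sheets [s_open s_disj sU s_sec]]]]] := cov.
have nO := analytic_map_open fB Bz T0o T0z.
have /near_rV_ball[e e0 he] := near_rV_mono2 (fun (z : V) a b => conj a b) nB nO.
exists e; first exact: e0.
split; first by move=> w /he[].
move=> w u zw Uu pu.
have Ou : T0 (pi u) by rewrite pu; case: (he w zw).
have [s ss su] : (\bigcup_(s in sheets) s) u by rewrite -sU.
have [sg [sgO sgs sgu]] := s_sec s ss.
have [T' oT' sE] := s_open s ss.
exists (fun w => sg (f w)); last by rewrite -pu; exact: sgu.
split.
  move=> y zy; have [By Oy] := he y zy.
  have ny : \forall y' \near y, T0 (f y').
    by apply: near_rV_mono (open_near_ball zy) => y' /he[].
  by have [i [F [Fy Fc]]] := analytic_on_comp sgO fB By Oy ny; exists i, F.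
move=> y /he[By Oy]; have [h1 h2] := sgs _ Oy; split; last exact: h2.
by move: h1; rewrite sE => -[].
Qed.

(** Near each point the two lifts stay in fixed sheets. Agreement at one nearby point makes these
    sheets equal, and [pi] is injective on a sheet. *)
Lemma lift_uniq W l1 l2 a z : convex_set W -> W `<=` B ->
  is_lift U pi W f l1 -> is_lift U pi W f l2 -> W a -> W z ->
  l1 a = l2 a -> l1 z = l2 z.
Proof.
move=> cW WB [a1 h1] [a2 h2]; apply: (convex_propagate (P := fun z => l1 z = l2 z) cW).
move=> {z} z Wz; have Bz := WB _ Wz.
have [_ _ /(_ (f z))[T0 [T0o T0z [sheets [s_open s_disj sU s_sec]]]]] := cov.
have nO := analytic_map_open fB Bz T0o T0z.
have [U1 p1] := h1 z Wz; have [U2 p2] := h2 z Wz.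
have [s1 ss1 sl1] : (\bigcup_(s in sheets) s) (l1 z).
  by rewrite -sU; split=> //=; rewrite p1.
have [s2 ss2 sl2] : (\bigcup_(s in sheets) s) (l2 z).
  by rewrite -sU; split=> //=; rewrite p2.
have [T1 oT1 s1E] := s_open s1 ss1; have [T2 oT2 s2E] := s_open s2 ss2.
have T1z : T1 (l1 z) by move: sl1; rewrite s1E => -[].
have T2z : T2 (l2 z) by move: sl2; rewrite s2E => -[].
have n1 := analytic_map_open a1 Wz oT1 T1z.
have n2 := analytic_map_open a2 Wz oT2 T2z.
have /near_rV_ball[e e0 he] := near_rV_mono2 (fun (z : V) a b => conj a b) n1 n2.
have [sg [_ _ sgu]] := s_sec s1 ss1.
exists e; first exact: e0.
move=> w w' Ww Ww' /he[w1 w2] /he[w'1 w'2] E.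
have s12 : s1 = s2.
  apply: s_disj => //; exists (l1 w); split.
    by rewrite s1E; split; [case: (h1 w Ww)|exact: w1].
  by rewrite E s2E; split; [case: (h2 w Ww)|exact: w2].
have [U1' p1'] := h1 w' Ww'; have [U2' p2'] := h2 w' Ww'.
rewrite -(sgu (l1 w')) ?p1' -?p2'; last by rewrite s1E; split; [exact: U1'|exact: w'1].
by apply: sgu; rewrite s12 s2E; split; [exact: U2'|exact: w'2].
Qed.

Lemma analytic_map_near_eq (l l' : V -> Cpt Y) z :
  (\forall w \near z, l w = l' w) ->
  (exists (i : 'I_(nch Y)) (F : V -> 'rV[C]_(dim i)),
    analytic_vect_at F z /\ \forall w \near z, coord (l w) (F w)) ->
  exists (i : 'I_(nch Y)) (F : V -> 'rV[C]_(dim i)),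
    analytic_vect_at F z /\ \forall w \near z, coord (l' w) (F w).
Proof.
move=> E [i [F [Fz Fc]]]; exists i, F; split; first exact: Fz.
by apply: near_rV_mono2 E Fc => w <-.
Qed.

Section Ball.
Hypotheses (cB : convex_set B) (oB : forall z, B z -> \forall w \near z, B w).
Variables (c : V) (u0 : Cpt Y).
Hypotheses (Bc : B c) (Uu0 : U u0) (pu0 : pi u0 = f c).

(* The lift is continued along the segment [c, z] on convex neighbourhoods of
   initial pieces of the segment; the intersection of two of them is convex,
   hence connected, so the value reached at [z] is unique. *)
Definition reaches z u := exists (W : set V) l,
  [/\ convex_set W, forall w, W w -> \forall y \near w, W y, W `<=` B, W c & W z] /\
  [/\ is_lift U pi W f l, l c = u0 & l z = u].

Lemma reaches_uniq z u u' : reaches z u -> reaches z u' -> u = u'.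
Proof.
move=> [W [l [[cW oW WB Wc Wz] [lW lc <-]]]] [W' [l' [[cW' oW' WB' Wc' Wz'] [lW' lc' <-]]]].
apply: (@lift_uniq (W `&` W') l l' c).
- exact: convex_setI.
- by move=> w [/WB].
- by apply: lift_sub lW => w [].
- by apply: lift_sub lW' => w [].
- by [].
- by [].
- by rewrite lc lc'.
Qed.

Lemma reaches_ball z : B z -> exists u, reaches z u.
Proof.
move=> Bz.
have Bseg t : 0 <= t <= 1 -> B (seg c z t) by move=> t01; exact: cB.
suff : exists u, reaches (seg c z 1) u by rewrite seg1.
apply: (real_induction (P := fun t => exists u, reaches (seg c z t) u)).
  rewrite seg0; have [e e0 [eB he]] := local_lift Bc (oB Bc).
  have [l ll lc] := he c u0 (ballxx c e0) Uu0 pu0.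
  exists u0, (ball c e), l; split; split.
  - exact: convex_ball.
  - by move=> w; exact: open_near_ball.
  - exact: eB.
  - exact: ballxx.
  - exact: ballxx.
  - exact: ll.
  - exact: lc.
  - exact: lc.
move=> t t01; set z0 := seg c z t.
have [e e0 [eB he]] := local_lift (Bseg t t01) (oB (Bseg t t01)).
have e20 : 0 < e / 2 by rewrite divr_gt0.
have [d d0 hd] := seg_near c z t e20.
exists d; first exact: d0.
move=> s s' s01 s'01 ds ds' [u [W [l [[cW oW WB Wc Ws] [lW lc lu]]]]].
have [s's|ss'] := leP s' s.
  have Ws' : W (seg c z s').
    by apply: (convex_seg_le cW Wc Ws); rewrite s's; case/andP: s'01 => ->.
  exists (l (seg c z s')), W, l.
  exact: (conj (And5 cW oW WB Wc Ws') (And3 lW lc erefl)).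
have [UB pB] := lW.2 _ Ws.
have e2e : e / 2 <= e by rewrite ler_pdivrMr // mulr_natr mulr2n lerDl ltW.
have [l' ll' l's] := he (seg c z s) (l (seg c z s)) (ball_shrink e2e (hd s ds)) UB pB.
have /near_rV_ball[d1 d10 hd1] := oW _ Wc.
have /near_rV_ball[d2 d20 hd2] := oW _ Ws.
(* The tube must lie in [W] up to time [s] and in [ball z0 e] afterwards: [d1] and [d2] keep the two
   ends inside [W], and [e / 2] is added to the [e / 2] granted by [hd]. *)
have [dl dl0 [dl1 dl2 dle]] : exists2 dl : C, 0 < dl & [/\ dl <= d1, dl <= d2 & dl <= e / 2].
  have [x x0 [x1 x2]] : exists2 x : C, 0 < x & x <= d1 /\ x <= d2.
    have re : d1 >=< d2 by apply: real_comparable; rewrite gtr0_real.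
    by case/comparable_leP: re => h'; [exists d1|exists d2; [exact: d20|rewrite ltW]].
  have re : x >=< e / 2 by apply: real_comparable; rewrite gtr0_real.
  case/comparable_leP: re => h'; first by exists x.
  by exists (e / 2); [exact: e20|split=> //; apply: le_trans (ltW h') _].
pose T := tube c z s' dl.
have agree w : W w -> ball z0 e w -> l w = l' w.
  move=> Ww zw; apply: (@lift_uniq (W `&` ball z0 e) l l' (seg c z s)).
  - by apply: convex_setI; [exact: cW|exact: convex_ball].
  - by move=> y [/WB].
  - by apply: lift_sub lW => y [].
  - by apply: lift_sub ll' => y [].
  - by split; [exact: Ws|exact: (ball_shrink e2e (hd s ds))].
  - by [].
  - by rewrite l's.
have Tcov w : T w -> W w \/ ball z0 e w.
  move=> [tau /andP[tau0 taus'] wtau].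
  have [taus|staus] := leP tau s; [left|right].
    (* Translate the initial segment by the displacement [v]: both ends remain in [W], so convexity
       keeps the part between them there. *)
    have := wtau => /ball_sub0 hv; set v := w - _ in hv.
    have -> : w = seg c z tau + v by rewrite /v addrC subrK.
    have Wcv : [set y | W (y + v)] c.
      by apply: hd1; apply: (ball_shrink dl1); apply/ball_translate.
    have Wsv : [set y | W (y + v)] (seg c z s).
      by apply: hd2; apply: (ball_shrink dl2); apply/ball_translate.
    have tt : 0 <= tau <= s by rewrite tau0 taus.
    exact: (convex_seg_le (@convex_translate _ _ W v cW) Wcv Wsv tt).
  have -> : e = e / 2 + e / 2 by field.
  apply: ball_triangle (ball_shrink dle wtau); apply: hd.
  move: ds ds'; rewrite !ltr_distl => /andP[h1 h2] /andP[h3 h4].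
  by rewrite (lt_trans h1 staus) (le_lt_trans taus' h4).
(* By [agree] the lifts coincide on the overlap of their domains, so near each point of the tube
   [l2] equals one of them. *)
pose l2 w := if pselect (W w) then l w else l' w.
have l2W w : W w -> l2 w = l w by rewrite /l2; case: pselect.
have l2e w : ball z0 e w -> l2 w = l' w.
  by move=> zw; rewrite /l2; case: pselect => // Ww; exact: agree.
have s'0 : 0 <= s' by case/andP: s'01.
exists (l2 (seg c z s')), T, l2; split; split.
- exact: convex_tube.
- move=> w [tau taus wtau]; apply: near_rV_mono (open_near_ball wtau) => y ytau.
  by exists tau.
- by move=> w /Tcov[/WB|/eB].
- by exists 0; rewrite ?lexx // seg0; exact: ballxx.
- by exists s'; rewrite ?s'0 ?lexx //; exact: ballxx.
- split=> [w /Tcov[Ww|zw]|w /Tcov[Ww|zw]].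
  + apply: (analytic_map_near_eq (l := l)); last exact: lW.1.
    by apply: near_rV_mono (oW _ Ww) => y /l2W.
  + apply: (analytic_map_near_eq (l := l')); last exact: ll'.1.
    by apply: near_rV_mono (open_near_ball zw) => y /l2e.
  + by rewrite l2W //; exact: lW.2.
  + by rewrite l2e //; exact: ll'.2.
- by rewrite l2W.
- by [].
Qed.

(** Reached values are unique, so the pointwise choice [ft] coincides near each point with a single
    lift on an open set, and is therefore analytic. *)
Lemma global_lift : exists2 ft, is_lift U pi B f ft & ft c = u0.
Proof.
have h z : exists u, B z -> reaches z u.
  have [Bz|nBz] := pselect (B z); last by exists u0.
  by have [u hu] := reaches_ball Bz; exists u.
have [ft hft] := choice h.
have ftW z : B z -> exists (W : set V) l, [/\ W z, forall w, W w -> \forall y \near w, W y,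
    is_lift U pi W f l & forall w, W w -> ft w = l w].
  move=> Bz; have [W [l [[cW oW WB Wc Wz] [lW lc lz]]]] := hft z Bz.
  exists W, l; split; [exact: Wz|exact: oW|exact: lW|move=> w Ww].
  apply: (reaches_uniq (hft w (WB _ Ww))); exists W, l.
  exact: (conj (And5 cW oW WB Wc Ww) (And3 lW lc erefl)).
exists ft.
  split=> z Bz; have [W [l [Wz oW lW E]]] := ftW z Bz.
    apply: (analytic_map_near_eq (l := l)); last exact: lW.1.
    by apply: near_rV_mono (oW _ Wz) => y /E.
  by rewrite E //; exact: lW.2.
apply: (reaches_uniq (hft c Bc)).
have [e e0 [eB he]] := local_lift Bc (oB Bc).
have [l ll lc] := he c u0 (ballxx c e0) Uu0 pu0.
exists (ball c e), l; split; split.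
- exact: convex_ball.
- by move=> w; exact: open_near_ball.
- exact: eB.
- exact: ballxx.
- exact: ballxx.
- exact: ll.
- exact: lc.
- exact: lc.
Qed.

End Ball.
End Lifting.

(** * Translates of lifts *)

Section Main.
Variables (R : realType) (n : nat).
Local Notation C := (Cx R).
Local Notation V := 'rV[C]_n.

Lemma rapp2_graph (W1 W2 W3 : variety R) (f : rmap2 W1 W2 W3) (K : fieldType)
    (iota : {rmorphism C -> K}) (p : pt iota W1) (p' : pt iota W2) :
  rgraph2 (rdata2 f) p p' (rapp2 f p p').
Proof. by rewrite /rapp2; case: cid => q []. Qed.

Lemma rapp2_eq (W1 W2 W3 : variety R) (f : rmap2 W1 W2 W3) (K : fieldType)
    (iota : {rmorphism C -> K}) (p : pt iota W1) (p' : pt iota W2) q :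
  rgraph2 (rdata2 f) p p' q -> rapp2 f p p' = q.
Proof.
move=> h; have [q0 [_ un]] := rfun2 f p p'.
by rewrite -(un _ h) -(un _ (rapp2_graph f p p')).
Qed.

Section Action.
Variables (G Y : variety R) (act : rmap2 G Y Y) (g : Cpt G).
Variables (B : set V) (ft : V -> Cpt Y).
Hypothesis ftB : analytic_map B ft.

(** The rational map that presents the action at [z0] keeps a nonzero denominator nearby, so one
    presentation serves a neighbourhood. *)
Lemma act_local z0 : B z0 -> exists i j (x : 'rV[C]_(@dim R G i))
    (F : V -> 'rV[C]_(@dim R Y j)) l (f : frac R (dim i + dim j) (@dim R Y l)),
  [/\ coord g x, analytic_vect_at F z0, \forall z \near z0, coord (ft z) (F z) &
      List.In (existT _ l f) (rdata2 act i j)] /\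
  [/\ \forall z \near z0, frac_at idfun f (row_mx x (F z)) (frac_val f (row_mx x (F z))),
      analytic_vect_at (fun z => frac_val f (row_mx x (F z))) z0 &
      \forall z \near z0, coord (rapp2 act g (ft z)) (frac_val f (row_mx x (F z)))].
Proof.
move=> Bz0; have [i [j [x [y [gx fty [l [f [y' [fi fxy _]]]]]]]]] := rapp2_graph act g (ft z0).
have [F [Fz Fc Fy]] := analytic_map_chart ftB Bz0 fty.
have xa : analytic_vect_at (fun=> x) z0 by move=> k; exact: analytic_cst.
have ra := analytic_row_mx xa Fz; rewrite -Fy in fxy.
have [Ha Hf] := frac_analytic ra fxy.1.
exists i, j, x, F, l, f; split; split; [exact: gx|exact: Fz|exact: Fc|exact: fi|exact: Hf|exact:
  Ha|].
apply: near_rV_mono2 Fc Hf => z fz hz.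
have cH := rinto2 (coord_chart gx) (coord_chart fz) fi hz.
have [q hq] := pt_ex cH.
rewrite (_ : rapp2 act g (ft z) = q) //; apply: rapp2_eq.
exists i, j, x, (F z); split; [exact: gx|exact: fz|].
by exists l, f, (frac_val f (row_mx x (F z))); split; [exact: fi|exact: hz|exact: hq].
Qed.

Lemma act_analytic : analytic_map B (fun z => rapp2 act g (ft z)).
Proof.
move=> z Bz; have [i [j [x [F [l [f [_ [_ Ha Hc]]]]]]]] := act_local Bz.
by exists l, (fun z => frac_val f (row_mx x (F z))).
Qed.

End Action.

Section Realizations.
Variables (M : diffFieldType n) (iota : {rmorphism C -> M}).
Variables (p : V) (real : germ_field iota p).

(** A point has at most one coordinate vector in each of finitely many charts. One neighbourhood
    thus serves all of them, and the radius can be fixed before it is known which chart [realizes]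
    uses. *)
Lemma near_analytic_pt (X : variety R) (a : pt iota X) :
  \forall z \near p, forall i (x : 'rV[M]_(@dim R X i)), coord a x -> forall k,
    analytic_at (Defs.num real (x 0 k)) z /\ analytic_at (Defs.den real (x 0 k)) z.
Proof.
apply: (near_rV_forall (P := fun i z => forall x : 'rV[M]_(@dim R X i), coord a x -> forall k,
    analytic_at (Defs.num real (x 0 k)) z /\ analytic_at (Defs.den real (x 0 k)) z)) => i.
have [[x ax]|no] := pselect (exists x : 'rV[M]_(@dim R X i), coord a x); last first.
  by apply: near_rV_all => z x ax; case: no; exists x.
by apply: near_rV_mono (near_analytic_coords real x) => z h y ay; rewrite -(coord_fun ax ay).
Qed.

Variables (rho : C) (rho0 : 0 < rho).

Lemma realizes_germ (X : variety R) (i : 'I_(nch X)) (x : 'rV[M]_(dim i)) c r q f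
    (a' : pt (germ_const (point_domain q)) X) :
  analytic_coords real rho x -> ball c r `<=` ball p rho -> ball c r q ->
  (forall z, ball c r z -> (forall k, Defs.den real (x 0 k) z <> 0) /\
    coord (f z) (\row_k (Defs.num real (x 0 k) z / Defs.den real (x 0 k) z))) ->
  coord a' (germ_row real (point_domain q) x) -> has_germ (germ_model q) f a'.
Proof.
move=> xa crp crq hf a'x; apply: has_germ_quot a'x.
- by move=> k; case: (xa k q (crp q crq)).
- move=> k; have [dD d0] := den_nonzero_ball rho0 k xa.
  by split=> _ ->; [apply: dD; exact: crp|apply: d0; exact: crp].
- apply: near_rV_mono (open_near_ball crq) => z /hf[dz cz]; split; last exact: cz.
  by move=> k; apply/eqP.
Qed.

End Realizations.

Lemma analytic_map_germ (Y : variety R) (W : set V) (ft : V -> Cpt Y) q :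
  analytic_map W ft -> W q ->
  exists at' : pt (germ_const (point_domain q)) Y, has_germ (germ_model q) ft at'.
Proof.
move=> ftW Wq; have [i [F [Fq Fc]]] := ftW q Wq.
by have [a _ ha] := has_germ_class_row Fq Fc; exists a.
Qed.

Section Translate.
Variables (G Y : variety R) (act : rmap2 G Y Y) (q : V).
Local Notation D := (point_domain q).

(** The coordinates of [g] are constants in every chart where it lies, by [rational_coord], and
    define a complex point [g0]. Evaluating the rational expression of the action at a generic point
    gives the identity for [g0]. *)
Lemma translate_germs (at' bt' : pt (germ_const D) Y) (g : pt (germ_const D) G)
    (ft ftb : V -> Cpt Y) :
  has_germ (germ_model q) ft at' -> has_germ (germ_model q) ftb bt' ->
  rational_pt (germ_const D) g -> rapp2 act g at' = bt' ->
  exists g0 : Cpt G, generically [set q] (fun z => rapp2 act g0 (ft z) = ftb z).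
Proof.
move=> hat hbt gr gab.
have [i [j [x [y [gx aty [l [f [y' [fi fxy bty]]]]]]]]] := rapp2_graph act g at'.
rewrite gab in bty.
have [xg xE xgc] := rational_coord (iK := idfun) (fun=> erefl) gr gx.
have [g0 g0x] := pt_ex xgc.
exists g0; rewrite xE in fxy.
have hx : generically [set q] (fun z => forall k,
    germ_eval (germ_model q) (map_mx (germ_const D) xg 0 k) z = xg 0 k).
  by apply: gen_forall => k; rewrite mxE; exact: germ_eval_const.
apply: gen_mono2 (gen_and (gen_coord hat aty) (gen_coord hbt bty))
  (gen_and (gen_frac_at (germ_model q) fxy) hx) => z [h1 h2] [h3 h4].
apply: rapp2_eq; exists i, j, xg, (germ_eval_row (germ_model q) y z); split; [exact: g0x|exact:
  h1|].
exists l, f, (germ_eval_row (germ_model q) y' z); split; [exact: fi| |exact: h2].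
rewrite (_ : row_mx _ _ = germ_eval_row (germ_model q) (row_mx (map_mx (germ_const D) xg) y) z);
  first exact: h3.
apply/rowP => k; rewrite [RHS]mxE; case: (split_ordP k) => m ->.
  by rewrite !row_mxEl h4.
by rewrite !row_mxEr mxE.
Qed.

(** The way back: the rational expression of the action, valid near [q], is read as an identity
    between classes of germs. *)
Lemma translate_point (g : Cpt G) (B : set V) (ft : V -> Cpt Y) :
  analytic_map B ft -> B q ->
  exists (gK : pt (germ_const D) G) (at' bt' : pt (germ_const D) Y),
    [/\ rational_pt (germ_const D) gK, rapp2 act gK at' = bt', has_germ (germ_model q) ft at' &
        has_germ (germ_model q) (fun z => rapp2 act g (ft z)) bt'].
Proof.
move=> ftB Bq.
have [i [j [x [F [l [f [[gx Fq Fc fi] [Hf Ha Hc]]]]]]]] := act_local act g ftB Bq.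
have [at' atF hat] := has_germ_class_row Fq Fc.
have [bt' btH hbt] := has_germ_class_row Ha Hc.
have [gK hg] := pt_over_ex (iK := idfun) (phi := germ_const D) (fun=> erefl) g.
have gKx := pt_over_coord (iK := idfun) (phi := germ_const D) (fun=> erefl) hg gx.
exists gK, at', bt'; split; [by exists i, x| |exact: hat|exact: hbt].
apply: rapp2_eq; exists i, j, (map_mx (germ_const D) x), (germ_class_row D F); split.
- exact: gKx.
- exact: atF.
exists l, f, (germ_class_row D (fun z => frac_val f (row_mx x (F z)))); split.
- exact: fi.
- rewrite germ_class_row_row_mx; apply: germ_class_row_frac_at.
  + by move=> _ -> ; apply: analytic_row_mx; [move=> k; exact: analytic_cst|exact: Fq].
  + by move=> _ ->.
  + by move=> _ ->.
- exact: btH.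
Qed.

End Translate.
End Main.

Theorem proposition4p1 (R : realType) (n : nat)
  (RF : ominimal_expansion R)
  (G : alg_group R) (Y X Z : variety R)
  (act : rmap2 G Y Y) (act_faithful : is_faithful_action act)
  (U : set (Cpt Y)) (U_submanifold : submanifold U)
  (Gam : set (Cpt G)) (Gam_subgroup : subgroup Gam)
  (Gam_dense : zariski_dense Gam) (Gam_discrete : discrete_pts Gam)
  (Gam_acts : forall g u, Gam g -> U u -> U (rapp2 act g u))
  (pi : Cpt Y -> Cpt X) (pi_covering : analytic_covering U pi)
  (pi_quotient : forall u v, U u -> U v ->
     (pi u = pi v <-> exists2 g, Gam g & rapp2 act g u = v))
  (F : set (Cpt Y)) (F_open : open_pts F) (F_definable : definable_pts RF F)
  (F_sub_U : F `<=` U) (piF_definable : definable_map RF F pi)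
  (piF_surjective : pi @` F = setT)
  (M : diffFieldType n) (iota : {rmorphism Cx R -> M})
  (M_constants : constants_are iota)
  (p : 'rV[Cx R]_n) (real : germ_field iota p)
  (UU : diffFieldType n) (j : {rmorphism UU -> M}) (j_diff : diff_hom j)
  (UU_closed : diff_closed UU)
  (chit : dconstr n Y Z) (chit_orbits : separates_orbits act chit)
  (chi : dconstr n X Z) (chi_def : is_log_derivative U pi chit chi)
  (k := [set c : Cx R | exists u : UU, j u = iota c])
  (X_over : variety_over k X) (Y_over : variety_over k Y)
  (Z_over : variety_over k Z) (G_over : group_over k G)
  (chit_over : dconstr_over k chit) (chi_over : dconstr_over k chi)
  (a b : pt iota X) (a_UU : rational_pt j a) (b_UU : rational_pt j b) :
  (* a and b can be regarded as analytic maps on balls arbitrarily close to p *)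
  (forall N, nbhs p N -> exists (c : 'rV[Cx R]_n) (r : Cx R) fa fb,
     [/\ 0 < r, ball c r `<=` N, realizes real a (ball c r) fa &
         realizes real b (ball c r) fb]) /\
  (* and the equivalence holds on all balls sufficiently close to p *)
  exists2 N, nbhs p N &
    forall (c : 'rV[Cx R]_n) (r : Cx R) fa fb,
      0 < r -> ball c r `<=` N ->
      realizes real a (ball c r) fa -> realizes real b (ball c r) fb ->
      same_dvalue chi chi a b <->
      (forall ft, is_lift U pi (ball c r) fa ft ->
         exists (g : Cpt G) (c' : 'rV[Cx R]_n) (r' : Cx R),
           [/\ 0 < r', ball c' r' `<=` ball c r &
               forall z, ball c' r' z ->
                 U (rapp2 act g (ft z)) /\ pi (rapp2 act g (ft z)) = fb z]).
Proof.
split; first by move=> N; exact: realizes_ex2.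
have /near_rV_ball[rho rho0 hrho] := near_rV_mono2
  (fun z h1 h2 => conj h1 h2) (near_analytic_pt real a) (near_analytic_pt real b).
(* On this ball all numerators and denominators of the coordinates of [a] and [b] are analytic,
   whichever charts are used. *)
exists (ball p rho); first by apply/near_rV_ball; exists rho.
move=> c r fa fb r0 crp [faV [i [x [ax hx]]]] [fbV [l [y [bY hy]]]].
have xa : analytic_coords real rho x by move=> m z /hrho[/(_ i x ax m)].
have ya : analytic_coords real rho y by move=> m z /hrho[_ /(_ l y bY m)].
have piU (f : 'rV[Cx R]_n -> Cpt X) : analytic_map (ball c r) f ->
    exists ft, is_lift U pi (ball c r) f ft.
  move=> fV; have [_ piUT _] := pi_covering.
  have [u Uu pu] : (pi @` U) (f c) by rewrite piUT.
  have [ft hft _] := global_lift pi_covering fV (@convex_ball R n c r)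
    (fun z zc => open_near_ball zc) (ballxx c r0) Uu pu.
  by exists ft.
split=> [ab ft ftl|H].
  have cc := ballxx c r0; have pc := crp c cc.
  have [a' [b' [a'x b'y tr]]] := same_dvalue_transfer M_constants rho0 pc chi chi ax xa bY ya.
  have ha := realizes_germ rho0 xa crp cc hx a'x.
  have hb := realizes_germ rho0 ya crp cc hy b'y.
  have [ftb ftbl] := piU fb fbV.
  have [at' hat] := analytic_map_germ ftl.1 cc; have [bt' hbt] := analytic_map_germ ftbl.1 cc.
  have cst := gconst_constants (D := point_domain c).
  have e1 := chi_def _ _ _ (germ_model c) cst _ _ _ _ _ r0 faV ftl ha hat.
  have e2 := chi_def _ _ _ (germ_model c) cst _ _ _ _ _ r0 fbV ftbl hb hbt.
  have ic := @deriv_germ_const R n (point_domain c).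
  have e3 := same_dvalue_trans ic (same_dvalue_sym e1) (same_dvalue_trans ic (tr.1 ab) e2).
  have [g gr gab] := (chit_orbits _ _ cst at' bt').1 e3.
  have [g0 hg0] := translate_germs hat hbt gr gab.
  (* The translate of [ft] agrees with [ftb] generically at [c], hence pointwise on some smaller
     ball, where [ftb] already lifts [fb]. *)
  have [c' [r' [r'0 c'r' hz]]] := gen_ex (erefl : [set c] c) r0 hg0.
  exists g0, c', r'; split; [exact: r'0|exact: c'r'|move=> z zc'].
  by rewrite hz //; exact: ftbl.2 (c'r' z zc').
(* [H] speaks of every lift of [fa]; a lift has to exist before [g] can be obtained from it. *)
have [ft ftl] := piU fa faV.
have [g [c' [r' [r'0 c'r' hg]]]] := H ft ftl.
(* Germs are now taken at [c'], since the translate of [ft] is known to lift [fb] only on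
   [ball c' r']. *)
have cc' := ballxx c' r'0; have crc' := c'r' c' cc'; have pc' := crp c' crc'.
have [a' [b' [a'x b'y tr]]] := same_dvalue_transfer M_constants rho0 pc' chi chi ax xa bY ya.
apply/tr.
have ha := realizes_germ rho0 xa crp crc' hx a'x.
have hb := realizes_germ rho0 ya crp crc' hy b'y.
have [gK [at' [bt' [gr gab hat hbt]]]] := translate_point act g ftl.1 crc'.
have cst := gconst_constants (D := point_domain c').
have ftl' := lift_sub c'r' ftl.
have gftl : is_lift U pi (ball c' r') fb (fun z => rapp2 act g (ft z)).
  by split; [apply: act_analytic; exact: ftl'.1|exact: hg].
have e1 := chi_def _ _ _ (germ_model c') cst _ _ _ _ _ r'0 (analytic_map_sub c'r' faV) ftl' ha hat.
have e2 := chi_def _ _ _ (germ_model c') cst _ _ _ _ _ r'0 (analytic_map_sub c'r' fbV) gftl hb hbt.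
have ic := @deriv_germ_const R n (point_domain c').
have e3 : same_dvalue chit chit at' bt' by apply/(chit_orbits _ _ cst); exists gK.
exact: (same_dvalue_trans ic e1 (same_dvalue_trans ic e3 (same_dvalue_sym e2))).
Qed.
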